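(* Assume (A1) and (A2) (recalled in the context), let $W\in L^{\widehat u}_+$ satisfy $\sup_{k\in K^W}E[u(y+k)]<u(\infty)$ for some $y>a$, and let $x>a$. Let $(\lambda^*,Q^* )$ be a solution of the dual problem $$\min_{\lambda>0,\;Q\in\mathcal{N}^W}\left\{\lambda\,(x+\|Q_s\|)+E\left[\Phi\left(\lambda\frac{dQ_r}{dP}\right)\right]\right\}$$ and let $f_x=-\Phi'\left(\lambda^*\frac{dQ^*_r}{dP}\right)$. If $f_x-x\in K^W$, then $\|Q^*_s\|=Q^*_s(f_x^-)$. If, in addition, $-f_x^-\in \mathrm{int}(\mathcal{D})$ (or, equivalently, $-(1+\epsilon)f_x^-\in\mathcal{D}$ for some $\epsilon>0$), then $Q^*_s=0$ and, consequently, $Q^*=Q^*_r$ is unique.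
   Context: Market: $T\in(0,\infty]$; $S$ is an $\mathbb{R}^d$-valued càdlàg semimartingale (not necessarily locally bounded) on a filtered probability space $(\Omega,\mathcal{F},(\mathcal{F}_t)_{t\in[0,T]},P)$ satisfying the usual conditions, with $\mathcal{F}_0$ trivial; if $T=\infty$, every process $Y$ considered is assumed to have a limit $Y_\infty=\lim_{t\uparrow\infty}Y_t$. $L(S)$ is the set of $\mathbb{R}^d$-valued predictable $S$-integrable processes and $H\cdot S$ is the stochastic integral. For $W\in L^0_+$, $\mathcal{H}^W=\{H\in L(S): \exists c>0,\ (H\cdot S)_t\ge -cW\ \forall t\le T\}$ and $K^W=\{(H\cdot S)_T: H\in\mathcal{H}^W\}$. Utility: $u:\mathbb{R}\to\mathbb{R}\cup\{-\infty\}$ is increasing, concave on the interior $(a,\infty)$, $a\in[-\infty,0)$, of its effective domain, with $\lim_{x\to-\infty}u(x)=-\infty$ (and $u(x)=-\infty$ for $x<a$ if $a$ is finite); $u(\infty)=\lim_{x\to\infty}u(x)$. $\Phi(y)=\sup_{x\in\mathbb{R}}\{u(x)-xy\}$ for $y\ge0$, $\Phi(0)=u(\infty)$, and $\Phi'(0)=\Phi'(0^+)=-\infty$ by convention. (A1): $u$ is increasing, strictly concave and continuously differentiable on $(a,\infty)$ and $u'(a):=\lim_{x\downarrow a}u'(x)=+\infty$, $\lim_{x\uparrow\infty}u'(x)=0$. (A2): for every $\lambda>0$, $\mathbb{P}_\Phi=\mathbb{P}_{\Phi_\lambda}$, where $\Phi_\lambda(y)=\Phi(\lambda y)$ and, for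 a function $\Psi$, $\mathbb{P}_\Psi$ is the set of probabilities $Q\ll P$ with $E[\Psi(dQ/dP)]<\infty$. Expectations $E[u(\cdot)]$ are set to $-\infty$ whenever the negative part has infinite expectation. Orlicz spaces: $\widehat u(x)=-u(-|x|)+u(0)$, $L^{\widehat u}=\{f\in L^0:\exists\alpha>0,\ E[\widehat u(\alpha f)]<\infty\}$ with the Luxemburg norm $N_{\widehat u}(f)=\inf\{c>0: E[\widehat u(f/c)]\le1\}$ (a Banach lattice); $\widehat\Phi(y)=\sup_{x}\{xy-\widehat u(x)\}$ and $L^{\widehat\Phi}$ is the corresponding Orlicz space. The norm dual decomposes as $(L^{\widehat u})^*=\mathcal{A}\oplus\mathcal{A}^d$, where $\mathcal{A}$ is the band of order-continuous functionals and $\mathcal{A}^d$ is the band of singular functionals, i.e. those lattice-disjoint from $\mathcal{A}$. Each $z$ is uniquely $z=z_r+z_s$ with $z_r\in\mathcal{A}$ (regular part), $z_s\in\mathcal{A}^d$ (singular part). The functional $z_r$ is identified with a density $\frac{dz_r}{dP}\in L^{\widehat\Phi}$ via $z_r(f)=E_{z_r}[f]=E[f\frac{dz_r}{dP}]$. $\|\cdot\|$ is the dual norm on $(L^{\widehat u})^*$. Sets: $\mathcal{D}=\{f\in L^{\widehat u}: E[u(f)]>-\infty\}$ and $\mathrm{int}(\mathcal{D})$ is its norm interior in $L^{\widehat u}$; $C^W=(K^W-L^0_+)\cap L^{\widehat u}$; $(C^W)^0=\{z\in(L^{\widehat u})^*: z(f)\le0\ \forall f\in C^W\}$; $\mathcal{M}^W=\{Q\in(C^W)^0: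 Q(I_\Omega)=1\}$; $\mathcal{L}_\Phi=\{f\in L^0_+: E[\Phi(f)]<\infty\}$; $\mathcal{N}^W=\{Q\in\mathcal{M}^W: Q_r\neq0,\ \frac{dQ_r}{dP}\in\mathcal{L}_\Phi\}$. *)

(* Defs.v *)
From HB Require Import structures.
From mathcomp Require Import all_boot all_order all_algebra.
From mathcomp Require Import all_classical all_reals all_analysis.

Set Implicit Arguments.
Unset Strict Implicit.
Unset Printing Implicit Defensive.

Import Order.TTheory GRing.Theory Num.Theory.
Import numFieldNormedType.Exports.

Local Open Scope classical_set_scope.
Local Open Scope ring_scope.

(* Random variables and processes are genuine functions; an element of L^0 is
   such a function taken up to almost sure equality.  A process is indexed by
   all of R, but only its values on the time set [timeset T] matter. *)

Section StochasticIntegration.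
Context {d : measure_display} {Om : measurableType d} {R : realType}.
Variables (P : probability Om R) (T : \bar R) (F : R -> set (set Om)).

Definition timeset : set R := [set t | 0 <= t /\ (t%:E <= T)%E].

Definition usual_conditions : Prop :=
  [/\ forall t, timeset t -> sigma_algebra setT (F t) /\ F t `<=` measurable,
      forall s t, timeset s -> timeset t -> s <= t -> F s `<=` F t,
      forall t, timeset t -> (t%:E < T)%E ->
        \bigcap_(s in [set s | timeset s /\ t < s]) F s `<=` F t,
      measure_is_complete P
    & P.-negligible `<=` F 0].

Definition trivial_initial : Prop :=
  forall A, F 0 A -> P A = 0%E \/ P A = 1%E.

Definition adapted (X : R -> Om -> R) : Prop :=
  forall t, timeset t -> forall B : set R, measurable B -> F t (X t @^-1` B).

Definition cadlag (f : R -> R) : Prop :=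
  (forall t, timeset t -> (t%:E < T)%E -> f s @[s --> t^'+] --> f t) /\
  (forall t, timeset t -> 0 < t -> cvg (f s @[s --> t^'-])).

Definition cadlag_adapted (X : R -> Om -> R) : Prop :=
  adapted X /\ forall w, cadlag (X ^~ w).

Definition martingale (M : R -> Om -> R) : Prop :=
  [/\ adapted M,
      forall t, timeset t -> P.-integrable setT (EFin \o M t)
    & forall s t A, timeset s -> timeset t -> s <= t -> F s A ->
        (\int[P]_(w in A) (M t w)%:E = \int[P]_(w in A) (M s w)%:E)%E].

Definition stopping_time (tau : Om -> \bar R) : Prop :=
  (forall w, (0 <= tau w)%E) /\
  forall t, timeset t -> F t [set w | (tau w <= t%:E)%E].

Definition stopped (tau : Om -> \bar R) (X : R -> Om -> R) : R -> Om -> R :=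
  fun t w => X (if (t%:E <= tau w)%E then t else fine (tau w)) w.

Definition local_martingale (M : R -> Om -> R) : Prop :=
  cadlag_adapted M /\
  exists tau : nat -> Om -> \bar R,
    [/\ forall n, stopping_time (tau n),
        forall n w, (tau n w <= tau n.+1 w)%E,
        {ae P, forall w, forall t, timeset t ->
           exists n, (t%:E <= tau n w)%E}
      & forall n, martingale (stopped (tau n) M)].

Definition finite_variation (A : R -> Om -> R) : Prop :=
  cadlag_adapted A /\
  forall w t, timeset t -> bounded_variation 0 t (A ^~ w).

Definition semimartingale (X : R -> Om -> R) : Prop :=
  cadlag_adapted X /\
  exists M A, [/\ local_martingale M, finite_variation A
    & forall t w, timeset t -> X t w = M t w + A t w].

Definition predictable_sets : set (set (R * Om)) :=
  <<s timeset `*` setT,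
      [set E | exists A, F 0 A /\ E = [set 0] `*` A] `|`
      [set E | exists s t A, [/\ timeset s, timeset t, F s A
                               & E = [set r | s < r <= t] `*` A]] >>.

Definition predictable (H : R -> Om -> R) : Prop :=
  forall B : set R, measurable B ->
    predictable_sets ((timeset `*` setT) `&` [set p | B (H p.1 p.2)]).

(* Uniform convergence on compact time intervals, in probability. *)
Definition ucp_cvg (Xn : nat -> R -> Om -> R) (X : R -> Om -> R) : Prop :=
  forall t eps : R, timeset t -> 0 < eps ->
    exists N, forall n, (N <= n)%N -> exists B : set Om,
      [/\ measurable B, (P B <= eps%:E)%E
        & forall w, ~ B w -> forall s, 0 <= s <= t ->
            `|Xn n s w - X s w| <= eps].

(* [bdd_int Y H X]: H is bounded and X is (a version of) H . Y, for a scalar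
   semimartingale Y.  It is the least relation that contains the integrals of
   indicators of predictable rectangles ]s, t] x A, is linear, and satisfies
   bounded convergence; by the monotone class theorem it reaches every bounded
   predictable H.  Integrals are over ]0, t], so that the values at time 0 of
   the integrands play no role and (H . Y)_0 = 0. *)
Inductive bdd_int (Y : R -> Om -> R) :
    (R -> Om -> R) -> (R -> Om -> R) -> Prop :=
| bdd_int_rect s t A : timeset s -> timeset t -> s <= t -> F s A ->
    bdd_int Y
      (fun r w => \1_A w * (s < r <= t)%R%:R)
      (fun r w => \1_A w * (Y (Num.min t r) w - Y (Num.min s r) w))
| bdd_int_lin c H1 X1 H2 X2 : bdd_int Y H1 X1 -> bdd_int Y H2 X2 ->
    bdd_int Y (fun r w => c * H1 r w + H2 r w)
              (fun r w => c * X1 r w + X2 r w)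
| bdd_int_lim (Hn Xn : nat -> R -> Om -> R) (H X : R -> Om -> R) (C : R) :
    (forall n, bdd_int Y (Hn n) (Xn n)) ->
    (forall n t w, timeset t -> 0 < t -> `|Hn n t w| <= C) ->
    (forall t w, timeset t -> 0 < t -> Hn n t w @[n --> \oo] --> H t w) ->
    cadlag_adapted X -> ucp_cvg Xn X ->
    bdd_int Y H X.

(* Convergence in Emery's semimartingale topology. *)
Definition emery_cvg (Xn : nat -> R -> Om -> R) (X : R -> Om -> R) : Prop :=
  forall t eps : R, timeset t -> 0 < eps -> exists N, forall n, (N <= n)%N ->
    forall K Z, predictable K ->
      (forall s w, timeset s -> `|K s w| <= 1) ->
      bdd_int (fun s w => Xn n s w - X s w) K Z ->
      (\int[P]_w (Num.min 1 `|Z t w|)%:E <= eps%:E)%E.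

Section Vector.
Context {n : nat}.
Implicit Types S H : R -> Om -> 'rV[R]_n.

Definition coordp (S : R -> Om -> 'rV[R]_n) (i : 'I_n) : R -> Om -> R :=
  fun t w => S t w ord0 i.

Definition truncp (H : R -> Om -> 'rV[R]_n) (m : nat) : R -> Om -> 'rV[R]_n :=
  fun t w => if `|H t w| <= m%:R then H t w else 0.

Definition bdd_int_vec S H (X : R -> Om -> R) : Prop :=
  exists Z : 'I_n -> R -> Om -> R,
    (forall i, bdd_int (coordp S i) (coordp H i) (Z i)) /\
    forall t w, timeset t -> X t w = \sum_(i < n) Z i t w.

(* [stoch_int S H X]: H is in L(S) and X = H . S.  This is the vector stochastic
   integral: H is S-integrable when the integrals of its truncations
   H 1_{|H| <= m} converge in the semimartingale topology, and H . S is the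
   limit.  That topology does not see the value at time 0. *)
Definition stoch_int S H (X : R -> Om -> R) : Prop :=
  [/\ forall i, predictable (coordp H i),
      semimartingale X, {ae P, forall w, X 0 w = 0}
    & exists Xm : nat -> R -> Om -> R,
        (forall m, bdd_int_vec S (truncp H m) (Xm m)) /\ emery_cvg Xm X].

(* k is the value of X at the horizon, a limit when the horizon is infinite. *)
Definition terminal (X : R -> Om -> R) (k : Om -> R) : Prop :=
  {ae P, forall w, match T with
    | t%:E => X t w = k w
    | _ => X t w @[t --> +oo] --> k w
    end}.

Definition market S : Prop :=
  (forall i, semimartingale (coordp S i)) /\
  forall i, exists k, terminal (coordp S i) k.

Definition admissible S (W : Om -> R) H (X : R -> Om -> R) : Prop :=
  stoch_int S H X /\
  exists c : R, 0 < c /\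
    {ae P, forall w, forall t, timeset t -> - (c * W w) <= X t w}.

Definition KW S (W : Om -> R) : set (Om -> R) :=
  [set k : Om -> R | measurable_fun setT k /\
           exists H X, admissible S W H X /\ terminal X k].

End Vector.
End StochasticIntegration.

Section Utility.
Context {R : realType}.
Variables (a : \bar R) (u : R -> \bar R).

Definition utility : Prop :=
  [/\ (a < 0)%E /\ (forall x, u x != +oo%E),
      interior [set x | u x != -oo%E] = [set x | (a < x%:E)%E],
      forall x y, x <= y -> (u x <= u y)%E,
      forall x y t : R, (a < x%:E)%E -> (a < y%:E)%E -> 0 <= t <= 1 ->
        (t%:E * u x + (1 - t)%:E * u y <= u (t * x + (1 - t) * y)%R)%E
    & u x @[x --> -oo] --> -oo%E].

Definition u_infty : \bar R := lim (u x @[x --> +oo]).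

Definition du (x : R) : R := derive1 (fine \o u) x.

Definition assumption_A1 : Prop :=
  [/\ forall x y : R, (a < x%:E)%E -> x < y -> (u x < u y)%E,
      forall x y t : R, (a < x%:E)%E -> (a < y%:E)%E -> x != y -> 0 < t < 1 ->
        (t%:E * u x + (1 - t)%:E * u y < u (t * x + (1 - t) * y)%R)%E,
      forall x : R, (a < x%:E)%E ->
        derivable (fine \o u) x 1 /\ {for x, continuous du},
      match a with
      | r%:E => du x @[x --> r^'+] --> +oo
      | _ => du x @[x --> -oo] --> +oo
      end
    & du x @[x --> +oo] --> (0 : R)].

(* With y = 0 the formula gives sup u = u(oo). *)
Definition Phi (y : R) : \bar R :=
  ereal_sup [set (u x - (x * y)%:E)%E | x in setT].

Definition dPhi (y : R) : \bar R :=
  if y == 0 then -oo%E else (derive1 (fine \o Phi) y)%:E.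

Definition uhat (x : R) : \bar R := (- u (- `|x|)%R + u 0)%E.

End Utility.

Section Assumption2.
Context {d : measure_display} {Om : measurableType d} {R : realType}.
Variable P : probability Om R.

(* The set of probabilities Q << P with E[Psi(dQ/dP)] < oo. *)
Definition finite_entropy (Psi : R -> \bar R) : set (probability Om R) :=
  [set Q : probability Om R | Q `<< P /\
     (\int[P]_w Psi (fine (Radon_Nikodym (charge_of_finite_measure Q) P w))
        < +oo)%E].

Definition assumption_A2 (u : R -> \bar R) : Prop :=
  forall lam : R, 0 < lam ->
    finite_entropy (Phi u) = finite_entropy (fun y => Phi u (lam * y)).

End Assumption2.

Section Orlicz.
Context {d : measure_display} {Om : measurableType d} {R : realType}.
Variables (P : probability Om R) (G : R -> \bar R).

Definition orlicz : set (Om -> R) :=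
  [set f : Om -> R | measurable_fun setT f /\
     exists alpha : R, 0 < alpha /\ (\int[P]_w G (alpha * f w)%R < +oo)%E].

Definition luxemburg (f : Om -> R) : R :=
  inf [set c : R | 0 < c /\ (\int[P]_w G (f w / c)%R <= 1)%E].

Definition conjugate (y : R) : \bar R :=
  ereal_sup [set ((x * y)%:E - G x)%E | x in setT].

(* A functional is evaluated on representatives and only its values on the
   Orlicz space matter; boundedness for the Luxemburg norm forces the values at
   almost surely equal functions to agree. *)
Implicit Types (z m : (Om -> R) -> R) (f g h : Om -> R).

Definition is_dual z : Prop :=
  (forall c f g, orlicz f -> orlicz g ->
     z (fun w => c * f w + g w) = c * z f + z g) /\
  exists C : R, forall f, orlicz f -> `|z f| <= C * luxemburg f.

Definition dual_norm z : R :=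
  sup [set `|z f| | f in [set f : Om -> R | orlicz f /\ luxemburg f <= 1]].

Definition ae_le f g : Prop := {ae P, forall w, f w <= g w}.

Definition dual_eq z z' : Prop := forall f, orlicz f -> z f = z' f.

Definition dual_zero z : Prop := forall f, orlicz f -> z f = 0.

Definition dual_le z z' : Prop :=
  forall f, orlicz f -> ae_le (cst 0) f -> z f <= z' f.

(* m is the modulus of z, i.e. the supremum of z and - z in the dual. *)
Definition is_modulus z m : Prop :=
  [/\ is_dual m, dual_le z m, dual_le (fun f => - z f) m
    & forall m', is_dual m' -> dual_le z m' -> dual_le (fun f => - z f) m' ->
        dual_le m m'].

Definition lattice_disjoint z z' : Prop :=
  exists m m', [/\ is_modulus z m, is_modulus z' m'
    & forall v, is_dual v -> dual_le v m -> dual_le v m' ->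
        dual_le v (fun=> 0)].

(* z sends every net f that converges in order to 0, i.e. with |f| <= g for some
   net g decreasing to 0, to a net converging to 0. *)
Definition order_continuous z : Prop :=
  is_dual z /\
  forall (I : Type) (le : I -> I -> Prop) (f g : I -> Om -> R),
    inhabited I ->
    (forall i, le i i) ->
    (forall i j k, le i j -> le j k -> le i k) ->
    (forall i j, exists k, le i k /\ le j k) ->
    (forall i, orlicz (f i) /\ orlicz (g i)) ->
    (forall i, ae_le (fun w => `|f i w|) (g i)) ->
    (forall i j, le i j -> ae_le (g j) (g i)) ->
    (forall h, orlicz h -> (forall i, ae_le h (g i)) -> ae_le h (cst 0)) ->
    forall eps : R, 0 < eps -> exists i0, forall i, le i0 i -> `|z (f i)| <= eps.

Definition singular z : Prop :=
  is_dual z /\ forall z', order_continuous z' -> lattice_disjoint z z'.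

(* z = zr + zs with zr regular and zs singular, and phi = d zr / dP. *)
Definition decomposes z zr zs (phi : Om -> R) : Prop :=
  [/\ order_continuous zr, singular zs,
      forall f, orlicz f -> z f = zr f + zs f
    & forall f, orlicz f -> (zr f)%:E = (\int[P]_w (f w * phi w)%:E)%E].

End Orlicz.

Section DualProblem.
Context {d : measure_display} {Om : measurableType d} {R : realType}.
Variables (P : probability Om R) (T : \bar R) (F : R -> set (set Om)).
Context {n : nat}.
Variables (S : R -> Om -> 'rV[R]_n) (u : R -> \bar R) (W : Om -> R).

Local Notation Lu := (orlicz P (uhat u)).

(* The library's integral is -oo as soon as that of the negative part is +oo. *)
Definition expected_utility (f : Om -> R) : \bar R := (\int[P]_w u (f w))%E.

Definition Dset : set (Om -> R) :=
  [set f : Om -> R | Lu f /\ (-oo < expected_utility f)%E].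

Definition intDset : set (Om -> R) :=
  [set f : Om -> R | Lu f /\ exists delta : R, 0 < delta /\
     forall g, Lu g -> luxemburg P (uhat u) (fun w => g w - f w) < delta ->
       Dset g].

Definition CW : set (Om -> R) :=
  [set f : Om -> R | Lu f /\ exists k g : Om -> R,
     [/\ KW P T F S W k, measurable_fun setT g, ae_le P (cst 0) g
       & {ae P, forall w, f w = k w - g w}]].

Definition polarCW : set ((Om -> R) -> R) :=
  [set z : (Om -> R) -> R |
     is_dual P (uhat u) z /\ forall f, CW f -> z f <= 0].

Definition MW : set ((Om -> R) -> R) :=
  [set Q : (Om -> R) -> R | polarCW Q /\ Q (cst 1) = 1].

Definition LPhi : set (Om -> R) :=
  [set f : Om -> R | [/\ measurable_fun setT f, ae_le P (cst 0) f
             & (\int[P]_w Phi u (f w) < +oo)%E]].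

(* [parts Q Qr Qs phi]: Qr and Qs are the regular and singular parts of Q, and
   phi = dQr/dP, an element of the Orlicz space of the conjugate function. *)
Definition parts (Q Qr Qs : (Om -> R) -> R) (phi : Om -> R) : Prop :=
  decomposes P (uhat u) Q Qr Qs phi /\ orlicz P (conjugate (uhat u)) phi.

Definition NW : set ((Om -> R) -> R) :=
  [set Q : (Om -> R) -> R | MW Q /\ exists Qr Qs phi,
     [/\ parts Q Qr Qs phi, ~ dual_zero P (uhat u) Qr & LPhi phi]].

Definition dual_objective (x lam : R) (Qs : (Om -> R) -> R) (phi : Om -> R)
    : \bar R :=
  ((lam * (x + dual_norm P (uhat u) Qs))%:E
   + \int[P]_w Phi u (lam * phi w)%R)%E.

(* (lam, Q) minimizes the dual objective over ]0, oo[ x NW. *)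
Definition dual_solution (x lam : R) (Q Qr Qs : (Om -> R) -> R)
    (phi : Om -> R) : Prop :=
  [/\ 0 < lam, NW Q, parts Q Qr Qs phi
    & forall lam' Q' Qr' Qs' phi', 0 < lam' -> NW Q' -> parts Q' Qr' Qs' phi' ->
        (dual_objective x lam Qs phi <= dual_objective x lam' Qs' phi')%E].

(* f_x, which is +oo where phi vanishes. *)
Definition optimal_claim (lam : R) (phi : Om -> R) : Om -> \bar R :=
  fun w => (- dPhi u (lam * phi w))%E.

Definition optimal_loss (lam : R) (phi : Om -> R) : Om -> R :=
  fun w => fine (maxe (- optimal_claim lam phi w) 0)%E.

(* Membership of an extended real valued function in K^W. *)
Definition in_KW (f : Om -> \bar R) : Prop :=
  exists k, KW P T F S W k /\ {ae P, forall w, f w = (k w)%:E}.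

End DualProblem.

(* Main.v *)
Require Import Defs.
From HB Require Import structures.
From mathcomp Require Import all_boot all_order all_algebra.
From mathcomp Require Import all_classical all_reals all_analysis.
From mathcomp Require Import measurable_realfun ring lra.

Set Implicit Arguments.
Unset Strict Implicit.
Unset Printing Implicit Defensive.

Import Order.TTheory GRing.Theory Num.Theory.
Import numFieldNormedType.Exports.

Local Open Scope classical_set_scope.
Local Open Scope ring_scope.

(* Truncating f_x - x from above gives elements of C^W, which shows that Q >= 0
   and that E[phi f_x] <= x + Qs(f_x^-).  Lowering lam while keeping Q fixed gives
   the opposite first order condition x + ||Qs|| <= E[phi f_x]; together these
   yield ||Qs|| <= Qs(f_x^-).  The converse is the general fact that z(g) <= ||z|| for
   a positive singular z whenever g >= 0 and E[uhat(g)] is finite: z charges g only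
   on sets of arbitrarily small probability, by a Yosida-Hewitt argument (the
   countably additive part of A |-> z(g 1_A) has a density, hence defines an order
   continuous functional below z, hence vanishes).

   If moreover (1 + e) f_x^- has a finite modular, the same fact gives
   (1 + e) Qs(f_x^-) <= ||Qs|| = Qs(f_x^-), so Qs = 0.  A second solution is averaged
   with the first one; strict convexity of Phi gives lam phi = lam' phi' almost
   surely, so both solutions have the same f_x, both singular parts vanish, and
   Q(1) = Q'(1) = 1 gives lam = lam'. *)

(** * The utility function and its conjugate *)

Section RealFacts.
Context {R : realType}.

(** Membership of [f_x - x] in [K^W] does two further jobs. As [Phi'(0) = -oo], it forces [phi > 0]
    almost surely; and it bounds [f_x^-] by a multiple of [W] plus a constant, so the loss lies in
    the Orlicz space. Nothing is controlled from above, which is why claims have to be truncated.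
    (A2) makes [Phi(s phi)] integrable for every [s > 0], and this supplies the dominating function
    for the difference quotients in [lam]. The finite modular of [f_x^-] comes from [Phi(y) >= u(0)]
    at [y = lam phi], which on losses reads [uhat(f_x^-) <= lam phi f_x^-]. The obstacle is the
    singular part. Singularity is expressed through moduli and the dual is never shown to be a
    vector lattice, so signs and uniqueness of the parts are not read off from band projections.
    They come from the minimality of the modulus and from one principle: a nonnegative density whose
    functional lies below every modulus of a singular functional vanishes. *)

Lemma derivable1_quotient (f : R -> R) (x e : R) : derivable f x 1 -> 0 < e ->
  exists2 d, 0 < d & forall h, h != 0 -> `|h| < d ->
    `|derive1 f x - (f (x + h) - f x) / h| < e.
Proof.
move=> df e0.
have : h^-1 *: ((f \o shift x) (h *: (1 : R)) - f x) @[h --> (0:R)^'] --> derive1 f x.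
  by rewrite derive1E; exact: df.
move=> /cvgrPdist_lt /(_ _ e0).
rewrite near_withinE => /nbhs_ballP[d /= d0 hd].
exists d => // h h0 hlt.
have := hd h; rewrite /ball/= sub0r normrN => /(_ hlt h0).
rewrite /= /GRing.scale /= mulr1.
by rewrite mulrC [h + x]addrC.
Qed.

Lemma derive1_quotient (f : R -> R) (x l : R) :
  (forall e, 0 < e -> exists2 d, 0 < d & forall h, h != 0 -> `|h| < d ->
    `|l - (f (x + h) - f x) / h| < e) -> derive1 f x = l.
Proof.
move=> H; rewrite /derive1; apply: cvg_lim => //.
apply/cvgrPdist_lt => e /H[d d0 hd].
rewrite near_withinE; apply/nbhs_ballP; exists d => //= h.
rewrite /ball/= sub0r normrN => hlt h0.
have := hd _ h0 hlt.
by rewrite /GRing.scale /= [_^-1 * _]mulrC [h + x]addrC.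
Qed.

Lemma is_interval_nondecreasing_measurable (D : set R) (f : R -> \bar R) :
  is_interval D ->
  (forall s t, D s -> D t -> s <= t -> (f s <= f t)%E) ->
  measurable_fun D f.
Proof.
move=> iD fnd mD.
apply: (measurability _ (ErealGenCInfty.measurableE R)) => // _ [_ [r ->] <-].
apply: is_interval_measurable => s t /= [Ds]; rewrite in_itv/= !andbT => fs [Dt ft].
move=> z /andP[sz zt]; split; first by apply: (iD _ _ Ds Dt); rewrite sz zt.
rewrite /= in_itv/= !andbT; apply: le_trans fs _; apply: fnd => //.
by apply: (iD _ _ Ds Dt); rewrite sz zt.
Qed.

End RealFacts.

Section UtilityFacts.
Context {R : realType}.
Variables (a : \bar R) (u : R -> \bar R).
Hypotheses (hu : utility a u) (hA1 : assumption_A1 a u).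
Local Notation v := (fine \o u).

Lemma utility_neq_pinfty x : u x != +oo%E.
Proof. by have [[_ +] _ _ _ _] := hu. Qed.

Lemma utility_nondecreasing x y : x <= y -> (u x <= u y)%E.
Proof. by have [_ _ + _ _] := hu; exact. Qed.

Lemma utility_fin x : (a < x%:E)%E -> u x = (v x)%:E.
Proof.
move=> ax; rewrite /= fineK//.
have [_ dom _ _ _] := hu.
have : interior [set x | u x != -oo%E] x by rewrite dom.
move/interior_subset => /= ux.
by rewrite fin_numE ux utility_neq_pinfty.
Qed.

(** If [u] were finite at [x], monotonicity would make it finite on []x, +oo[], so this open set
    would lie in the interior []a, +oo[] of the domain, whence [a <= x]. *)
Lemma utility_low x : (x%:E < a)%E -> u x = -oo%E.
Proof.
move=> xa; apply/eqP; apply: contraTT xa => ux; rewrite -leNgt.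
have [_ dom nd _ _] := hu.
have H y : x < y -> (a < y%:E)%E.
  move=> xy; suff : interior [set x | u x != -oo%E] y by rewrite dom.
  apply/nbhs_ballP; exists (y - x) => /=; first by rewrite subr_gt0.
  move=> z /=; rewrite /ball/= => hz.
  have xz : x < z by move: hz; rewrite ltr_distl; lra.
  apply: contra ux => /eqP uz.
  by rewrite -leeNy_eq -uz utility_nondecreasing// ltW.
case: a H => [r| |] H.
- rewrite lee_fin; apply/ler_addgt0Pr => e e0.
  by rewrite -lee_fin ltW// H// ltrDl.
- have /H : x < x + 1 by rewrite ltrDl.
  by rewrite ltNge leey.
- exact: leNye.
Qed.

Lemma utility0 : (a < 0%:E)%E. Proof. by have [[]] := hu. Qed.

Lemma utility_dom_le x y : (a < x%:E)%E -> x <= y -> (a < y%:E)%E.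
Proof. by move=> ax xy; apply: lt_le_trans ax _; rewrite lee_fin. Qed.

Lemma utility_strict_concave x y t : (a < x%:E)%E -> (a < y%:E)%E -> x != y ->
  0 < t < 1 -> t * v x + (1 - t) * v y < v (t * x + (1 - t) * y).
Proof.
move=> ax ay xy t01; have [_ h _ _ _] := hA1.
have axy : (a < (t * x + (1 - t) * y)%:E)%E.
  have [xley|/ltW ylex] := leP x y.
    by apply: (utility_dom_le ax); move: t01; nra.
  by apply: (utility_dom_le ay); move: t01; nra.
have := h x y t ax ay xy t01.
by rewrite (utility_fin ax) (utility_fin ay) (utility_fin axy) -!EFinM -EFinD lte_fin.
Qed.

(** If [z'] were above the tangent, the chord slope [s] from [m] to [z'] would be on the wrong side
    of [u'(m)]. By strict concavity the slopes [q] of chords to points closer to [m] are even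
    further away, so they cannot converge to [u'(m)]. *)
Lemma utility_below_tangent m z : (a < m%:E)%E -> (a < z%:E)%E -> z != m ->
  v z < v m + du u m * (z - m).
Proof.
move=> am az zm.
have weak z' : (a < z'%:E)%E -> z' != m -> v z' <= v m + du u m * (z' - m).
  move=> az' z'm; rewrite leNgt; apply/negP => hlt.
  have [_ _ h _ _] := hA1; have [dm _] := h _ am.
  set s := (v z' - v m) / (z' - m).
  have z'm0 : z' - m != 0 by rewrite subr_eq0.
  have es : v z' = v m + s * (z' - m) by rewrite /s mulfVK//; lra.
  have sd : (s - du u m) * (z' - m) > 0 by rewrite mulrBl; lra.
  have sd0 : s - du u m != 0 by apply: contraTneq sd => ->; rewrite mul0r ltxx.
  have e0 : 0 < `|s - du u m| by rewrite normr_gt0.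
  have [d d0 hd] := derivable1_quotient dm e0.
  (* Small enough for [m + t (z' - m)] to fall where the difference quotient is within [|s - u'(m)|]
     of [u'(m)]. *)
  pose t := Num.min (2^-1) (d / 2 / `|z' - m|).
  have t0 : 0 < t by rewrite lt_min invr_gt0 ltr0n/= divr_gt0 ?normr_gt0// divr_gt0.
  have t1 : t < 1 by apply: (@le_lt_trans _ _ (2^-1)); rewrite ?ge_min ?lexx//; lra.
  have h0 : t * (z' - m) != 0 by rewrite mulf_neq0// gt_eqF.
  have hdl : `|t * (z' - m)| < d.
    rewrite normrM (gtr0_norm t0).
    have : t <= d / 2 / `|z' - m| by rewrite ge_min lexx orbT.
    rewrite ler_pdivlMr ?normr_gt0//; lra.
  have := hd _ h0 hdl.
  have t01 : 0 < t < 1 by rewrite t0.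
  have := utility_strict_concave az' am z'm t01.
  have -> : t * z' + (1 - t) * m = m + t * (z' - m) by ring.
  move=> hc; apply/negP; rewrite -leNgt.
  set q := (_ / _).
  have hq : v (m + t * (z' - m)) = v m + q * (t * (z' - m)) by rewrite /q mulfVK//; lra.
  have hh : 0 < (q - s) * (z' - m).
    have : 0 < t * ((q - s) * (z' - m)).
      move: hc; rewrite hq es; move=> hc.
      have -> : t * ((q - s) * (z' - m)) = (q * (t * (z' - m))) - t * (s * (z' - m)) by ring.
      by move: hc; rewrite mulrDr; lra.
    by rewrite pmulr_rgt0.
  have [zlt|zgt] := ltP 0 (z' - m).
    have s1 : 0 < q - s by move: hh; rewrite pmulr_lgt0.
    have s2 : 0 < s - du u m by move: sd; rewrite pmulr_lgt0.
    rewrite -/(du u m) (gtr0_norm s2) distrC ger0_norm; lra.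
  have zlt : z' - m < 0 by rewrite lt_neqAle z'm0.
  have s1 : q - s < 0 by move: hh; rewrite nmulr_lgt0.
  have s2 : s - du u m < 0 by move: sd; rewrite nmulr_lgt0.
  rewrite -/(du u m) (ltr0_norm s2) ger0_norm; lra.
(* Strictness at [z] follows from the weak bound at this midpoint and strict concavity. *)
pose w := 2^-1 * z + (1 - 2^-1) * m.
have h2 : 0 < (2^-1 : R) < 1 by apply/andP; split; lra.
have hw := utility_strict_concave az am zm h2.
have aw : (a < w%:E)%E.
  rewrite /w; have [xley|/ltW ylex] := leP z m.
    by apply: (utility_dom_le az); lra.
  by apply: (utility_dom_le am); lra.
have wm : w != m.
  by rewrite -subr_eq0 (_ : w - m = 2^-1 * (z - m)) ?mulf_neq0 ?subr_eq0 ?invr_eq0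
    ?pnatr_eq0// /w; lra.
have := weak w aw wm; rewrite -/w in hw.
have -> : w - m = 2^-1 * (z - m) by rewrite /w; lra.
have -> : du u m * (2^-1 * (z - m)) = 2^-1 * (du u m * (z - m)) by ring.
move: hw; lra.
Qed.

Lemma du_decreasing m m' : (a < m%:E)%E -> m < m' -> du u m' < du u m.
Proof.
move=> am mm'; have am' := utility_dom_le am (ltW mm').
have h1 := utility_below_tangent am am' (negbT (gt_eqF mm')).
have h2 := utility_below_tangent am' am (negbT (lt_eqF mm')).
rewrite -subr_gt0 -(@pmulr_lgt0 _ (m' - m)) ?subr_gt0// mulrBl.
move: h1 h2; rewrite -(opprB m' m) mulrN; lra.
Qed.

Lemma du_gt0 m : (a < m%:E)%E -> 0 < du u m.
Proof.
move=> am; have mm' : m < m + 1 by rewrite ltrDl.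
have am' := utility_dom_le am (ltW mm').
have := utility_below_tangent am am' (negbT (gt_eqF mm')).
have [h _ _ _ _] := hA1.
have := h _ _ am mm'; rewrite (utility_fin am) (utility_fin am') lte_fin.
have -> : m + 1 - m = 1 by ring.
lra.
Qed.

(** The delicate point is the endpoint [a], where [u] may be finite: monotonicity compares [u z]
    with the value at [z + e / u'(m)], a shift that raises the tangent by exactly [e]. *)
Lemma utility_le_tangent m z : (a < m%:E)%E ->
  (u z <= (v m + du u m * (z - m))%:E)%E.
Proof.
move=> am.
have H z' : (a < z'%:E)%E -> (u z' <= (v m + du u m * (z' - m))%:E)%E.
  move=> az'; rewrite utility_fin// lee_fin.
  have [->|zm] := eqVneq z' m; first by rewrite subrr mulr0 addr0.
  exact/ltW/utility_below_tangent.
have [za|az] := leP z%:E a; last exact: H.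
have [zlt|zge] := ltP z%:E a; first by rewrite utility_low// leNye.
apply/lee_addgt0Pr => e e0.
have p0 := du_gt0 am.
have az' : (a < (z + e / du u m)%:E)%E.
  by apply: le_lt_trans zge _; rewrite lte_fin ltrDl divr_gt0.
apply: (le_trans (utility_nondecreasing (_ : z <= z + e / du u m))).
  by rewrite lerDl ltW// divr_gt0.
apply: le_trans (H _ az') _; rewrite -EFinD lee_fin.
rewrite le_eqVlt; apply/orP; left; apply/eqP; field.
by rewrite gt_eqF.
Qed.

(** The limits of [u'] at the two ends of the domain bracket [y], and the intermediate value theorem
    applies. *)
Lemma du_surj y : 0 < y -> exists m, (a < m%:E)%E /\ du u m = y.
Proof.
move=> y0; have [_ _ hd ha hinf] := hA1.
have [m1 [am1 hm1]] : exists m, (a < m%:E)%E /\ y < du u m.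
  have := utility0; case: a ha => [r| |] //.
    move=> /cvgryPgt /(_ y); rewrite near_withinE => /nbhs_ballP[e /= e0 he] _.
    exists (r + e / 2); split; first by rewrite lte_fin ltrDl divr_gt0.
    apply: he; last by rewrite /= ltrDl divr_gt0.
    by rewrite /ball/= opprD addrA subrr sub0r normrN gtr0_norm ?divr_gt0//; lra.
  move=> /cvgryPgt /(_ y) [M [_ hM]] _; exists (M - 1); split; first exact: ltNyr.
  by apply: hM; rewrite gtrBl.
have [m2 [m12 hm2]] : exists m, m1 <= m /\ du u m < y.
  move/cvgrPdist_lt : hinf => /(_ _ y0) [M [_ hM]].
  exists (Num.max m1 (M + 1)); split; first by rewrite le_max lexx.
  have := hM (Num.max m1 (M + 1)); rewrite sub0r normrN => h.
  apply: le_lt_trans (ler_norm _) (h _).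
  by apply: (@lt_le_trans _ _ (M + 1)); rewrite ?ltrDl// le_max lexx orbT.
have cdu : {within `[m1, m2], continuous (du u)}.
  apply: continuous_in_subspaceT => x /set_mem /=; rewrite in_itv/= => /andP[m1x _].
  have ax := utility_dom_le am1 m1x.
  by have [_ +] := hd x ax.
have [|m mm em] := @IVT _ _ m1 m2 y m12 cdu.
  by rewrite ge_min le_max (ltW hm1) (ltW hm2) orbT.
exists m; split => //; apply: (utility_dom_le am1).
by move: mm; rewrite in_itv/= => /andP[].
Qed.

(** Concavity is assumed on the open domain only. Points outside it, the endpoint [a] included, are
    handled by the tangent at the convex combination [m]: both values lie below it, and it averages
    to [v m]. *)
Lemma utility_concave x y t : 0 <= t <= 1 ->
  (t%:E * u x + (1 - t)%:E * u y <= u (t * x + (1 - t) * y)%R)%E.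
Proof.
move=> /andP[t0 t1].
have [->|tn0] := eqVneq t 0.
  by rewrite mul0e add0e subr0 mul1e mul0r add0r mul1r.
have [->|tn1] := eqVneq t 1.
  by rewrite subrr mul0e adde0 mul1e mul0r addr0 mul1r.
have {}t0 : 0 < t by rewrite lt_neqAle eq_sym tn0.
have {}t1 : 0 < 1 - t by rewrite subr_gt0 lt_neqAle tn1.
have [xa|xa] := ltP x%:E a.
  by rewrite (utility_low xa) gt0_muleNy ?lte_fin// addNye leNye.
have [ya|ya] := ltP y%:E a.
  by rewrite (utility_low ya) gt0_muleNy ?lte_fin// addeNy leNye.
have [<-|xy] := eqVneq x y.
  have -> : t * x + (1 - t) * x = x by ring.
  case ux : (u x) => [r| |]; [|by move/eqP: ux; rewrite (negbTE (utility_neq_pinfty _))|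
     by rewrite gt0_muleNy ?lte_fin// addNye leNye].
  by rewrite -!EFinM -EFinD lee_fin -mulrDl addrC subrK mul1r.
set m := t * x + (1 - t) * y.
have am : (a < m%:E)%E.
  have [xly|ylx] : x < y \/ y < x by case: (ltgtP x y) xy => //; auto.
    by apply: le_lt_trans xa _; rewrite lte_fin /m; nra.
  by apply: le_lt_trans ya _; rewrite lte_fin /m; nra.
have hx := utility_le_tangent x am; have hy := utility_le_tangent y am.
rewrite (utility_fin am).
apply: (@le_trans _ _ (t%:E * (v m + du u m * (x - m))%:E +
   (1 - t)%:E * (v m + du u m * (y - m))%:E)%E).
  by apply: leeD; apply: lee_wpmul2l => //; rewrite lee_fin ltW.
rewrite -!EFinM -EFinD lee_fin.
rewrite le_eqVlt; apply/orP; left; apply/eqP.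
rewrite /m; ring.
Qed.

(** The inverse of marginal utility, that is [- Phi'] on []0, +oo[]; it is the maximizer in the
    definition of [Phi y], and [f_x] is its value at [lam * phi]. *)
Definition inv_du y : R := xget 0 [set m | (a < m%:E)%E /\ du u m = y].
Local Notation I := inv_du.

Lemma inv_du_spec y : 0 < y -> (a < (I y)%:E)%E /\ du u (I y) = y.
Proof.
by move=> y0; rewrite /inv_du; case: xgetP => [m _ //|h];
   have [m hm] := du_surj y0; have := h m.
Qed.

Lemma inv_du_nonincreasing y z : 0 < y -> y <= z -> I z <= I y.
Proof.
move=> y0 yz; have [h1 h2] := inv_du_spec y0.
have [h3 h4] := inv_du_spec (lt_le_trans y0 yz).
rewrite leNgt; apply/negP => h; have := du_decreasing h1 h.
by rewrite h2 h4 ltNge yz.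
Qed.

Lemma inv_du_cont y e : 0 < y -> 0 < e -> exists2 d, 0 < d &
  forall z, 0 < z -> `|z - y| < d -> `|I z - I y| < e.
Proof.
move=> y0 e0; have [h1 h2] := inv_du_spec y0.
(* [e'] is reduced so that [I y - e'] stays in the domain, where [u'] is strictly decreasing. *)
have [e' [e'0 e'e ha]] : exists e', [/\ 0 < e', e' <= e & (a < (I y - e')%:E)%E].
  case: a h1 => [r| |]//.
    rewrite lte_fin => h1; exists (Num.min e ((I y - r) / 2)).
    rewrite lt_min e0 ge_min lexx divr_gt0 ?subr_gt0//; split=> //.
    rewrite lte_fin.
    have : Num.min e ((I y - r) / 2) <= (I y - r) / 2 by rewrite ge_min lexx orbT.
    by lra.
  by exists e; split => //; exact: ltNyr.
have l1 : I y - e' < I y by rewrite gtrBl.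
have l2 : I y < I y + e' by rewrite ltrDl.
have d1 := du_decreasing ha l1; have d2 := du_decreasing h1 l2.
exists (Num.min (du u (I y - e') - du u (I y)) (du u (I y) - du u (I y + e'))).
  by rewrite lt_min !subr_gt0 d1.
move=> z z0; rewrite lt_min => /andP[]; rewrite !h2 in d1 d2 *.
have [h3 h4] := inv_du_spec z0.
rewrite !ltr_distl => /andP[_ A] /andP[B _].
have A' : I y - e' < I z.
  rewrite ltNge; apply/negP => hle.
  have : du u (I y - e') <= du u (I z).
    move: hle; rewrite le_eqVlt => /orP[/eqP ->//|lt]; exact/ltW/du_decreasing.
  by rewrite h4; move: A; lra.
have B' : I z < I y + e'.
  rewrite ltNge; apply/negP => hle.
  have : du u (I z) <= du u (I y + e').
    move: hle; rewrite le_eqVlt => /orP[/eqP ->//|lt].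
    by apply/ltW/du_decreasing => //; exact: utility_dom_le h1 (ltW l2).
  by rewrite h4; move: B; lra.
by apply/andP; split; lra.
Qed.

Lemma Phi_ge y z : (u z - (z * y)%:E <= Phi u y)%E.
Proof. by apply: ereal_sup_ubound; exists z. Qed.

Lemma Phi_ge_fin y z : (a < z%:E)%E -> ((v z - z * y)%:E <= Phi u y)%E.
Proof. by move=> az; rewrite EFinB -utility_fin//; exact: Phi_ge. Qed.

Lemma Phi_pos y : 0 < y -> Phi u y = (v (I y) - I y * y)%:E.
Proof.
move=> y0; have [h1 h2] := inv_du_spec y0.
apply/eqP; rewrite eq_le Phi_ge_fin// andbT.
apply: ge_ereal_sup => _ [z _ <-].
apply: (@le_trans _ _ ((v (I y) + du u (I y) * (z - I y))%:E - (z * y)%:E)%E).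
  by apply: leeB => //; exact: utility_le_tangent.
by rewrite -EFinB lee_fin h2; lra.
Qed.

Lemma Phi_strict y z : 0 < y -> (a < z%:E)%E -> z != I y ->
  v z - z * y < fine (Phi u y).
Proof.
move=> y0 az zI; have [h1 h2] := inv_du_spec y0.
rewrite Phi_pos//=; have := utility_below_tangent h1 az zI; rewrite h2.
by rewrite /=; lra.
Qed.

(** The maximizer for either point is a competitor for the other. This two-sided bound will control
    the difference quotients of the dual objective in [lam]. *)
Lemma Phi_slope y z : 0 < y -> y < z ->
  I z * (z - y) <= fine (Phi u y) - fine (Phi u z) <= I y * (z - y).
Proof.
move=> y0 yz; have z0 := lt_trans y0 yz.
have [h1 _] := inv_du_spec y0; have [h3 _] := inv_du_spec z0.
have b1 := Phi_ge_fin y h3; have b2 := Phi_ge_fin z h1.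
move: b1 b2; rewrite !Phi_pos// !lee_fin /= => b1 b2.
by apply/andP; split; lra.
Qed.

Lemma Phi_neg y : y < 0 -> Phi u y = +oo%E.
Proof.
move=> y0; apply/eqyP => A A0.
have a0 := utility0.
(* Chosen so that [- z y = A + |u 0|]; as [u z >= u 0], the competitor [z] gives at least [A]. *)
pose z := (A + `|v 0|) / (- y).
have z0 : 0 <= z by rewrite /z divr_ge0//; [rewrite addr_ge0//; exact: ltW|lra].
have az := utility_dom_le a0 z0.
apply: le_trans (Phi_ge_fin y az); rewrite lee_fin.
have -> : z * y = - (A + `|v 0|) by rewrite /z; field; rewrite lt_eqF.
have := utility_nondecreasing z0; rewrite (utility_fin a0) (utility_fin az) lee_fin.
by have := ler_norm (- v 0); rewrite normrN; lra.
Qed.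

Lemma Phi_ge_u0 y : (u 0 <= Phi u y)%E.
Proof. by have := Phi_ge y 0; rewrite mul0r sube0. Qed.

Lemma Phi_convex x y t : 0 <= t <= 1 ->
  (Phi u (t * x + (1 - t) * y)%R <= t%:E * Phi u x + (1 - t)%:E * Phi u y)%E.
Proof.
move=> /andP[t0 t1]; apply: ge_ereal_sup => _ [z _ <-].
have [->|uz] := eqVneq (u z) -oo%E; first by rewrite addNye leNye.
have uzf : u z = (v z)%:E.
  by rewrite /= fineK// fin_numE uz utility_neq_pinfty.
apply: (@le_trans _ _ (t%:E * (v z - z * x)%:E + (1 - t)%:E * (v z - z * y)%:E)%E).
  by rewrite uzf -EFinB -!EFinM -EFinD lee_fin /=; lra.
apply: leeD; apply: lee_wpmul2l => //; rewrite ?lee_fin ?subr_ge0//.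
  by rewrite EFinB -uzf; exact: Phi_ge.
by rewrite EFinB -uzf; exact: Phi_ge.
Qed.

(** If [y] and [z] differ, the maximizer at the midpoint is not the maximizer at [y], since [u']
    takes different values there. It is thus strictly suboptimal at [y] and at best optimal at [z],
    which contradicts the assumed inequality. The point [z] is allowed to be 0. *)
Lemma Phi_midpoint_inj y z : 0 < y -> 0 <= z ->
  (2^-1%:E * Phi u y + 2^-1%:E * Phi u z <= Phi u (2^-1 * y + 2^-1 * z)%R)%E -> y = z.
Proof.
move=> y0 z0; set m := 2^-1 * y + 2^-1 * z => h.
have m0 : 0 < m by rewrite /m; lra.
have [am dm] := inv_du_spec m0; have [ay dy] := inv_du_spec y0.
apply: contrapT => yz.
have IyIm : I m != I y.
  by apply/eqP => e; apply: yz; move: dm; rewrite e dy /m; lra.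
have h1 := Phi_strict y0 am IyIm; have h2 := Phi_ge_fin z am.
have h3 : ((2^-1 * fine (Phi u y) + 2^-1 * (v (I m) - I m * z))%:E <= Phi u m)%E.
  apply: le_trans h; rewrite EFinD EFinM EFinM; apply: leeD.
    by rewrite (Phi_pos y0).
  by apply: lee_wpmul2l => //; rewrite lee_fin; lra.
have e i : i * m = 2^-1 * (i * y) + 2^-1 * (i * z) by rewrite /m; ring.
by move: h1 h3; rewrite (Phi_pos m0) lee_fin e; lra.
Qed.

(** Envelope theorem: the difference quotient lies between [- I y] and [- I (y + h)], and [I] is
    continuous. *)
Lemma dPhi_pos y : 0 < y -> dPhi u y = (- I y)%:E.
Proof.
move=> y0; rewrite /dPhi gt_eqF//; congr EFin.
apply: derive1_quotient => e e0.
have [d d0 hd] := inv_du_cont y0 e0.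
exists (Num.min d y); first by rewrite lt_min d0.
move=> h h0; rewrite lt_min => /andP[hlt hy].
have yh0 : 0 < y + h by have := ler_norm (- h); rewrite normrN; lra.
have [h1 h2] := inv_du_spec y0; have [h3 h4] := inv_du_spec yh0.
have cl := hd _ yh0; rewrite (_ : y + h - y = h) in cl; last by lra.
apply: le_lt_trans (cl hlt).
have b1 := Phi_ge_fin (y + h) h1; have b2 := Phi_ge_fin y h3.
rewrite Phi_pos// lee_fin in b1; rewrite Phi_pos// lee_fin in b2.
have eA : (fine \o Phi u) (y + h) = v (I (y + h)) - I (y + h) * (y + h).
  by rewrite [LHS]/= Phi_pos.
have eB : (fine \o Phi u) y = v (I y) - I y * y by rewrite [LHS]/= Phi_pos.
rewrite eA eB; set A := v (I (y + h)) - _; set B := v (I y) - _; set q := _ / _.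
have eq : A - B = q * h by rewrite /q mulfVK.
have k1 : - I y * h <= q * h by rewrite -eq; move: b1; rewrite -/A /B; lra.
have k2 : q * h <= - I (y + h) * h by rewrite -eq; move: b2; rewrite -/B /A; lra.
have [hp|hn] := ltP 0 h.
  move: k1 k2; rewrite !ler_pM2r// => k1 k2.
  by rewrite ler0_norm; [rewrite ler0_norm; lra|lra].
have {}hn : h < 0 by rewrite lt_neqAle h0.
move: k1 k2; rewrite !ler_nM2r// => k1 k2.
by rewrite ger0_norm; [rewrite ger0_norm; lra|lra].
Qed.

(** [Phi] is [+oo] to the left of 0 and [fine] sends it to 0, so the derivative there is a default
    value. It matters because [phi] is nonnegative only almost surely. *)
Lemma dPhi_neg y : y < 0 -> dPhi u y = 0%E.
Proof.
move=> y0; rewrite /dPhi lt_eqF//; congr EFin.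
apply: derive1_quotient => e e0; exists (- y); first by lra.
move=> h h0 hlt; have yh : y + h < 0 by have := ler_norm h; lra.
by rewrite /= !Phi_neg//= subrr mul0r subrr normr0.
Qed.

Lemma measurable_utility : measurable_fun setT u.
Proof.
apply: is_interval_nondecreasing_measurable => // s t _ _.
exact: utility_nondecreasing.
Qed.

Lemma measurable_inv_du : measurable_fun [set y : R | 0 < y] I.
Proof.
have -> : I = (fun y => - (- I y)) by apply/funext => y; rewrite opprK.
apply: measurableT_comp => //; apply/measurable_EFinP.
apply: is_interval_nondecreasing_measurable.
  by move=> s t /= s0 t0 z /andP[sz _]; exact: lt_le_trans sz.
move=> s t /= s0 t0 st; rewrite lee_fin lerN2; exact: inv_du_nonincreasing.
Qed.

Lemma measurable_Phi : measurable_fun setT (Phi u).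
Proof.
have m0 : measurable [set y : R | 0 < y] by rewrite -set_itvoy; exact: measurable_itv.
rewrite -(setvU [set y : R | 0 < y]); apply/measurable_funU => //.
  exact: measurableC.
split.
  apply: (eq_measurable_fun (fun y : R => if y == 0 then Phi u 0 else +oo%E)).
    move=> y; rewrite inE/= => /negP; rewrite -leNgt => y0.
    case: eqP => [->//|/eqP yn]; rewrite Phi_neg// lt_neqAle yn//.
  apply: measurable_funTS; apply: measurable_fun_if => //.
  apply: (measurable_fun_bool true) => //.
  rewrite (_ : _ @^-1` _ = [set 0]); first by rewrite setTI.
  by apply/seteqP; split => y /=; [move/eqP | move=> ->; rewrite eqxx].
apply: (eq_measurable_fun (fun y : R => (v (I y) - I y * y)%:E)).
  by move=> y; rewrite inE/= => y0; rewrite Phi_pos.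
apply/measurable_EFinP; apply: measurable_funB.
  have mv : measurable_fun setT v by exact: measurableT_comp measurable_utility.
  exact: (measurableT_comp mv measurable_inv_du).
by apply: measurable_funM => //; exact: measurable_inv_du.
Qed.

(** The function is nondecreasing on the whole line: it is 0 on []-oo, 0]], the value [-oo] at 0
    being absorbed by the maximum, and [max (- I y) 0] afterwards. *)
Lemma measurable_pos_dPhi : measurable_fun setT (fun y : R => fine (maxe (dPhi u y) 0)).
Proof.
apply: nondecreasing_measurable => // s t st.
have ge0 y : 0 <= fine (maxe (dPhi u y) 0) by rewrite fine_ge0// le_max lexx orbT.
have z0 : s <= 0 -> fine (maxe (dPhi u s) 0) = 0.
  rewrite le_eqVlt => /orP[/eqP ->|s0].
    by rewrite /dPhi eqxx maxNye.
  by rewrite dPhi_neg// maxxx.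
have [/z0 ->//|s0] := leP s 0.
have t0 := lt_le_trans s0 st.
rewrite !dPhi_pos// -!EFin_max /=.
have := inv_du_nonincreasing s0 st.
by case: (leP (- I t) 0); case: (leP (- I s) 0) => // *; lra.
Qed.

End UtilityFacts.

(** * Orlicz spaces *)

(** Infinite values are allowed because [uhat u] is [+oo] beyond [- a] when [a] is finite. The class
    also has to contain the conjugate of [uhat u]. *)
Definition young {R : realType} (G : R -> \bar R) : Prop :=
  [/\ G 0 = 0%E, forall x, (0 <= G x)%E, forall x, G (- x) = G x
    & forall x y t, 0 <= t <= 1 ->
        (G (t * x + (1 - t) * y)%R <= t%:E * G x + (1 - t)%:E * G y)%E].

Section Young.
Context {R : realType}.
Variable G : R -> \bar R.
Hypothesis yG : young G.

Lemma young_ge0 x : (0 <= G x)%E. Proof. by have [_ + _ _] := yG; exact. Qed.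

Lemma young_scale t x : 0 <= t <= 1 -> (G (t * x) <= t%:E * G x)%E.
Proof.
have [G0 _ _ cG] := yG => t01.
by have := cG x 0 t t01; rewrite G0 mule0 adde0 mulr0 addr0.
Qed.

Lemma young_norm x : G `|x| = G x.
Proof.
have [_ _ eG _] := yG; have [x0|x0] := leP 0 x; first by rewrite ger0_norm.
by rewrite ltr0_norm// eG.
Qed.

Lemma young_le x y : `|x| <= `|y| -> (G x <= G y)%E.
Proof.
move=> xy; rewrite -(young_norm x) -(young_norm y).
have [y0|y0] := eqVneq y 0.
  by move: xy; rewrite y0 normr0 normr_le0 => /eqP ->; rewrite normr0.
have {}y0 : 0 < `|y| by rewrite normr_gt0.
have -> : `|x| = `|x| / `|y| * `|y| by rewrite mulfVK// gt_eqF.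
have t01 : 0 <= `|x| / `|y| <= 1 by rewrite divr_ge0//= ler_pdivrMr// mul1r.
apply: (le_trans (young_scale _ t01)).
have /andP[_ t1] := t01.
by rewrite -[leRHS]mul1e lee_wpmul2r ?young_ge0.
Qed.

Lemma measurable_young : measurable_fun setT G.
Proof.
pose g (x : R) := G (Num.max x 0).
have -> : G = g \o (@Num.norm R R).
  by apply/funext => x; rewrite /g /= (max_idPl _)// young_norm.
apply: measurableT_comp => //.
apply: is_interval_nondecreasing_measurable => // s t _ _ st.
have h (r : R) : 0 <= Num.max r 0 by rewrite le_max lexx orbT.
by apply: young_le; rewrite !ger0_norm// ge_max h andbT le_max st.
Qed.

(** Makes the linear structure available on the Orlicz space of the densities [dQ_r/dP], where two
    solutions will be averaged. *)
Lemma young_conjugate : young (conjugate G).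
Proof.
have [G0 Gge0 Gev _] := yG.
have ge x y : ((x * y)%:E - G x <= conjugate G y)%E.
  by apply: ereal_sup_ubound; exists x.
have ge0 y : (0 <= conjugate G y)%E.
  by have := ge 0 y; rewrite mul0r G0 sube0.
split => //.
- apply/eqP; rewrite eq_le ge0 andbT; apply: ge_ereal_sup => _ [x _ <-].
  by rewrite mulr0 sub0e leeNl oppe0.
- move=> y; congr ereal_sup; apply/seteqP; split => _ [x _ <-]; exists (- x) => //;
    by rewrite Gev ?mulrNN// mulNr mulrN.
- move=> x y t /andP[t0 t1]; apply: ge_ereal_sup => _ [z _ <-].
  case Gz : (G z) (Gge0 z) => [r| |] // _; last by rewrite addeNy leNye.
  apply: (@le_trans _ _ (t%:E * (z * x - r)%:E + (1 - t)%:E * (z * y - r)%:E)%E).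
    by rewrite -EFinB -!EFinM -EFinD lee_fin; lra.
  apply: leeD; apply: lee_wpmul2l => //; rewrite ?lee_fin ?subr_ge0//.
    by rewrite EFinB -Gz.
  by rewrite EFinB -Gz.
Qed.

End Young.

Section UtilityYoung.
Context {R : realType}.
Variables (a : \bar R) (u : R -> \bar R).
Hypotheses (hu : utility a u) (hA1 : assumption_A1 a u).

Lemma uhat_fin (x : R) : u (- `|x|) != -oo%E ->
  uhat u x = (fine (u 0) - fine (u (- `|x|)))%:E.
Proof.
move=> h; rewrite /uhat addrC EFinB.
rewrite -(utility_fin hu (utility0 hu)); congr (_ - _)%E.
by rewrite fineK// fin_numE h (utility_neq_pinfty hu).
Qed.

Lemma uhat_infty (x : R) : u (- `|x|) = -oo%E -> uhat u x = +oo%E.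
Proof. by rewrite /uhat => ->; rewrite (utility_fin hu (utility0 hu)). Qed.

Lemma young_uhat : young (uhat u).
Proof.
have u0 := utility_fin hu (utility0 hu).
have ge0 x : (0 <= uhat u x)%E.
  rewrite /uhat addeC sube_ge0; first by apply: (utility_nondecreasing hu); rewrite oppr_le0.
  by rewrite u0 orbT.
split => //.
- by rewrite /uhat normr0 oppr0 u0 -EFinN -EFinD addNr.
- by move=> x; rewrite /uhat normrN.
- move=> x y t t01.
  have [->|tn0] := eqVneq t 0.
    by rewrite mul0e add0e subr0 mul1e mul0r add0r mul1r.
  have [->|tn1] := eqVneq t 1.
    by rewrite subrr mul0e adde0 mul1e mul0r addr0 mul1r.
  move/andP: (t01) => [t0 t1].
  have {}t0 : 0 < t by rewrite lt_neqAle eq_sym tn0.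
  have {}t1 : 0 < 1 - t by rewrite subr_gt0 lt_neqAle tn1.
  have nyx z : uhat u z != -oo%E by rewrite -leeNy_eq -ltNge (lt_le_trans _ (ge0 z)).
  have [ux|ux] := eqVneq (u (- `|x|)) -oo%E.
    rewrite (uhat_infty ux) gt0_muley ?lte_fin// addye ?leey//.
    by rewrite (gt_eqF (lt_le_trans ltNy0 _))// mule_ge0// lee_fin ltW.
  have [uy|uy] := eqVneq (u (- `|y|)) -oo%E.
    rewrite (uhat_infty uy) gt0_muley ?lte_fin// addey ?leey//.
    by rewrite (gt_eqF (lt_le_trans ltNy0 _))// mule_ge0// lee_fin ltW.
  have h := utility_concave hu hA1 (- `|x|) (- `|y|) t01.
  have h2 : (u (t * - `|x| + (1 - t) * - `|y|)%R <= u (- `|t * x + (1 - t) * y|)%R)%E.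
    apply: (utility_nondecreasing hu).
    have := ler_normD (t * x) ((1 - t) * y).
    by rewrite !normrM (gtr0_norm t0) (gtr0_norm t1); lra.
  have {h2}h := le_trans h h2.
  have fx : u (- `|x|) = (fine (u (- `|x|)))%:E.
    by rewrite fineK// fin_numE ux (utility_neq_pinfty hu).
  have fy : u (- `|y|) = (fine (u (- `|y|)))%:E.
    by rewrite fineK// fin_numE uy (utility_neq_pinfty hu).
  have um : u (- `|t * x + (1 - t) * y|) != -oo%E.
    by apply: contraTneq h => ->; rewrite fx fy -!EFinM -EFinD.
  have fm : u (- `|t * x + (1 - t) * y|) = (fine (u (- `|t * x + (1 - t) * y|)))%:E.
    by rewrite fineK// fin_numE um (utility_neq_pinfty hu).
  rewrite !uhat_fin// -!EFinM -EFinD lee_fin.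
  by move: h; rewrite fx fy fm -!EFinM -EFinD lee_fin; lra.
Qed.

Lemma uhat_lt_pinfty (x : R) : (a < (- `|x|)%:E)%E -> (uhat u x < +oo)%E.
Proof.
move=> ax; rewrite uhat_fin ?ltry//.
by rewrite (utility_fin hu ax).
Qed.

End UtilityYoung.

Section Orlicz.
Context {d : measure_display} {Om : measurableType d} {R : realType}.
Variables (P : probability Om R) (G : R -> \bar R).
Hypothesis yG : young G.
Implicit Types f g h : Om -> R.
Local Notation L := (orlicz P G).
Local Notation N := (luxemburg P G).

Lemma measurable_young_comp f : measurable_fun setT f ->
  measurable_fun setT (fun w => G (f w)).
Proof. by move=> mf; apply: measurableT_comp mf; exact: measurable_young. Qed.

Lemma integral_young_le f g : measurable_fun setT f -> measurable_fun setT g ->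
  {ae P, forall w, `|f w| <= `|g w|} -> (\int[P]_w G (f w) <= \int[P]_w G (g w))%E.
Proof.
move=> mf mg fg; apply: ae_ge0_le_integral => //.
- by move=> *; exact: young_ge0.
- exact: measurable_young_comp.
- by move=> *; exact: young_ge0.
- exact: measurable_young_comp.
- by apply: filterS fg => w fgw _; exact: young_le.
Qed.

Lemma orlicz_le f g : measurable_fun setT f -> L g ->
  {ae P, forall w, `|f w| <= `|g w|} -> L f.
Proof.
move=> mf [mg [al [al0 h]]] fg; split => //; exists al; split => //.
apply: le_lt_trans h; apply: integral_young_le.
- exact: measurable_funM.
- exact: measurable_funM.
- by apply: filterS fg => w fgw; rewrite !normrM ler_wpM2l.
Qed.

Lemma orlicz0 : L (cst 0).
Proof.
split; first exact: measurable_cst.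
exists 1; split => //; rewrite (eq_integral (cst 0%E)); first by rewrite integral0.
by move=> w _; rewrite mulr0; have [] := yG.
Qed.

Lemma orlicz_lin (c : R) f g : L f -> L g -> L (fun w => c * f w + g w).
Proof.
move=> [mf [al [al0 hf]]] [mg [be [be0 hg]]].
have ac : 0 < `|c| + 1 by rewrite ltr_wpDl.
split; first by apply: measurable_funD => //; exact: measurable_funM.
(* With [e |c| <= al] and [e <= be], convexity with weights 1/2 bounds the modular of
   [(e / 2) (c f + g)]. *)
pose e := Num.min (al / (`|c| + 1)) be.
have e0 : 0 < e by rewrite lt_min be0 divr_gt0.
exists (e / 2); split; first exact: divr_gt0.
apply: (@le_lt_trans _ _ (\int[P]_w (2^-1%:E * G (al * f w) + 2^-1%:E * G (be * g w))))%E.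
  apply: ge0_le_integral => //.
  - by move=> *; exact: young_ge0.
  - apply: measurable_young_comp; apply: measurable_funM => //.
    by apply: measurable_funD => //; exact: measurable_funM.
  - by apply: emeasurable_funD; apply: measurable_funeM; apply: measurable_young_comp;
      exact: measurable_funM.
  - move=> w _; have [_ _ _ cG] := yG.
    have h2 : 0 <= (2^-1 : R) <= 1 by apply/andP; split; lra.
    have := cG (e * c * f w) (e * g w) _ h2.
    have -> : 1 - 2^-1 = 2^-1 :> R by lra.
    have -> : 2^-1 * (e * c * f w) + 2^-1 * (e * g w) = e / 2 * (c * f w + g w) by ring.
    move=> /le_trans; apply; apply: leeD; apply: lee_wpmul2l; rewrite ?lee_fin ?invr_ge0//.
      apply: young_le => //; rewrite !normrM (gtr0_norm e0) (gtr0_norm al0) ler_wpM2r//.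
      have : e <= al / (`|c| + 1) by rewrite /e ge_min lexx.
      rewrite ler_pdivlMr// => /(le_trans _); apply.
      by rewrite ler_pM2l// lerDl.
    apply: young_le => //; rewrite !normrM (gtr0_norm e0) (gtr0_norm be0) ler_wpM2r//.
    by rewrite /e ge_min lexx orbT.
rewrite ge0_integralD//; last first.
- by apply: measurable_funeM; apply: measurable_young_comp; exact: measurable_funM.
- by move=> *; apply: mule_ge0; [rewrite lee_fin invr_ge0|exact: young_ge0].
- by apply: measurable_funeM; apply: measurable_young_comp; exact: measurable_funM.
- by move=> *; apply: mule_ge0; [rewrite lee_fin invr_ge0|exact: young_ge0].
rewrite !ge0_integralZl_EFin//;
  try by [rewrite invr_ge0|move=> *; exact: young_ge0|
    apply: measurable_young_comp; exact: measurable_funM].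
by rewrite lte_add_pinfty// lte_mul_pinfty// ?lee_fin ?invr_ge0.
Qed.

Lemma orlicz_measurable f : L f -> measurable_fun setT f. Proof. by case. Qed.

Lemma orlicz_scale (c : R) f : L f -> L (fun w => c * f w).
Proof.
move=> /orlicz_lin -/(_ c _ orlicz0); congr orlicz; apply/funext => w.
by rewrite /= addr0.
Qed.

Lemma orliczD f g : L f -> L g -> L (fun w => f w + g w).
Proof.
move=> /orlicz_lin /[apply] -/(_ 1); congr orlicz; apply/funext => w.
by rewrite mul1r.
Qed.

Lemma orliczB f g : L f -> L g -> L (fun w => f w - g w).
Proof.
move=> Lf /orlicz_lin -/(_ (-1) _ Lf); congr orlicz; apply/funext => w.
by rewrite mulN1r addrC.
Qed.

Lemma orlicz_norm f : L f -> L (fun w => `|f w|).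
Proof.
move=> Lf; apply: (orlicz_le _ Lf); last by apply: aeW => w; rewrite normr_id.
by apply: measurableT_comp => //; case: Lf.
Qed.

Lemma orlicz_indic f (A : set Om) : measurable A -> L f -> L (fun w => f w * \1_A w).
Proof.
move=> mA Lf; apply: (orlicz_le _ Lf).
  by apply: measurable_funM => //; case: Lf.
apply: aeW => w; rewrite normrM ler_piMr//.
by rewrite indicE; case: (_ \in _); rewrite ?normr1 ?normr0.
Qed.

(** Finiteness of [G] at a single positive point is enough, since the factor in the definition of
    the space shrinks [c] below [e]. *)
Lemma orlicz_cst (c e : R) : 0 < e -> (G e < +oo)%E -> L (cst c).
Proof.
move=> e0 Ge; split => //.
exists (e / (`|c| + 1)); have c0 : 0 < `|c| + 1 by rewrite ltr_wpDl.
split; first exact: divr_gt0.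
have : (\int[P]_w G (e / (`|c| + 1) * cst c w) <= \int[P]_w G (cst e w))%E.
  apply: integral_young_le; [exact: measurable_funM|exact: measurable_cst|].
  apply: aeW => w /=; rewrite normrM (gtr0_norm (divr_gt0 _ _))// (gtr0_norm e0).
  by rewrite mulrAC ler_pdivrMr// ler_pM2l// lerDl.
move/le_lt_trans; apply.
rewrite (eq_integral (cst (G e)))// integral_cst//.
by rewrite [X in (_ * X)%E](_ : _ = 1%E) ?mule1//; exact: probability_setT.
Qed.

Definition lux_set f := [set c : R | 0 < c /\ (\int[P]_w G (f w / c)%R <= 1)%E].

Lemma luxemburg_witness f : L f -> exists c, lux_set f c.
Proof.
move=> [mf [al [al0 h]]].
have mal : measurable_fun setT (fun w => G (al * f w)).
  by apply: measurable_young_comp; exact: measurable_funM.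
have I0 : (0 <= \int[P]_w G (al * f w)%R)%E.
  by apply: integral_ge0 => *; exact: young_ge0.
set M := fine (\int[P]_w G (al * f w)%R).
have eM : (\int[P]_w G (al * f w)%R = M%:E)%E by rewrite fineK// ge0_fin_numE.
have M0 : 0 <= M by rewrite fine_ge0.
have M1 : 0 < M + 1 by rewrite ltr_wpDl.
(* As [G (t x) <= t G x] for [0 <= t <= 1], the factor [t = 1 / (M + 1)] lowers the modular [M]
   below 1. *)
exists ((M + 1) / al); split; first exact: divr_gt0.
apply: (@le_trans _ _ (\int[P]_w ((M + 1)^-1%:E * G (al * f w))))%E.
  apply: ge0_le_integral => //.
  - by move=> *; exact: young_ge0.
  - by apply: measurable_young_comp; exact: measurable_funM.
  - exact: measurable_funeM.
  - move=> w _; have -> : f w / ((M + 1) / al) = (M + 1)^-1 * (al * f w).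
      by rewrite invf_div; ring.
    by apply: young_scale => //; rewrite invr_ge0 ltW//= invf_le1// lerDr.
rewrite ge0_integralZl_EFin ?invr_ge0 ?(ltW M1)//.
  by rewrite eM -EFinM lee_fin mulrC ler_pdivrMr// mul1r lerDl.
by move=> *; exact: young_ge0.
Qed.

Lemma luxemburg_le f c : lux_set f c -> N f <= c.
Proof. by move=> h; apply: ge_inf => //; exists 0 => x [/ltW]. Qed.

Lemma luxemburg_ge0 f : 0 <= N f.
Proof.
change (0 <= inf (lux_set f)); have [->|/set0P h] := eqVneq (lux_set f) set0.
  by rewrite inf0.
by apply: (lb_le_inf h) => x [/ltW].
Qed.

(** Strictness yields an admissible constant below [c], and [G] is monotone in the absolute
    value. *)
Lemma luxemburg_lt f c : L f -> N f < c -> (\int[P]_w G (f w / c)%R <= 1)%E.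
Proof.
move=> Lf Nc.
have hi : has_inf (lux_set f).
  by split; [exact: luxemburg_witness|exists 0 => x [/ltW]].
have /(inf_adherent) : 0 < c - N f by rewrite subr_gt0.
move=> /(_ _ hi)[e [e0 he] ]; rewrite -/(N f) addrC subrK => ec.
apply: le_trans he; have [mf _] := Lf.
apply: integral_young_le.
- exact: measurable_funM.
- exact: measurable_funM.
- apply: aeW => w; rewrite !normrM ler_wpM2l// !ger0_norm ?invr_ge0 ?ltW//.
  + by rewrite ltf_pV2 ?posrE// (lt_trans e0).
  + exact: lt_trans ec.
Qed.

Lemma luxemburg_mono f g : measurable_fun setT f -> L g ->
  {ae P, forall w, `|f w| <= `|g w|} -> N f <= N g.
Proof.
move=> mf Lg fg.
apply: lb_le_inf; first exact: luxemburg_witness.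
move=> c [c0 hc]; apply: luxemburg_le; split => //.
apply: le_trans hc; have [mg _] := Lg.
apply: integral_young_le; [exact: measurable_funM..|].
by apply: filterS fg => w fgw; rewrite !normrM ler_wpM2r.
Qed.

Lemma luxemburg_ae0 f : measurable_fun setT f -> {ae P, forall w, f w = 0} -> N f = 0.
Proof.
move=> mf f0; apply/eqP; rewrite eq_le luxemburg_ge0 andbT.
apply/ler_addgt0Pl => c c0; rewrite addr0; apply: luxemburg_le; split => //.
rewrite (_ : (\int[P]_w _ = 0)%E) ?lee01//.
rewrite -(integral0 P setT); apply: ge0_ae_eq_integral => //.
- by apply: measurable_young_comp; exact: measurable_funM.
- by move=> *; exact: young_ge0.
- by apply: filterS f0 => w -> _; rewrite mul0r; have [] := yG.
Qed.

Section Dual.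
Variable z : (Om -> R) -> R.
Hypothesis dz : is_dual P G z.

Lemma dual_lin c f g : L f -> L g -> z (fun w => c * f w + g w) = c * z f + z g.
Proof. by case: dz => + _; exact. Qed.

Lemma dual0 : z (cst 0) = 0.
Proof.
have := dual_lin (-1) orlicz0 orlicz0.
rewrite mulN1r addNr; congr (z _ = _); apply/funext => w.
by rewrite /= mulr0 addr0.
Qed.

Lemma dual_scale c f : L f -> z (fun w => c * f w) = c * z f.
Proof.
move=> Lf; have := dual_lin c Lf orlicz0; rewrite dual0 addr0 => <-.
by congr z; apply/funext => w; rewrite /= addr0.
Qed.

Lemma dualD f g : L f -> L g -> z (fun w => f w + g w) = z f + z g.
Proof.
move=> Lf Lg; have := dual_lin 1 Lf Lg; rewrite mul1r => <-.
by congr z; apply/funext => w; rewrite mul1r.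
Qed.

Lemma dualB f g : L f -> L g -> z (fun w => f w - g w) = z f - z g.
Proof.
move=> Lf Lg; have := dual_lin (-1) Lg Lf; rewrite mulN1r addrC => <-.
by congr z; apply/funext => w; rewrite mulN1r addrC.
Qed.

Lemma dual_bound : exists2 C, 0 <= C & forall f, L f -> `|z f| <= C * N f.
Proof.
have [_ [C hC]] := dz; exists (Num.max C 0); first by rewrite le_max lexx orbT.
move=> f Lf; apply: (le_trans (hC f Lf)).
by rewrite ler_wpM2r ?luxemburg_ge0// le_max lexx.
Qed.

Lemma dual_le_ae f g : dual_le P G (fun=> 0) z -> L f -> L g ->
  ae_le P f g -> z f <= z g.
Proof.
move=> z0 Lf Lg fg; rewrite -subr_ge0 -dualB//; apply: z0; first exact: orliczB.
by apply: filterS fg => w; rewrite /= subr_ge0.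
Qed.

Lemma dual_norm_ub f : L f -> N f <= 1 -> `|z f| <= dual_norm P G z.
Proof.
move=> Lf f1; apply: sup_upper_bound; last by exists f.
split; first by exists `|z f|, f.
have [C C0 hC] := dual_bound; exists C => _ [g [Lg Ng] <-].
by apply: le_trans (hC _ Lg) _; rewrite ler_piMr.
Qed.

Lemma dual_norm_ge f : L f -> (\int[P]_w G (f w) <= 1)%E -> `|z f| <= dual_norm P G z.
Proof.
move=> Lf f1; apply: dual_norm_ub => //; apply: luxemburg_le; split => //.
by under eq_integral do rewrite divr1.
Qed.

Lemma dual_norm_le M : (forall f, L f -> N f <= 1 -> `|z f| <= M) ->
  dual_norm P G z <= M.
Proof.
move=> h; apply: ge_sup; last by move=> _ [f [Lf f1] <-]; exact: h.
exists `|z (cst 0)|, (cst 0) => //; split; first exact: orlicz0.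
by rewrite luxemburg_ae0//; exact: aeW.
Qed.

Lemma dual_norm0 : dual_norm P G z <= 0 -> dual_zero P G z.
Proof.
move=> z0 f Lf; have [c [c0 hc]] := luxemburg_witness Lf.
have : `|z (fun w => c^-1 * f w)| <= 0.
  apply: le_trans z0; apply: dual_norm_ge; first exact: orlicz_scale.
  by under eq_integral do rewrite mulrC.
by rewrite dual_scale// normr_le0 mulf_eq0 invr_eq0 gt_eqF// => /eqP.
Qed.

End Dual.
End Orlicz.

(** * Order continuous and singular functionals *)

Section Density.
Context {d : measure_display} {Om : measurableType d} {R : realType}.
Variables (P : probability Om R) (G : R -> \bar R).
Hypothesis yG : young G.
Local Notation L := (orlicz P G).
Local Notation N := (luxemburg P G).
Implicit Types (f g h : Om -> R) (z m : (Om -> R) -> R).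

Lemma is_dual_lin c z z' : is_dual P G z -> is_dual P G z' ->
  is_dual P G (fun f => c * z f + z' f).
Proof.
move=> dz dz'; split.
  by move=> k f g Lf Lg; rewrite !(dual_lin dz) // !(dual_lin dz')//; ring.
have [C C0 hC] := dual_bound dz; have [C' C'0 hC'] := dual_bound dz'.
exists (`|c| * C + C') => f Lf.
apply: le_trans (ler_normD _ _) _; rewrite normrM mulrDl -mulrA lerD ?hC'//.
by rewrite ler_wpM2l ?hC.
Qed.

Lemma is_dual0 : is_dual P G (fun=> 0).
Proof.
split; first by move=> *; rewrite mulr0 addr0.
by exists 0 => f _; rewrite normr0 mul0r.
Qed.

Lemma order_continuous0 : order_continuous P G (fun=> 0).
Proof.
split; first exact: is_dual0.
move=> I le f g [i] _ _ _ _ _ _ _ eps e0; exists i => j _.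
by rewrite normr0 ltW.
Qed.

Definition density_functional (psi : Om -> R) f : R :=
  fine (\int[P]_w (f w * psi w)%:E)%E.

Section DensityFunctional.
Variables (psi : Om -> R) (m : (Om -> R) -> R).
Hypotheses (mpsi : measurable_fun setT psi) (psi0 : forall w, 0 <= psi w)
  (dm : is_dual P G m)
  (hm : forall f, L f -> ae_le P (cst 0) f -> (\int[P]_w (f w * psi w)%:E <= (m f)%:E)%E).
Local Notation V := (density_functional psi).

(** The bound by [m], applied to [|f|], makes the integral of [|f| psi] finite. *)
Lemma density_integrable f : L f -> P.-integrable setT (fun w => (f w * psi w)%:E).
Proof.
move=> Lf; have mf := orlicz_measurable Lf; apply/integrableP; split.
  by apply/measurable_EFinP; exact: measurable_funM.
apply: (@le_lt_trans _ _ (m (fun w => `|f w|))%:E); last exact: ltry.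
apply: le_trans (hm (orlicz_norm yG Lf) _); last by apply: aeW => w /=.
rewrite le_eqVlt; apply/orP; left; apply/eqP; apply: eq_integral => w _.
by rewrite /= normrM (ger0_norm (psi0 w)).
Qed.

Lemma density_functionalE f : L f -> ((V f)%:E = \int[P]_w (f w * psi w)%:E)%E.
Proof. by move=> Lf; rewrite fineK// integrable_fin_num//; exact: density_integrable. Qed.

Lemma density_functional_ae f g : L f -> L g -> ae_le P f g -> V f <= V g.
Proof.
move=> Lf Lg fg; rewrite -lee_fin !density_functionalE//.
rewrite -sube_ge0; last by rewrite -density_functionalE.
rewrite -integralB_EFin//; [|exact: density_integrable..].
have -> : (\int[P]_x ((g x * psi x)%:E - (f x * psi x)%:E) =
   \int[P]_x (Num.max (g x - f x) 0 * psi x)%:E)%E.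
  apply: ae_eq_integral => //.
  - by apply: emeasurable_funB; exact: measurable_int (density_integrable _).
  - apply/measurable_EFinP; apply: measurable_funM => //.
    apply: measurable_maxr => //; apply: measurable_funB.
      exact: (orlicz_measurable Lg).
    exact: (orlicz_measurable Lf).
  - apply: filterS fg => w fgw _; rewrite -EFinB -mulrBl (max_idPl _)//.
    by rewrite subr_ge0.
apply: integral_ge0 => w _; rewrite lee_fin mulr_ge0//.
by rewrite le_max lexx orbT.
Qed.

Lemma density_functional_lin c f g : L f -> L g ->
  V (fun w => c * f w + g w) = c * V f + V g.
Proof.
move=> Lf Lg; apply: EFin_inj; rewrite EFinD EFinM !density_functionalE//; last first.
  exact: orlicz_lin.
rewrite -integralZl//; last exact: density_integrable.
rewrite -integralD//; last first.
  exact: density_integrable.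
  by apply: integrableZl => //; exact: density_integrable.
by apply: eq_integral => w _; rewrite -EFinM -EFinD mulrDl mulrA.
Qed.

Lemma density_functional_norm f : L f -> `|V f| <= V (fun w => `|f w|).
Proof.
move=> Lf; rewrite ler_norml; apply/andP; split.
  rewrite lerNl -[leLHS]mulN1r -[leLHS]addr0.
  have V0 : V (cst 0) = 0.
    rewrite /density_functional (eq_integral (cst 0%E)) ?integral0//.
    by move=> w _; rewrite mul0r.
  rewrite -V0 -(density_functional_lin (-1) Lf (orlicz0 P yG)).
  apply: density_functional_ae; first by apply: (orlicz_lin yG) => //; exact: (orlicz0 P yG).
    exact: orlicz_norm.
  by apply: aeW => w; rewrite /= addr0 mulN1r -normrN ler_norm.
apply: density_functional_ae => //; first exact: orlicz_norm.
by apply: aeW => w; exact: ler_norm.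
Qed.

Lemma density_functional_dual : is_dual P G V.
Proof.
split; first exact: density_functional_lin.
have [C C0 hC] := dual_bound dm; exists C => f Lf.
have Lnf := orlicz_norm yG Lf.
apply: le_trans (density_functional_norm Lf) _.
apply: (@le_trans _ _ (m (fun w => `|f w|))).
  by rewrite -lee_fin density_functionalE//; apply: hm => //; apply: aeW => w /=.
apply: le_trans (ler_norm _) _; apply: le_trans (hC _ Lnf) _.
rewrite ler_wpM2l//; apply: luxemburg_mono => //; first exact: (orlicz_measurable Lnf).
by apply: aeW => w; rewrite normr_id.
Qed.

(* Along a suitable increasing sequence of indices the integrals of the [g i] reach
   their infimum; the almost sure limit of that sequence lies below every member
   of the net on the set where [psi] is positive. *)
Lemma density_functional_order_continuous : order_continuous P G V.
Proof.
split; first exact: density_functional_dual.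
move=> I le f g [istar] le_refl le_tr le_dir Lfg fg gdec ginf eps e0.
have Lf i : L (f i) by have [] := Lfg i.
have Lg i : L (g i) by have [] := Lfg i.
have mg i := orlicz_measurable (Lg i).
have g0 i : ae_le P (cst 0) (g i).
  by apply: filterS (fg i) => w /= h; apply: le_trans h.
suff [i0 hi0] : exists i0, V (g i0) <= eps.
  exists i0 => i ii0; apply: le_trans (density_functional_norm (Lf i)) _.
  apply: le_trans hi0; apply: (@le_trans _ _ (V (g i))).
    by apply: density_functional_ae => //; exact: orlicz_norm.
  by apply: density_functional_ae => //; exact: gdec.
pose E := [set V (g i) | i in [set: I]].
have E0 x : E x -> 0 <= x.
  move=> [i _ <-]; have V0 : V (cst 0) = 0.
    rewrite /density_functional (eq_integral (cst 0%E)) ?integral0//.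
    by move=> w _; rewrite mul0r.
  by rewrite -V0; apply: density_functional_ae => //; exact: orlicz0.
have hE : has_inf E by split; [exists (V (g istar)), istar | exists 0].
pose c := inf E.
have cE i : c <= V (g i) by apply: ge_inf; [exact: hE.2|exists i].
suff c0 : c <= 0.
  have [_ [i _ <-] hi] := inf_adherent e0 hE; exists i.
  by move: c0 hi; rewrite /c; lra.
have /choice[j hj] : forall n : nat, exists j, V (g j) < c + n.+1%:R^-1.
  move=> n; have n0 : 0 < n.+1%:R^-1 :> R by rewrite invr_gt0.
  by have [_ [i _ <-] hi] := inf_adherent n0 hE; exists i.
have /choice[up1 hup1] : forall ij : I * I, exists k, le ij.1 k /\ le ij.2 k.
  by move=> [i1 i2]; exact: le_dir.
(* An increasing sequence of indices with [s n] beyond [j n], obtained from directedness; it still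
   minimizes the integrals because the net is decreasing. *)
pose s := fix s n := if n is n'.+1 then up1 (s n', j n'.+1) else j 0%N.
have sj n : le (j n) (s n).
  by case: n => [|n] /=; [exact: le_refl|exact: (hup1 (s n, j n.+1)).2].
have sS n : le (s n) (s n.+1) by exact: (hup1 (s n, j n.+1)).1.
have sV n : V (g (s n)) < c + n.+1%:R^-1.
  apply: le_lt_trans (hj n); apply: density_functional_ae => //; exact: gdec.
have [Nu [mNu Nu0 hNu]] : {ae P, forall w, forall n,
    0 <= g (s n) w /\ g (s n.+1) w <= g (s n) w}.
  apply: ae_foralln => n; apply: filterS2 (g0 (s n)) (gdec _ _ (sS n)) => w.
  by [].
(* Removing one null set makes the sequence nonnegative and decreasing at every point, so that its
   pointwise limit [h] exists everywhere. *)
pose Z := ~` Nu; have mZ : measurable Z by exact: measurableC.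
pose g' n w := g (s n) w * \1_Z w.
have Lg' n : L (g' n) by exact: orlicz_indic.
have aeZ : {ae P, forall w, Z w}.
  by exists Nu; split => //; rewrite /Z setCK.
have hZ w : Z w -> forall n, 0 <= g (s n) w /\ g (s n.+1) w <= g (s n) w.
  by move=> Zw; apply: contrapT => h; apply: Zw; exact: hNu.
have g'ae n : {ae P, forall w, g' n w = g (s n) w}.
  by apply: filterS aeZ => w Zw; rewrite /g' indicE mem_set// mulr1.
have g'0 n w : 0 <= g' n w.
  rewrite /g' indicE; case: (pselect (Z w)) => [Zw|nZ].
    by rewrite mem_set// mulr1; have [] := hZ w Zw n.
  by rewrite memNset// mulr0.
have g'S w : {homo (g' ^~ w) : n m / (n <= m)%N >-> m <= n}.
  apply/nonincreasing_seqP => n.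
  rewrite /g' indicE; case: (pselect (Z w)) => [Zw|nZ].
    by rewrite mem_set// !mulr1; have [] := hZ w Zw n.
  by rewrite memNset// !mulr0.
have cg' w : cvgn (g' ^~ w).
  by apply: nonincreasing_is_cvgn => //; exists 0 => _ [n _ <-].
pose h w := limn (g' ^~ w).
have hcvg w : g' n w @[n --> \oo] --> h w by exact: cg'.
have hg' n w : h w <= g' n w.
  by apply: nonincreasing_cvgn_ge => //; exact: g'S.
have h0 w : 0 <= h w.
  by apply: limr_ge => //; apply: nearW => n.
have mh : measurable_fun setT h.
  apply: (measurable_fun_cvg (h := g')) => [n|w _].
    exact: (orlicz_measurable (Lg' n)).
  exact: hcvg.
have Lh : L h.
  apply: (orlicz_le yG mh (Lg' 0%N)); apply: aeW => w.
  by rewrite !ger0_norm.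
pose E1 := [set w | 0 < psi w].
have mE1 : measurable E1.
  rewrite /E1 -[X in measurable X]setTI.
  rewrite (_ : [set w | 0 < psi w] = psi @^-1` `]0, +oo[).
    exact: mpsi.
  by apply/seteqP; split => w /=; rewrite in_itv/= andbT.
have key i : ae_le P (fun w => h w * \1_E1 w) (g i).
  pose q w := Num.max (h w - g i w) 0.
  have mq : measurable_fun setT q.
    by apply: measurable_maxr => //; apply: measurable_funB.
  have q0 w : 0 <= q w by rewrite le_max lexx orbT.
  have Lq : L q.
    apply: (orlicz_le yG mq Lh); apply: filterS (g0 i) => w /= giw.
    rewrite !ger0_norm// ge_max h0 andbT; lra.
  have Vq : V q <= 0.
    apply/ler_addgt0Pl => e ee0; rewrite addr0.
    have [n hn] : exists n : nat, n.+1%:R^-1 < e.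
      have [n _ hn] := near_infty_natSinv_lt (PosNum ee0).
      by exists n; apply: hn => /=.
    (* [g k] lies below both [g (s n)] and [g i], so the excess [q] of [h] over [g i] is at most
       [g (s n) - g k], whose integral is less than [1 / (n + 1)] because [c <= V (g k)]. *)
    have [k [k1 k2]] := le_dir (s n) i.
    apply: (@le_trans _ _ (-1 * V (g k) + V (g (s n)))); last first.
      move: (cE k) (sV n) hn; rewrite -/c.
      by move: (n.+1%:R^-1) (V (g k)) (V (g (s n))) => x1 y1 z1; clearbody c; lra.
    rewrite -density_functional_lin//; apply: density_functional_ae => //.
      exact: orlicz_lin.
    apply: filterS3 (gdec _ _ k1) (gdec _ _ k2) (g'ae n) => w A B eg.
    have := hg' n w; rewrite eg /q ge_max mulN1r => C.
    by apply/andP; split; lra.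
  have mqp : measurable_fun setT (fun w => (q w * psi w)%:E).
    by apply/measurable_EFinP; exact: measurable_funM.
  have : ae_eq P setT (fun w => (q w * psi w)%:E) (cst 0%E).
    apply/ae_eq_integral_abs => //; apply/eqP; rewrite eq_le; apply/andP; split.
      rewrite (eq_integral (fun w => (q w * psi w)%:E)).
        by rewrite -density_functionalE// lee_fin.
      by move=> w _; rewrite gee0_abs// lee_fin mulr_ge0.
    exact: integral_ge0.
  move=> hq; apply: filterS2 hq (g0 i) => w qw g0w.
  rewrite indicE; case: (pselect (E1 w)) => [E1w|nE1]; last first.
    by rewrite memNset// mulr0.
  rewrite mem_set// mulr1.
  have /= [/eqP] := qw Logic.I; rewrite mulf_eq0 (gt_eqF E1w) orbF.
  by rewrite /q => /eqP qe; rewrite -subr_le0 -qe le_max lexx.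
have hE1 : ae_le P (fun w => h w * \1_E1 w) (cst 0).
  by apply: ginf => //; exact: orlicz_indic.
(* On [E1] the limit [h] is 0, being below a lower bound of the net; off [E1] the density
   vanishes. *)
have hpsi0 : (\int[P]_w (h w * psi w)%:E = 0)%E.
  rewrite -(integral0 P setT); apply: ae_eq_integral => //.
    by apply/measurable_EFinP; exact: measurable_funM.
  apply: filterS hE1 => w; rewrite indicE; case: (pselect (E1 w)) => [E1w|nE1] hw _.
    move: hw; rewrite mem_set// mulr1 => hw.
    by rewrite (_ : h w = 0) ?mul0r//; apply/eqP; rewrite eq_le h0 hw.
  rewrite (_ : psi w = 0) ?mulr0//; apply/eqP; rewrite eq_le psi0 andbT leNgt.
  exact/negP.
have [_ _ dcv] : [/\ P.-integrable setT (fun w => (h w * psi w)%:E),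
    [sequence \int[P]_w `|(g' n w * psi w)%:E - (h w * psi w)%:E|]_n @ \oo --> 0%E &
    [sequence \int[P]_w (g' n w * psi w)%:E]_n @ \oo --> (\int[P]_w (h w * psi w)%:E)%E]%E.
  apply: (@dominated_convergence _ _ _ P setT measurableT
    (fun n w => (g' n w * psi w)%:E) _ (fun w => (g' 0%N w * psi w)%:E)).
  - by move=> n; exact: measurable_int (density_integrable (Lg' n)).
  - exact: measurable_int (density_integrable Lh).
  - apply: aeW => w _; apply: cvg_EFin; first exact: nearW.
    exact: cvgMr_tmp.
  - exact: density_integrable.
  - apply: aeW => w n _; have h1 := mulr_ge0 (g'0 n w) (psi0 w).
    by rewrite gee0_abs ?lee_fin// ler_wpM2r// g'S.
suff : (c%:E <= \int[P]_w (h w * psi w)%:E)%E by rewrite hpsi0 lee_fin.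
apply: (cvge_to_ge dcv).
apply: nearW => n; change (c%:E <= \int[P]_w (g' n w * psi w)%:E)%E.
rewrite -(density_functionalE (Lg' n)) lee_fin.
apply: le_trans (cE (s n)) _; apply: density_functional_ae => //.
by apply: filterS (g'ae n) => w ->.
Qed.
End DensityFunctional.
End Density.

(** * Signs and uniqueness of the regular and singular parts *)

Section Singular.
Context {d : measure_display} {Om : measurableType d} {R : realType}.
Variables (P : probability Om R) (G : R -> \bar R).
Hypotheses (yG : young G) (L1 : orlicz P G (cst 1)).
Local Notation L := (orlicz P G).
Local Notation N := (luxemburg P G).
Implicit Types (f g h : Om -> R) (z m : (Om -> R) -> R).

(** The zero functional is order continuous, and disjointness from it already supplies a modulus. *)
Lemma singular_modulus z : singular P G z -> exists m, is_modulus P G z m.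
Proof.
by move=> [_ /(_ _ (order_continuous0 P G))[m [m' [mz _ _]]]]; exists m.
Qed.

Lemma modulus_ge0 z m : is_modulus P G z m -> dual_le P G (fun=> 0) m.
Proof.
by move=> [_ h1 h2 _] f Lf f0; have := h1 f Lf f0; have := h2 f Lf f0; lra.
Qed.

(* The density functional of [psi] lies below every modulus of [z], so
   disjointness forces it to vanish. *)
Lemma singular_density_eq0 z (psi : Om -> R) : singular P G z ->
  measurable_fun setT psi -> (forall w, 0 <= psi w) ->
  (forall m, is_modulus P G z m -> forall f, L f -> ae_le P (cst 0) f ->
    (\int[P]_w (f w * psi w)%:E <= (m f)%:E)%E) ->
  {ae P, forall w, psi w = 0}.
Proof.
move=> sz mpsi psi0 hpsi.
have [m mz] := singular_modulus sz; have dm : is_dual P G m by case: mz.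
have oc := density_functional_order_continuous yG mpsi psi0 dm (hpsi _ mz).
have [_ /(_ _ oc)[m1 [m2 [mz1 mz2 disj]]]] := sz.
have le1 : dual_le P G (density_functional P psi) m1.
  move=> f Lf f0; rewrite -lee_fin (density_functionalE yG mpsi psi0 (hpsi _ mz))//.
  exact: hpsi.
have le2 : dual_le P G (density_functional P psi) m2 by case: mz2.
have := disj _ (proj1 oc) le1 le2 _ L1 (aeW _ (fun=> ler01)).
rewrite -lee_fin (density_functionalE yG mpsi psi0 (hpsi _ mz))// => int0.
have mp : measurable_fun setT (fun w => (psi w)%:E) by exact/measurable_EFinP.
have : ae_eq P setT (fun w => (psi w)%:E) (cst 0%E).
  apply/ae_eq_integral_abs => //; apply/eqP; rewrite eq_le integral_ge0// andbT.
  rewrite (eq_integral (fun w => (cst 1 w * psi w)%:E))// => w _.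
  by rewrite gee0_abs ?lee_fin//= mul1r.
by apply: filterS => w /(_ Logic.I) [].
Qed.

Section Parts.
Variables (Q Qr Qs : (Om -> R) -> R) (phi : Om -> R).
Hypotheses (Q0 : dual_le P G (fun=> 0) Q) (dec : decomposes P G Q Qr Qs phi)
  (mphi : measurable_fun setT phi).

Lemma regular_part_indic f (A : set Om) : measurable A -> L f ->
  ((Qr (fun w => f w * \1_A w))%:E = \int[P]_w (f w * (phi w * \1_A w))%:E)%E.
Proof.
move=> mA Lf; have [_ _ _ ->] := dec; last exact: orlicz_indic.
by apply: eq_integral => w _; congr EFin; ring.
Qed.

(** On the set [A] where [phi < 0], positivity of [Q] gives [- Qr (f 1_A) <= Qs (f 1_A)] for
    [f >= 0]. So the density [- phi 1_A] defines a functional below every modulus of [Qs] and has to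
    vanish. *)
Lemma density_ge0 : ae_le P (cst 0) phi.
Proof.
have [ocr ss eQ eQr] := dec.
pose A := [set w | phi w < 0].
have mA : measurable A.
  rewrite -[A]setTI (_ : A = phi @^-1` `]-oo, 0[); first exact: mphi.
  by apply/seteqP; split => w /=; rewrite in_itv.
pose psi w := - (phi w * \1_A w).
have psi0 w : 0 <= psi w.
  rewrite /psi indicE; case: (pselect (A w)) => Aw.
    by rewrite mem_set// mulr1 oppr_ge0 ltW.
  by rewrite memNset// mulr0 oppr0.
have mpsi : measurable_fun setT psi.
  by apply: measurableT_comp => //; apply: measurable_funM.
have : {ae P, forall w, psi w = 0}.
  apply: (singular_density_eq0 ss) => // m mm f Lf f0.
  have Lf1 := orlicz_indic yG mA Lf.
  have f10 : ae_le P (cst 0) (fun w => f w * \1_A w).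
    by apply: filterS f0 => w /= fw; rewrite mulr_ge0// indicE.
  have <- : ((- Qr (fun w => f w * \1_A w))%:E = \int[P]_w (f w * psi w)%:E)%E.
    have -> : - Qr (fun w => f w * \1_A w) = Qr (fun w => (- f w) * \1_A w).
      rewrite -mulN1r -(dual_scale yG (proj1 ocr))//; congr Qr.
      by apply/funext => w; ring.
    rewrite regular_part_indic//; last first.
      by have := orlicz_scale yG (-1) Lf; congr orlicz; apply/funext => w; rewrite mulN1r.
    by apply: eq_integral => w _; rewrite /psi mulNr mulrN.
  rewrite lee_fin.
  have := eQ _ Lf1; have := Q0 Lf1 f10; have [dm h _ _] := mm.
  have := h _ Lf1 f10.
  have : m (fun w => f w * \1_A w) <= m f.
    apply: (dual_le_ae yG dm) => //; first exact: modulus_ge0 mm.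
    by apply: filterS f0 => w /= fw; rewrite ler_piMr// indicE lern1 leq_b1.
  lra.
apply: filterS => w; rewrite /psi indicE /=; case: (pselect (A w)) => Aw.
  rewrite mem_set// mulr1 => /eqP; rewrite oppr_eq0 => /eqP e.
  by move: Aw; rewrite /A /= e ltxx.
by move=> _; rewrite leNgt; apply/negP.
Qed.

Lemma regular_part_ge0 : dual_le P G (fun=> 0) Qr.
Proof.
have [_ _ _ eQr] := dec.
move=> f Lf f0; rewrite -lee_fin eQr//.
have -> : (\int[P]_w (f w * phi w)%:E = \int[P]_w (Num.max (f w * phi w) 0)%:E)%E.
  have mfp : measurable_fun setT (fun w => f w * phi w).
    by apply: measurable_funM => //; exact: (orlicz_measurable Lf).
  apply: ae_eq_integral => //; try apply/measurable_EFinP => //.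
    exact: measurable_maxr.
  apply: filterS2 f0 density_ge0 => w /= h1 h2 _.
  by rewrite (max_idPl _)// mulr_ge0.
by apply: integral_ge0 => w _; rewrite lee_fin le_max lexx orbT.
Qed.

(* The least upper bound property of the modulus [m] of [Qs] gives
   [m <= 2 Qr + Qs], so the negative part [(m - Qs) / 2] of [Qs] is below [Qr]. *)
Lemma singular_part_ge0 : dual_le P G (fun=> 0) Qs.
Proof.
have [ocr ss eQ _] := dec.
have [ds /(_ _ ocr)[m [m' [mm mm' disj]]]] := ss.
have [dm hm1 hm2 hm3] := mm; have [dm' hm'1 _ _] := mm'.
have dr := proj1 ocr.
pose v f := 2^-1 * m f + (- 2^-1 * Qs f + 0).
have dv : is_dual P G v.
  by apply: is_dual_lin => //; apply: is_dual_lin => //; exact: is_dual0.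
have le1 : dual_le P G v m.
  by move=> f Lf f0; rewrite /v; have := hm2 f Lf f0; lra.
have dm2 : is_dual P G (fun f => 2 * Qr f + Qs f) by exact: is_dual_lin.
have le2 : dual_le P G v m'.
  move=> f Lf f0; apply: le_trans (hm'1 f Lf f0); rewrite /v.
  suff : m f <= 2 * Qr f + Qs f by lra.
  apply: (hm3 _ dm2) => // {f0 Lf f}f Lf f0.
    by have := regular_part_ge0 Lf f0; lra.
  by have := Q0 Lf f0; rewrite (eQ _ Lf); lra.
move=> f Lf f0; have := disj _ dv le1 le2 f Lf f0; rewrite /v.
by have := hm2 f Lf f0; lra.
Qed.

End Parts.

(** On [A], where [phi' < phi], the difference [Qr - Qr'] equals [Qs' - Qs], which is at most [Qs']
    as [Qs] is positive; hence [(phi - phi') 1_A] is a density below the moduli of [Qs']. Used in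
    both directions, this shows that the density depends on [Q] alone. *)
Lemma decomposes_density_le Q Qr Qs (phi : Om -> R) Qr' Qs' (phi' : Om -> R) :
  dual_le P G (fun=> 0) Q ->
  decomposes P G Q Qr Qs phi -> measurable_fun setT phi ->
  decomposes P G Q Qr' Qs' phi' -> measurable_fun setT phi' ->
  ae_le P phi phi'.
Proof.
move=> Q0 dec mphi dec' mphi'.
have [ocr ss eQ eQr] := dec; have [ocr' ss' eQ' eQr'] := dec'.
pose A := [set w | phi' w < phi w].
have mA : measurable A.
  rewrite -[A]setTI (_ : A = (phi \- phi') @^-1` `]0, +oo[).
    exact: (measurable_funB mphi mphi').
  by apply/seteqP; split => w /=; rewrite in_itv/= andbT subr_gt0.
pose psi w := phi w * \1_A w - phi' w * \1_A w.
have psi0 w : 0 <= psi w.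
  rewrite /psi indicE; case: (pselect (A w)) => Aw.
    by rewrite mem_set// !mulr1 subr_ge0 ltW.
  by rewrite memNset// !mulr0 subrr.
have mpsi : measurable_fun setT psi.
  by apply: measurable_funB; apply: measurable_funM.
have : {ae P, forall w, psi w = 0}.
  apply: (singular_density_eq0 ss') => // m mm f Lf f0.
  have Lf1 := orlicz_indic yG mA Lf.
  have f10 : ae_le P (cst 0) (fun w => f w * \1_A w).
    by apply: filterS f0 => w /= fw; rewrite mulr_ge0// indicE.
  have hi q (mq : measurable_fun setT q) Qq Qqs :
     decomposes P G Q Qq Qqs q -> P.-integrable setT (fun w => (f w * (q w * \1_A w))%:E).
    move=> dq; apply/integrableP; split.
      apply/measurable_EFinP; apply: measurable_funM; last exact: measurable_funM.
      exact: (orlicz_measurable Lf).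
    rewrite -[X in (X < _)%E](_ : (Qq (fun w => `|f w| * \1_A w))%:E = _) ?ltry//.
    rewrite (regular_part_indic dq)//; last exact: orlicz_norm.
    apply: ae_eq_integral => //.
    - apply/measurable_EFinP; apply: measurable_funM; last exact: measurable_funM.
      exact: (orlicz_measurable (orlicz_norm yG Lf)).
    - apply/measurable_EFinP; apply: measurableT_comp => //.
      apply: measurable_funM; last exact: measurable_funM.
      exact: (orlicz_measurable Lf).
    - apply: filterS (density_ge0 Q0 dq mq) => w /= qw _.
      by rewrite !normrM (ger0_norm qw) (ger0_norm (_ : 0 <= \1_A w))// indicE.
  have -> : (\int[P]_w (f w * psi w)%:E =
     (Qr (fun w => f w * \1_A w) - Qr' (fun w => f w * \1_A w))%:E)%E.
    rewrite EFinB (regular_part_indic dec)// (regular_part_indic dec')//.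
    rewrite -integralB_EFin//; [|exact: hi dec|exact: hi dec'].
    by apply: eq_integral => w _; rewrite -EFinB -mulrBr.
  rewrite lee_fin.
  have := eQ _ Lf1; rewrite (eQ' _ Lf1) => e.
  have := singular_part_ge0 Q0 dec mphi Lf1 f10; have [dm h _ _] := mm.
  have := h _ Lf1 f10.
  have : m (fun w => f w * \1_A w) <= m f.
    apply: (dual_le_ae yG dm) => //; first exact: modulus_ge0 mm.
    by apply: filterS f0 => w /= fw; rewrite ler_piMr// indicE lern1 leq_b1.
  lra.
apply: filterS => w; rewrite /psi indicE /=; case: (pselect (A w)) => Aw.
  rewrite mem_set// !mulr1 => /eqP; rewrite subr_eq0 => /eqP e.
  by move: Aw; rewrite /A /= e ltxx.
by move=> _; rewrite leNgt; apply/negP.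
Qed.

End Singular.

(** * The countably additive part of a finitely additive set function *)

Section CountablyAdditivePart.
Context {d : measure_display} {Om : measurableType d} {R : realType}.
Variable nu : set Om -> \bar R.
Hypotheses (nu0 : nu set0 = 0%E) (nu_ge0 : forall A, (0 <= nu A)%E)
  (nuU : forall A B, measurable A -> measurable B -> A `&` B = set0 ->
    nu (A `|` B) = (nu A + nu B)%E).

(* For a merely additive [nu], the Caratheodory construction does not extend [nu]
   but yields the largest measure below it. *)
Definition countably_additive_part : set Om -> \bar R := mu_ext nu.
Local Notation mu := countably_additive_part.

HB.instance Definition _ := isOuterMeasure.Build R Om mu
  (mu_ext0 nu0 nu_ge0) (mu_ext_ge0 nu_ge0) (le_mu_ext nu)
  (mu_ext_sigma_subadditive nu_ge0).

Lemma countably_additive_part_le (A : set Om) : measurable A -> (mu A <= nu A)%E.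
Proof.
move=> mA; apply: ereal_inf_lbound; exists (fun n => if n is 0%N then A else set0).
  by split=> [[]// _|t At]; exists 0%N.
rewrite nneseries_recl//.
by rewrite eseries_cond/= eseries0 ?adde0// => -[|]//= k _ _.
Qed.

(** Finite additivity splits each term of a cover of [X] along [A], and the pieces cover the two
    parts of [X] with the same total. *)
Lemma countably_additive_part_caratheodory (A : set Om) : measurable A ->
  caratheodory_measurable mu A.
Proof.
move=> mA; apply: le_caratheodory_measurable => X.
apply: le_ereal_inf_tmp => _ [B [mB XB] <-].
have mBA k : measurable (B k `&` A) by exact: measurableI.
have mBC k : measurable (B k `&` ~` A) by apply: measurableI => //; exact: measurableC.
rewrite (_ : (\sum_(k <oo) nu (B k) =
    \sum_(k <oo) nu (B k `&` A) + \sum_(k <oo) nu (B k `&` ~` A))%E); last first.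
  rewrite -nneseriesD//; apply: eq_eseriesr => k _; rewrite -nuU//.
    by rewrite -setIUr setUCr setIT.
  by rewrite setIACA setICr setI0.
apply: leeD; apply: ereal_inf_lbound.
  exists (fun k => B k `&` A) => //; split => // x [Xx Ax].
  by have [k _ Bk] := XB x Xx; exists k.
exists (fun k => B k `&` ~` A) => //; split => // x [Xx Ax].
by have [k _ Bk] := XB x Xx; exists k.
Qed.

Lemma countably_additive_part_semi_sigma_additive : semi_sigma_additive mu.
Proof.
move=> F mF tF mUF; apply: caratheodory_measure_sigma_additive => //.
- by move=> i; exact: countably_additive_part_caratheodory.
- exact: countably_additive_part_caratheodory.
Qed.

HB.instance Definition _ := isMeasure.Build _ Om R mu
  (mu_ext0 nu0 nu_ge0) (mu_ext_ge0 nu_ge0) countably_additive_part_semi_sigma_additive.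

Hypothesis nuT : (nu setT < +oo)%E.

Lemma countably_additive_part_fin_num : fin_num_fun mu.
Proof.
move=> A mA; rewrite ge0_fin_numE; last exact: outer_measure_ge0.
apply: le_lt_trans nuT; apply: le_trans (countably_additive_part_le measurableT).
exact: le_outer_measure.
Qed.

HB.instance Definition _ := Measure_isFinite.Build _ Om R mu
  countably_additive_part_fin_num.

(** The measure structure on [mu_ext nu] depends on the hypotheses on [nu]; the bundled form can be
    instantiated with a concrete [nu]. *)
Lemma exists_countably_additive_part :
  exists m : {finite_measure set Om -> \bar R}, m =1 mu_ext nu.
Proof. by exists mu. Qed.

End CountablyAdditivePart.

(** * Positive singular functionals are carried by sets of small probability *)

Section YosidaHewitt.
Import HBNNSimple.
Context {d : measure_display} {Om : measurableType d} {R : realType}.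
Variables (P : probability Om R) (G : R -> \bar R).
Hypotheses (yG : young G) (L1 : orlicz P G (cst 1)).
Local Notation L := (orlicz P G).
Local Notation N := (luxemburg P G).
Variables (z : (Om -> R) -> R).
Hypotheses (sz : singular P G z) (z0 : dual_le P G (fun=> 0) z).

Let dz : is_dual P G z := proj1 sz.

Lemma orlicz_sum (I : Type) (s : seq I) (F : I -> Om -> R) :
  (forall i, L (F i)) -> L (fun w => \sum_(i <- s) F i w).
Proof.
move=> LF; elim: s => [|i s IH].
  by rewrite (_ : (fun _ => _) = cst 0); [exact: orlicz0|apply/funext => w; rewrite big_nil].
rewrite (_ : (fun _ => _) = (fun w => F i w + \sum_(j <- s) F j w)); first exact: orliczD.
by apply/funext => w; rewrite big_cons.
Qed.

Lemma dual_sum (I : Type) (s : seq I) (F : I -> Om -> R) :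
  (forall i, L (F i)) -> z (fun w => \sum_(i <- s) F i w) = \sum_(i <- s) z (F i).
Proof.
move=> LF; elim: s => [|i s IH].
  rewrite big_nil -[RHS](dual0 yG dz); congr z.
  by apply/funext => w; rewrite big_nil.
rewrite big_cons -IH -(dualD dz) //; last exact: orlicz_sum.
by congr z; apply/funext => w; rewrite big_cons.
Qed.

Section Witness.
Variable g1 : Om -> R.
Hypotheses (Lg1 : L g1) (g1_gt0 : forall w, 0 < g1 w).

(* Defined as 0 on nonmeasurable sets, since the outer measure construction
   requires nonnegativity on all sets. *)
Let nu (A : set Om) : \bar R :=
  if pselect (measurable A) is left _ then (z (fun w => g1 w * \1_A w))%:E else 0%E.

Let nuE A : measurable A -> nu A = (z (fun w => g1 w * \1_A w))%:E.
Proof. by rewrite /nu; case: pselect. Qed.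

Let nu0 : nu set0 = 0%E.
Proof.
rewrite nuE//; congr EFin; rewrite -[RHS](dual0 yG dz); congr z.
by apply/funext => w; rewrite indic0 mulr0.
Qed.

Let nu_ge0 A : (0 <= nu A)%E.
Proof.
rewrite /nu; case: pselect => // mA; rewrite lee_fin; apply: z0.
  exact: orlicz_indic.
by apply: aeW => w /=; rewrite mulr_ge0// ?ltW// indicE.
Qed.

Let nuU A B : measurable A -> measurable B -> A `&` B = set0 ->
  nu (A `|` B) = (nu A + nu B)%E.
Proof.
move=> mA mB AB; rewrite !nuE//; last exact: measurableU.
rewrite -EFinD -(dualD dz); [|exact: orlicz_indic..].
congr (_%:E); congr z; apply/funext => w; rewrite -mulrDr; congr (_ * _).
rewrite !indicE in_setU -natrD; congr (_%:R).
case: (boolP (w \in A)) => [wA|//]; case: (boolP (w \in B)) => [wB|//].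
suff : set0 w by [].
by rewrite -AB; split; exact: set_mem.
Qed.

Let nuT : (nu setT < +oo)%E. Proof. by rewrite nuE// ltry. Qed.

(** Since [z] ignores null sets, the measure below [nu] has a density [rho] with respect to [P]. As
    [nu] weights sets by [g1], the functional with density [rho / g1] lies below [z], so singularity
    makes [rho] vanish. *)
Lemma countably_additive_part_singular : mu_ext nu setT = 0%E.
Proof.
have [mu muE] := exists_countably_additive_part nu0 nu_ge0 nuU nuT.
have mu_le A : measurable A -> (mu A <= nu A)%E.
  by move=> mA; rewrite muE; exact: countably_additive_part_le.
have dom : mu `<< P.
  apply/null_content_dominatesP => A mA PA; apply/eqP.
  rewrite eq_le measure_ge0 andbT; apply: le_trans (mu_le _ mA) _.
  rewrite nuE// lee_fin -(dual0 yG dz); apply: (dual_le_ae yG dz) => //.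
  - exact: orlicz_indic.
  - exact: orlicz0.
  - exists A; split => // w /= h; apply: contrapT => nA; apply: h.
    by rewrite indicE memNset// mulr0.
pose rho w := fine (Radon_Nikodym_SigmaFinite.f mu P w).
have rhoE w : (rho w)%:E = Radon_Nikodym_SigmaFinite.f mu P w.
  by rewrite fineK//; exact: Radon_Nikodym_SigmaFinite.f_fin_num.
have rho0 w : 0 <= rho w.
  by rewrite -lee_fin rhoE; exact: Radon_Nikodym_SigmaFinite.f_ge0.
have mrho : measurable_fun setT rho.
  apply/measurable_EFinP; rewrite (_ : _ \o _ = Radon_Nikodym_SigmaFinite.f mu P).
    exact: measurable_int (Radon_Nikodym_SigmaFinite.f_integrable dom).
  by apply/funext => w; rewrite /= rhoE.
have mg1 := orlicz_measurable Lg1.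
pose psi w := rho w / g1 w.
have mV : measurable_fun setT (fun w => (g1 w)^-1).
  have mi : measurable_fun [set y : R | 0 < y] (fun y : R => (- y^-1)%:E).
    apply: is_interval_nondecreasing_measurable.
      by move=> s t /= s0 t0 y /andP[sy _]; exact: lt_le_trans sy.
    by move=> s t /= s0 t0 st; rewrite lee_fin lerN2 lef_pV2.
  have m0 : measurable [set y : R | 0 < y].
    by rewrite -set_itvoy; exact: measurable_itv.
  have -> : (fun w => (g1 w)^-1) = (fun w => - - (g1 w)^-1).
    by apply/funext => w; rewrite opprK.
  apply: measurableT_comp => //; apply/measurable_EFinP.
  apply: (measurable_comp m0 _ mi mg1) => _ /= [w _ <-]; exact: g1_gt0.
have psi0 w : 0 <= psi w by rewrite divr_ge0// ltW.
have mpsi : measurable_fun setT psi by exact: measurable_funM.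
have : {ae P, forall w, psi w = 0}.
  apply: (singular_density_eq0 yG L1 sz) => // m mm f Lf f0.
  have Lnf := orlicz_norm yG Lf.
  apply: (@le_trans _ _ (z (fun w => `|f w|))%:E); last first.
    rewrite lee_fin; have [_ hzm _ _] := mm.
    apply: le_trans (hzm _ Lf f0); apply: (dual_le_ae yG dz z0) => //.
    by apply: filterS f0 => w /= fw; rewrite ger0_norm.
  have -> : (\int[P]_w (f w * psi w)%:E = \int[mu]_w (`|f w| / g1 w)%:E)%E.
    rewrite -(Radon_Nikodym_SigmaFinite.change_of_variables dom)//; last 2 first.
    - by move=> w; rewrite lee_fin divr_ge0// ltW.
    - apply/measurable_EFinP; apply: measurable_funM => //.
      exact: (orlicz_measurable Lnf).
    apply: ae_eq_integral => //.
    - apply/measurable_EFinP; apply: measurable_funM => //.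
      exact: (orlicz_measurable Lf).
    - apply: emeasurable_funM.
        apply/measurable_EFinP; apply: measurable_funM => //.
        exact: (orlicz_measurable Lnf).
      exact: measurable_int (Radon_Nikodym_SigmaFinite.f_integrable dom).
    apply: filterS f0 => w /= fw _; rewrite -rhoE -EFinM ger0_norm//.
    by congr EFin; rewrite /psi; ring.
  rewrite ge0_integralTE; last by move=> w; rewrite lee_fin divr_ge0// ltW.
  (* It is enough to test simple functions [h <= |f| / g1]: their integral is at most [z (g1 h)]
     because [mu <= nu], and [g1 h <= |f|]. *)
  apply: ge_ereal_sup => _ /= [h hf <-].
  have mh x : measurable (h @^-1` [set x]) by [].
  rewrite sintegralE fsbig_finite//=.
  have Lx x : L (fun w => x * (g1 w * \1_(h @^-1` [set x]) w)).
    by apply: (orlicz_scale yG); apply: (orlicz_indic yG).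
  pose r := finmap.enum_fset (fset_set (range h)).
  change ((\sum_(x <- r) x%:E * mu (h @^-1` [set x]) <=
    (z (fun w => `|f w|))%:E)%E).
  apply: (@le_trans _ _ (\sum_(x <- r)
      (z (fun w => x * (g1 w * \1_(h @^-1` [set x]) w)))%:E)%E).
    apply: lee_sum => x _; have [x0|x0] := leP 0 x.
      rewrite (dual_scale yG dz); last exact: (orlicz_indic yG).
      by rewrite EFinM -nuE//; apply: lee_wpmul2l => //; exact: mu_le.
    rewrite preimage_nnfun0// measure0 mule0 lee_fin -(dual0 yG dz).
    rewrite le_eqVlt; apply/orP; left; apply/eqP; congr z.
    by apply/funext => w; rewrite indic0 !mulr0.
  rewrite sumEFin -dual_sum// lee_fin; apply: (dual_le_ae yG dz z0) => //.
    exact: orlicz_sum.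
  apply: aeW => w.
  have -> : \sum_(x <- r) x * (g1 w * \1_(h @^-1` [set x]) w) = g1 w * h w.
    rewrite [in RHS]fimfunE fsbig_finite//= big_distrr/=.
    by apply: eq_bigr => x _; ring.
  by have := hf w; rewrite lee_fin ler_pdivlMr// mulrC.
move=> hpsi.
rewrite -muE (Radon_Nikodym_SigmaFinite.f_integral dom)//.
rewrite -(integral0 P setT); apply: ae_eq_integral => //.
  exact: measurable_int (Radon_Nikodym_SigmaFinite.f_integrable dom).
apply: filterS hpsi => w /eqP; rewrite mulf_eq0 invr_eq0 (gt_eqF (g1_gt0 w)) orbF.
by move=> /eqP rw _; rewrite -rhoE rw.
Qed.

(** The outer measure of the whole space being 0, some countable cover has total [nu]-mass below
    [e]; finite unions of its members do the job. *)
Lemma positive_singular_exhaustion e : 0 < e -> exists B : (set Om)^nat,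
  [/\ forall n, measurable (B n), nondecreasing_seq B, \bigcup_n B n = setT
    & forall n, z (fun w => g1 w * \1_(B n) w) <= e].
Proof.
move=> e0.
have : (mu_ext nu setT < e%:E)%E by rewrite countably_additive_part_singular lte_fin.
move=> /ereal_inf_lt[_ [F [mF cF] <-] hF].
pose B n := \big[setU/set0]_(k < n) F k.
have mB n : measurable (B n) by apply: bigsetU_measurable => k _.
exists B; split => //.
- by move=> m n mn; rewrite subsetEset; exact: subset_bigsetU.
- apply/seteqP; split => // w _; have [k _ Fk] := cF w Logic.I.
  by exists k.+1 => //; rewrite /B big_ord_recr/=; right.
- move=> n; rewrite -lee_fin; apply: le_trans (ltW hF).
  apply: (@le_trans _ _ (\sum_(0 <= k < n) nu (F k))%E); last first.
    by apply: nneseries_lim_ge => k _ _.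
  rewrite big_mkord.
  have -> : (\sum_(k < n) nu (F k) =
      (\sum_(k < n) z (fun w => g1 w * \1_(F k) w)%R)%:E)%E.
    by rewrite -sumEFin; apply: eq_bigr => k _; rewrite nuE.
  have LF k : L (fun w => g1 w * \1_(F k) w) by exact: (orlicz_indic yG).
  rewrite -(dual_sum _ (fun k => LF (nat_of_ord k))) lee_fin.
  apply: (dual_le_ae yG dz z0); first exact: (orlicz_indic yG).
    exact: orlicz_sum.
  apply: aeW => w; rewrite -big_distrr/= ler_pM2l//.
  rewrite indicE; case: (boolP (w \in B n)) => [/set_mem|_]; last first.
    by apply: sumr_ge0 => k _; rewrite indicE.
  rewrite /B -bigcup_mkord => -[k /= kn Fkw].
  rewrite (bigD1 (Ordinal kn))//= [in leRHS]indicE mem_set// lerDl.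
  by apply: sumr_ge0 => i _; rewrite indicE.
Qed.

End Witness.

(* Off a set of small probability a singular functional is small, so the part of
   [g] that it sees has modular at most 1. *)
Lemma singular_le_dual_norm g : L g -> (forall w, 0 <= g w) ->
  (\int[P]_w G (g w) < +oo)%E -> z g <= dual_norm P G z.
Proof.
move=> Lg g0 Gg; apply/ler_addgt0Pr => e e0.
have mg := orlicz_measurable Lg.
(* Adding 1 makes the weight strictly positive, so that densities can be divided by it. *)
have Lg1 : L (fun w => g w + 1) by exact: (orliczD yG).
have g1_gt0 w : 0 < g w + 1 by rewrite ltr_wpDl.
have [B [mB ndB cB hB]] := positive_singular_exhaustion Lg1 g1_gt0 e0.
have mGg : measurable_fun setT (fun w => G (g w)) by exact: measurable_young_comp.
(* The sets [B n] increase to the whole space, so the finite modular of [g] outside them tends to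
   0. *)
have [n hn] : exists n, (\int[P]_(w in ~` B n) G (g w) <= 1)%E.
  have cv := @ge0_nondecreasing_set_cvg_integral _ _ _ B (fun w => G (g w)) P ndB mB
    (fun i => measurable_funS measurableT (@subsetT _ _) mGg)
    (fun i x _ => young_ge0 yG (g x)).
  rewrite cB in cv.
  have I0 A : (0 <= \int[P]_(w in A) G (g w))%E.
    by apply: integral_ge0 => *; exact: young_ge0.
  have fI A : measurable A -> (\int[P]_(w in A) G (g w))%E \is a fin_num.
    move=> mA; rewrite ge0_fin_numE//; apply: le_lt_trans Gg.
    by apply: ge0_subset_integral => // *; exact: young_ge0.
  have split_int n : (\int[P]_w G (g w) =
      \int[P]_(w in B n) G (g w) + \int[P]_(w in ~` B n) G (g w))%E.
    rewrite -[in LHS](setvU (B n)) setUC ge0_integral_setU//.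
    - exact: measurableC.
    - by rewrite setUv.
    - by move=> *; exact: young_ge0.
    - exact/disj_setPCl.
  have cv' : (\int[P]_(w in B i) G (g w))%E @[i --> \oo] -->
      (fine (\int[P]_w G (g w)))%:E by rewrite fineK ?fI.
  move/fine_cvg/cvgrPdist_lt : cv' => /(_ 1 ltr01)[n _ /(_ n (leqnn n))] /=.
  have mBC : measurable (~` B n) by exact: measurableC.
  rewrite (split_int n) fineD ?fI// addrAC subrr add0r => h1.
  exists n; rewrite -(fineK (fI _ mBC)) lee_fin.
  by apply/ltW; apply: le_lt_trans h1; exact: ler_norm.
have LgB : L (fun w => g w * \1_(B n) w) by exact: (orlicz_indic yG).
have LgC : L (fun w => g w * \1_(~` B n) w).
  by apply: (orlicz_indic yG) => //; exact: measurableC.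
have -> : z g = z (fun w => g w * \1_(~` B n) w) + z (fun w => g w * \1_(B n) w).
  rewrite -(dualD dz)//; congr z; apply/funext => w.
  by rewrite indicC indicE; case: (w \in B n); rewrite ?mulr1 ?mulr0 ?add0r ?addr0.
apply: lerD; last first.
  apply: le_trans (hB n); apply: (dual_le_ae yG dz z0) => //.
    exact: (orlicz_indic yG).
  by apply: aeW => w; rewrite ler_wpM2r ?indicE// lerDl.
apply: le_trans (ler_norm _) _; apply: (dual_norm_ge dz LgC).
apply: le_trans hn; rewrite [leRHS]integral_mkcond le_eqVlt; apply/orP; left.
apply/eqP; apply: eq_integral => w _; rewrite patchE indicE.
case: (w \in ~` B n); rewrite ?mulr1// mulr0.
by have [] := yG.
Qed.

End YosidaHewitt.

(** * The domain of the expected utility *)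

Section IntegralFacts.
Context {d : measure_display} {Om : measurableType d} {R : realType}.
Variable P : probability Om R.

Lemma integral_gtNy (f : Om -> \bar R) : measurable_fun setT f ->
  (-oo < \int[P]_w f w)%E <-> (\int[P]_w (f^\- w) < +oo)%E.
Proof.
move=> mf; rewrite integralE.
have p0 : (0 <= \int[P]_w (f^\+ w))%E by exact: integral_ge0.
have n0 : (0 <= \int[P]_w (f^\- w))%E by exact: integral_ge0.
split => h.
  rewrite ltNge leye_eq; apply/negP => /eqP e; move: h.
  by rewrite e /= addeNy ltxx.
case en : (\int[P]_w (f^\- w))%E n0 h => [r| |]// _ _.
by case ep : (\int[P]_w (f^\+ w))%E p0 => [s| |]// _; rewrite -?EFinB ?ltNyr.
Qed.

Lemma integrable_bounded_below (f : Om -> \bar R) (c : R) : measurable_fun setT f ->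
  (forall w, (c%:E <= f w)%E) -> (\int[P]_w f w < +oo)%E -> P.-integrable setT f.
Proof.
move=> mf cf; rewrite integralE => h.
have hn : (\int[P]_w (f^\- w) <= `|c|%:E)%E.
  apply: (@le_trans _ _ (\int[P]_w (cst `|c|%:E w))%E).
    apply: ge0_le_integral => //; first exact: measurable_funeneg.
    move=> w _; rewrite funenegE ge_max lee_fin normr_ge0 andbT.
    rewrite leeNl -EFinN; apply: le_trans (cf w); rewrite lee_fin lerNl.
    by rewrite -normrN ler_norm.
  by rewrite integral_cst// [X in (_ * X)%E](_ : _ = 1%E) ?mule1//; exact: probability_setT.
have n0 : (0 <= \int[P]_w (f^\- w))%E by exact: integral_ge0.
have p0 : (0 <= \int[P]_w (f^\+ w))%E by exact: integral_ge0.
apply/integrableP; split => //.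
rewrite (eq_integral (fun w => f^\+ w + f^\- w)%E); last first.
  by move=> w _; rewrite -[LHS]/((abse \o f) w) fune_abse.
rewrite ge0_integralD//; [|exact: measurable_funepos|exact: measurable_funeneg].
case en : (\int[P]_w (f^\- w))%E n0 hn h => [r| |]// _ _.
by case ep : (\int[P]_w (f^\+ w))%E p0 => [s| |]// _ _; rewrite -EFinD ltry.
Qed.

Lemma integral_le_ae_eq (f g : Om -> \bar R) :
  P.-integrable setT f -> P.-integrable setT g -> (forall w, (g w <= f w)%E) ->
  (\int[P]_w f w <= \int[P]_w g w)%E -> {ae P, forall w, f w = g w}.
Proof.
move=> jf jg gf h.
have ff := integrable_ae measurableT jf; have fg := integrable_ae measurableT jg.
have mfg := integrableB measurableT jf jg.
have : ae_eq P setT (f \- g)%E (cst 0%E).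
  apply/ae_eq_integral_abs => //; first exact: measurable_int mfg.
  have -> : (\int[P]_x `|(f \- g) x| = \int[P]_x (f \- g) x)%E.
    apply: ae_eq_integral => //.
    - by apply: measurableT_comp => //; exact: measurable_int mfg.
    - exact: measurable_int mfg.
    - apply: filterS2 ff fg => w fw gw _; rewrite gee0_abs// sube_ge0 ?gf//.
      by rewrite (fw Logic.I) orbT.
  apply/eqP; rewrite eq_le; apply/andP; split.
    by rewrite integralB// sube_le0.
  rewrite integralB// sube_ge0 ?integrable_fin_num//.
  exact: le_integral.
apply: filterS3 ff fg => w /(_ Logic.I) fw /(_ Logic.I) gw /(_ Logic.I) /= /eqP.
by rewrite sube_eq ?fw// ?add0e => /eqP.
Qed.

End IntegralFacts.

(** * Probabilities with a prescribed density *)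

Section DensityProbability.
Context {d : measure_display} {Om : measurableType d} {R : realType}.
Variables (P : probability Om R) (h : Om -> R).
Hypotheses (mh : measurable_fun setT h) (h0 : forall w, 0 <= h w)
  (h1 : (\int[P]_w (h w)%:E = 1)%E).

Definition density_measure (A : set Om) : \bar R := (\int[P]_(w in A) (h w)%:E)%E.

Let density_measure0 : density_measure set0 = 0%E.
Proof. by rewrite /density_measure integral_set0. Qed.

Let density_measure_ge0 A : (0 <= density_measure A)%E.
Proof. by apply: integral_ge0 => w _; rewrite lee_fin. Qed.

Let density_measure_additive : semi_sigma_additive density_measure.
Proof.
apply: semi_sigma_additive_nng_induced; first exact/measurable_EFinP.
by move=> w; rewrite lee_fin.
Qed.

HB.instance Definition _ := isMeasure.Build _ Om R density_measure
  density_measure0 density_measure_ge0 density_measure_additive.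

HB.instance Definition _ := Measure_isProbability.Build _ Om R density_measure h1.

(** (A2) speaks of probabilities and their Radon-Nikodym derivatives; a normalized density has to be
    realized in this form before (A2) applies to it. *)
Lemma exists_density_probability : exists Q : probability Om R,
  Q `<< P /\ {ae P, forall w,
     fine (Radon_Nikodym (charge_of_finite_measure Q) P w) = h w}.
Proof.
exists density_measure.
have dom : density_measure `<< P.
  apply/null_content_dominatesP => A mA PA.
  apply: null_set_integral => //; apply: measurable_funTS; exact/measurable_EFinP.
split => //.
have : ae_eq P setT (Radon_Nikodym (charge_of_finite_measure density_measure) P)
    (EFin \o h).
  apply: integral_ae_eq => //.
    exact: Radon_Nikodym_integrable.
  by apply/measurable_EFinP.
  by move=> E _ mE; rewrite -Radon_Nikodym_integral.
by apply: filterS => w /(_ Logic.I) ->.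
Qed.

End DensityProbability.

Section Utility.
Context {d : measure_display} {Om : measurableType d} {R : realType}.
Variables (P : probability Om R) (a : \bar R) (u : R -> \bar R).
Hypotheses (hu : utility a u) (hA1 : assumption_A1 a u).
Local Notation L := (orlicz P (uhat u)).

Lemma orlicz_uhat_cst c : L (cst c).
Proof.
have [e e0 he] : exists2 e : R, 0 < e & (a < (- e)%:E)%E.
  have := utility0 hu; case: (a) => [r| |]//.
    rewrite lte_fin => r0; exists (- r / 2); first by lra.
    by rewrite lte_fin; lra.
  by move=> _; exists 1 => //; exact: ltNyr.
apply: (orlicz_cst P (young_uhat hu hA1) _ e0); apply: (uhat_lt_pinfty hu).
by rewrite gtr0_norm.
Qed.

Lemma measurable_Phi_comp (f : Om -> R) : measurable_fun setT f ->
  measurable_fun setT (fun w => Phi u (f w)).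
Proof. by move=> mf; apply: measurableT_comp mf; exact: (measurable_Phi hu hA1). Qed.

Lemma Phi_ge_fine_u0 y : ((fine (u 0))%:E <= Phi u y)%E.
Proof.
by apply: le_trans (Phi_ge_u0 _ _); rewrite [X in (_ <= X)%E](utility_fin hu (utility0 hu)).
Qed.

Lemma Phi_integrable (f : Om -> R) : measurable_fun setT f ->
  (\int[P]_w Phi u (f w) < +oo)%E -> P.-integrable setT (fun w => Phi u (f w)).
Proof.
move=> mf hf; apply: (@integrable_bounded_below _ _ _ P _ (fine (u 0))) => //.
  exact: measurable_Phi_comp.
by move=> w; exact: Phi_ge_fine_u0.
Qed.

Lemma Phi_scale_integrable (phi : Om -> R) (t : R) : assumption_A2 P u ->
  measurable_fun setT phi -> ae_le P (cst 0) phi ->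
  (0 < \int[P]_w (phi w)%:E)%E -> P.-integrable setT (EFin \o phi) ->
  (\int[P]_w Phi u (phi w) < +oo)%E -> 0 < t ->
  P.-integrable setT (fun w => Phi u (t * phi w)).
Proof.
move=> hA2 mphi phi0 int_gt0 int_phi hPhi t0.
have mtphi : measurable_fun setT (fun w => t * phi w) by exact: measurable_funM.
apply: Phi_integrable => //.
pose c := fine (\int[P]_w (phi w)%:E)%E.
have cE : (\int[P]_w (phi w)%:E = c%:E)%E.
  by rewrite fineK//; apply: (integrable_fin_num measurableT int_phi).
have c0 : 0 < c by rewrite -lte_fin -cE.
(* [phi] is nonnegative only almost surely, whereas the density of a measure is required to be so
   everywhere. *)
pose h w := Num.max (phi w) 0 / c.
have h0 w : 0 <= h w by rewrite divr_ge0 ?(ltW c0)// le_max lexx orbT.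
have mh : measurable_fun setT h.
  by apply: measurable_funM => //; exact: measurable_maxr.
have hphi : {ae P, forall w, c * h w = phi w}.
  apply: filterS phi0 => w /= pw; rewrite /h (max_idPl pw) mulrC divfK//.
  by rewrite gt_eqF.
have h1 : (\int[P]_w (h w)%:E = 1)%E.
  have : (c%:E * \int[P]_w (h w)%:E = c%:E)%E.
    rewrite -ge0_integralZl_EFin//; last 3 first.
    - by move=> w _; rewrite lee_fin.
    - exact/measurable_EFinP.
    - exact: ltW.
    rewrite -[RHS]cE; apply: ae_eq_integral => //.
    + by apply: measurable_funeM; exact/measurable_EFinP.
    + exact/measurable_EFinP.
    + by apply: filterS hphi => w <- _; rewrite EFinM.
  move=> e.
  have : (c^-1%:E * (c%:E * \int[P]_w (h w)%:E) = c^-1%:E * c%:E)%E by rewrite e.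
  by rewrite muleA -EFinM mulVf ?gt_eqF// mul1e.
have [Q [dom hQ]] := exists_density_probability mh h0 h1.
have eint s : 0 < s -> (\int[P]_w Phi u (s * fine (Radon_Nikodym
    (charge_of_finite_measure Q) P w))%R = \int[P]_w Phi u ((s / c) * phi w)%R)%E.
  move=> s0; apply: ae_eq_integral => //.
  - apply: measurable_Phi_comp; apply: measurable_funM => //.
    exact: measurableT_comp.
  - by apply: measurable_Phi_comp; exact: measurable_funM.
  - apply: filterS2 hQ hphi => w -> <- _; congr (Phi u _).
    by field; rewrite gt_eqF.
have ct0 : 0 < c * t by rewrite mulr_gt0.
have Qc : finite_entropy P (fun y => Phi u (c * y)) Q.
  split=> //=; rewrite eint// divff ?gt_eqF//.
  by under eq_integral do rewrite mul1r.
(* As [c h = phi], [Q] belongs to the class of [Phi (c y)]. (A2) moves it to the class of [Phi],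
   then to that of [Phi (c t y)], whose integrand is [Phi (t phi)]. *)
rewrite -hA2// in Qc; rewrite (hA2 _ ct0) in Qc.
case: Qc => _ /=; rewrite eint//.
by rewrite (_ : c * t / c = t)//; field; rewrite gt_eqF.
Qed.

Lemma Phi_convex_integrable (f g : Om -> R) t : 0 <= t <= 1 ->
  measurable_fun setT f -> measurable_fun setT g ->
  P.-integrable setT (fun w => Phi u (f w)) ->
  P.-integrable setT (fun w => Phi u (g w)) ->
  P.-integrable setT (fun w => Phi u (t * f w + (1 - t) * g w)).
Proof.
move=> t01 mf mg jf jg.
have mh : measurable_fun setT (fun w => Phi u (t * f w + (1 - t) * g w)).
  by apply: measurable_Phi_comp; apply: measurable_funD; exact: measurable_funM.
have jh := integrableD measurableT (integrableZl measurableT t jf)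
  (integrableZl measurableT (1 - t) jg).
apply: (@integrable_bounded_below _ _ _ P _ (fine (u 0))) => //.
  by move=> w; exact: Phi_ge_fine_u0.
have jk : P.-integrable setT
    (fun w => maxe (t%:E * Phi u (f w) + (1 - t)%:E * Phi u (g w)) 0)%E.
  apply: (le_integrable measurableT _ _ jh).
    apply: measurable_maxe => //; exact: measurable_int jh.
  move=> w _ /=; set q := (_ + _)%E.
  by case: (leP q 0%E) => hq; rewrite ?abse0.
have := integrable_lty measurableT jk; apply: le_lt_trans.
apply: (@le_trans _ _ (\int[P]_w (fun w => Phi u (t * f w + (1 - t) * g w))^\+ w)%E).
  rewrite integralE; set A := (\int[P]_x _)%E.
  rewrite -[X in (_ <= X)%E]adde0 leeD2l// leeNl oppe0.
  exact: integral_ge0.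
apply: ge0_le_integral => //.
- exact: measurable_funepos.
- exact: measurable_int jk.
move=> w _; rewrite funeposE ge_max [X in _ && X]le_max lexx orbT andbT.
rewrite le_max; apply/orP; left; exact: (Phi_convex hu).
Qed.

(** The negative part of [u (f)] and [uhat (f^-)] bound each other up to the constant [|u 0|]. *)
Lemma DsetP (f : Om -> R) :
  Dset P u f <-> L f /\ (\int[P]_w uhat u (Num.max (- f w) 0)%R < +oo)%E.
Proof.
have yG := young_uhat hu hA1.
have u0 := utility_fin hu (utility0 hu).
suff H : L f -> (-oo < expected_utility P u f)%E <->
    (\int[P]_w uhat u (Num.max (- f w) 0)%R < +oo)%E.
  by split=> -[Lf h]; split => //; apply/(H Lf).
move=> Lf; have mf := orlicz_measurable Lf.
have muf : measurable_fun setT (fun w => u (f w)).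
  by apply: measurableT_comp mf; exact: measurable_utility hu.
have mG : measurable_fun setT (fun w => uhat u (Num.max (- f w) 0)%R).
  apply: (measurable_young_comp yG); apply: measurable_maxr => //.
  exact: measurableT_comp.
rewrite /expected_utility integral_gtNy//.
set v0 := (fine \o u) 0 in u0.
have int_add (g : Om -> \bar R) : measurable_fun setT g -> (forall w, 0 <= g w)%E ->
    (\int[P]_w g w < +oo)%E -> (\int[P]_w (`|v0|%:E + g w) < +oo)%E.
  move=> mg g0 hg; rewrite ge0_integralD//.
  rewrite (eq_integral (cst `|v0|%:E))// integral_cst//.
  rewrite [X in (_ * X)%E](_ : _ = 1%E); last exact: probability_setT.
  by rewrite mule1 lte_add_pinfty ?ltry.
have v01 : v0 <= `|v0| by exact: ler_norm.
have v02 : - v0 <= `|v0| by rewrite -normrN ler_norm.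
have unpy y := utility_neq_pinfty hu y.
split => h.
  apply: le_lt_trans (int_add _ (measurable_funeneg muf) _ h) => //.
  apply: ge0_le_integral => //.
  - by move=> w _; exact: young_ge0.
  - by apply: emeasurable_funD => //; exact: measurable_funeneg.
  move=> w _; have [fw|fw] := leP 0 (f w).
    rewrite (max_idPr _) ?oppr_le0//; have [-> _ _ _] := yG.
    by rewrite adde_ge0// lee_fin.
  rewrite (max_idPl _) ?oppr_ge0 ?(ltW fw)// /uhat normrN (ltr0_norm fw) opprK u0.
  rewrite funenegE; case uf : (u (f w)) => [r| |].
  - have : (- r <= Num.max (- r) 0) by rewrite le_max lexx.
    rewrite -EFinN -EFin_max -!EFinD lee_fin; lra.
  - by have := unpy (f w); rewrite uf.
  - by rewrite /= maxye addey ?leey.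
apply: le_lt_trans (int_add _ mG _ h) => //; last by move=> w; exact: young_ge0.
apply: ge0_le_integral => //.
- exact: measurable_funeneg.
- exact: emeasurable_funD.
move=> w _; rewrite funenegE ge_max; apply/andP; split; last first.
  by rewrite adde_ge0 ?lee_fin// (young_ge0 yG).
have [fw|fw] := leP 0 (f w).
  rewrite (max_idPr _) ?oppr_le0//; have [-> _ _ _] := yG.
  rewrite adde0 leeNl -EFinN; apply: le_trans (utility_nondecreasing hu fw).
  by rewrite u0 lee_fin; lra.
rewrite (max_idPl _) ?oppr_ge0 ?(ltW fw)// /uhat normrN (ltr0_norm fw) opprK u0.
case uf : (u (f w)) => [r| |].
- by rewrite -EFinN -!EFinD lee_fin; lra.
- by have := unpy (f w); rewrite uf.
- by rewrite /= addey ?leey.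
Qed.

(** For the converse, [g^- <= f + |g + f|] is a convex combination of [(1 + e) f] and
    [|g + f| (1 + e) / e] with weights [1 / (1 + e)] and [e / (1 + e)]. The radius [e / (1 + e)]
    makes the modular of the second term at most 1. *)
Lemma intDsetP (f : Om -> R) : L f -> (forall w, 0 <= f w) ->
  intDset P u (fun w => - f w) <->
  exists e : R, 0 < e /\ Dset P u (fun w => - (1 + e) * f w).
Proof.
have yG := young_uhat hu hA1.
move=> Lf f0; split.
  move=> [_ [del [del0 hdel]]].
  have [c [c0 hc]] := luxemburg_witness yG Lf.
  (* [c] bounds the Luxemburg norm of [f], so [e f] has norm at most [del / 2]. *)
  pose e := del / (2 * c); have e0 : 0 < e by rewrite divr_gt0// mulr_gt0.
  exists e; split => //; apply: hdel; first exact: (orlicz_scale yG).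
  apply: (@le_lt_trans _ _ (del / 2)); last by lra.
  apply: luxemburg_le; split; first by rewrite divr_gt0.
  have [_ _ ev _] := yG.
  rewrite (eq_integral (fun w => uhat u (f w / c)))// => w _.
  rewrite -[RHS]ev; congr (uhat u _); rewrite /e; field.
  by rewrite !gt_eqF.
move=> [e [e0 /DsetP[Lef hef]]]; split.
  have := orlicz_scale yG (-1) Lf; congr orlicz; apply/funext => w.
  by rewrite mulN1r.
have e1 : 0 < 1 + e by lra.
exists (e / (1 + e)); split; first exact: divr_gt0.
move=> g Lg /(luxemburg_lt yG) h; apply/DsetP; split => //.
have Lr : L (fun w => g w - - f w).
  by have := orliczD yG Lg Lf; congr orlicz; apply/funext => w; rewrite opprK.
move/(_ Lr) in h.
have mg := orlicz_measurable Lg; have mr := orlicz_measurable Lr.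
have mf := orlicz_measurable Lf.
pose t := (1 + e)^-1; have t0 : 0 <= t by rewrite invr_ge0 ltW.
have t1 : 0 <= 1 - t by rewrite subr_ge0 invf_le1//; lra.
have mG1 : measurable_fun setT (fun w => uhat u (Num.max (- (- (1 + e) * f w)) 0)%R).
  apply: (measurable_young_comp yG); apply: measurable_maxr => //.
  by apply: measurableT_comp => //; exact: measurable_funM.
have mG2 : measurable_fun setT (fun w => uhat u ((g w - - f w) / (e / (1 + e)))%R).
  by apply: (measurable_young_comp yG); exact: measurable_funM.
apply: (@le_lt_trans _ _ (\int[P]_w (t%:E * uhat u (Num.max (- (- (1 + e) * f w)) 0)%R +
    (1 - t)%:E * uhat u ((g w - - f w) / (e / (1 + e)))%R))%E).
  apply: ge0_le_integral => //.
  - by move=> w _; exact: young_ge0.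
  - apply: (measurable_young_comp yG); apply: measurable_maxr => //.
    exact: measurableT_comp.
  - by apply: emeasurable_funD; exact: measurable_funeM.
  move=> w _; have [_ _ _ cG] := yG.
  have t01 : 0 <= t <= 1 by rewrite t0/= -subr_ge0.
  rewrite -(young_norm yG ((g w - - f w) / _)).
  apply: le_trans (cG _ _ _ t01); apply: (young_le yG).
  have -> : Num.max (- (- (1 + e) * f w)) 0 = (1 + e) * f w.
    by rewrite mulNr opprK (max_idPl _)// mulr_ge0// ltW.
  have -> : t * ((1 + e) * f w) = f w by rewrite /t mulKf// gt_eqF.
  have -> : (1 - t) * `|(g w - - f w) / (e / (1 + e))| = `|g w + f w|.
    rewrite normrM opprK (gtr0_norm (_ : 0 < (e / (1 + e))^-1)).
      by rewrite /t; field; rewrite !gt_eqF.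
    by rewrite invr_gt0 divr_gt0.
  rewrite [leRHS]ger0_norm ?addr_ge0// ger0_norm ?le_max ?lexx ?orbT//.
  rewrite ge_max addr_ge0// andbT.
  by have := ler_norm (- (g w + f w)); rewrite normrN; lra.
rewrite ge0_integralD//; last 4 first.
- by move=> w _; rewrite mule_ge0 ?lee_fin// (young_ge0 yG).
- exact: measurable_funeM.
- by move=> w _; rewrite mule_ge0 ?lee_fin// (young_ge0 yG).
- exact: measurable_funeM.
rewrite !ge0_integralZl_EFin//; try by move=> w _; exact: young_ge0.
rewrite lte_add_pinfty// lte_mul_pinfty ?lee_fin//.
by apply: le_lt_trans h _; exact: ltry.
Qed.

End Utility.

(** * The dual problem *)

Section AttainableClaims.
Context {d : measure_display} {Om : measurableType d} {R : realType}.
Variables (P : probability Om R) (T : \bar R) (F : R -> set (set Om)).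
Context {n : nat}.
Variables (S : R -> Om -> 'rV[R]_n) (a : \bar R) (u : R -> \bar R) (W : Om -> R).
Hypotheses (hT : (0 < T)%E) (hu : utility a u) (hA1 : assumption_A1 a u)
  (hW : orlicz P (uhat u) W).
Local Notation L := (orlicz P (uhat u)).
Variable k : Om -> R.
Hypothesis Kk : KW P T F S W k.

Let yG : young (uhat u) := young_uhat hu hA1.

Lemma KW_lower_bound : exists c, {ae P, forall w, - (c * W w) <= k w}.
Proof.
have [_ [H [X [[_ [c [c0 hc]]] ht]]]] := Kk.
exists c; move: ht hc; rewrite /terminal /timeset; case: T hT => [t| |]// t0 ht hc.
  apply: filterS2 ht hc => w <-; apply; split => //=.
  by move: t0; rewrite lte_fin => /ltW.
apply: filterS2 ht hc => w cv hX; apply: (cvgr_to_ge cv).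
exists 0; split => // s s0; apply: hX; split; first exact: ltW.
by rewrite leey.
Qed.

(** Admissibility bounds [k] by a multiple of [W] from below only; the cap adds the upper bound that
    puts the claim in the Orlicz space. *)
Definition capped (N : R) (w : Om) : R := Num.min (k w) N.

Lemma capped_orlicz N : L (capped N).
Proof.
have [mk _] := Kk; have [c hc] := KW_lower_bound.
have mc : measurable_fun setT (capped N) by exact: measurable_minr.
have LW : L (fun w => `|c| * `|W w| + cst `|N| w).
  by apply: (orlicz_lin yG); [exact: (orlicz_norm yG)|exact: (orlicz_uhat_cst P hu hA1)].
apply: (orlicz_le yG mc LW); apply: filterS hc => w hw.
have cW0 : 0 <= `|c| * `|W w| by rewrite mulr_ge0.
rewrite [leRHS]ger0_norm ?addr_ge0// /capped ler_norml.
have := ler_norm (c * W w); rewrite normrM.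
have := ler_norm N; have := ler_norm (- N); rewrite normrN /= => h1 h2 h3.
by rewrite ge_min le_min; apply/andP; split; [apply/andP; split; lra|apply/orP; right; lra].
Qed.

Lemma CW_capped N f t : L f -> ae_le P (cst 0) f -> 0 <= t ->
  CW P T F S u W (fun w => - t * f w + capped N w).
Proof.
move=> Lf f0 t0; have Lc := capped_orlicz N.
split; first exact: (orlicz_lin yG).
have [mk _] := Kk; have mf := orlicz_measurable Lf; have mc := orlicz_measurable Lc.
exists k, (fun w => (k w - capped N w) + t * f w); split => //.
- apply: measurable_funD; first exact: measurable_funB.
  exact: measurable_funM.
- apply: filterS f0 => w /= fw; rewrite addr_ge0 ?mulr_ge0// subr_ge0.
  by rewrite /capped ge_min lexx.
- by apply: aeW => w; ring.
Qed.

Section Polar.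
Variable Q : (Om -> R) -> R.
Hypothesis pQ : polarCW P T F S u W Q.

Let dQ : is_dual P (uhat u) Q := proj1 pQ.

Lemma polar_capped_le N f t : L f -> ae_le P (cst 0) f -> 0 <= t ->
  Q (capped N) <= t * Q f.
Proof.
move=> Lf f0 t0; have Lc := capped_orlicz N.
have := proj2 pQ _ (CW_capped N Lf f0 t0).
by rewrite (dual_lin dQ)//; lra.
Qed.

Lemma polar_capped N : Q (capped N) <= 0.
Proof.
have := polar_capped_le N (orlicz0 P yG) _ (lexx 0); rewrite mul0r; apply.
by apply: aeW => w /=.
Qed.

(* The truncated claim [k /\ N] may be lowered by any multiple of [f]. *)
Lemma polar_ge0 : dual_le P (uhat u) (fun=> 0) Q.
Proof.
move=> f Lf f0; rewrite leNgt; apply/negP => Qf.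
pose t := (`|Q (capped 0)| + 1) / - Q f.
have t0 : 0 <= t by rewrite divr_ge0// ?addr_ge0//; lra.
have := polar_capped_le 0 Lf f0 t0.
have -> : t * Q f = - (`|Q (capped 0)| + 1) by rewrite /t; field; rewrite lt_eqF.
by have := ler_norm (- Q (capped 0)); rewrite normrN; lra.
Qed.

End Polar.

End AttainableClaims.

Section RegularPart.
Context {d : measure_display} {Om : measurableType d} {R : realType}.
Variables (P : probability Om R) (G : R -> \bar R).
Hypothesis yG : young G.

Lemma regular_integrable Q Qr Qs (phi : Om -> R) (f : Om -> R) :
  decomposes P G Q Qr Qs phi -> measurable_fun setT phi -> ae_le P (cst 0) phi ->
  orlicz P G f -> P.-integrable setT (fun w => (f w * phi w)%:E).
Proof.
move=> [_ _ _ eQr] mphi phi0 Lf; have mf := orlicz_measurable Lf.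
have Lnf := orlicz_norm yG Lf.
apply/integrableP; split; first by apply/measurable_EFinP; exact: measurable_funM.
rewrite -[X in (X < _)%E](_ : (Qr (fun w => `|f w|))%:E = _) ?ltry// eQr//.
have mnf := orlicz_measurable Lnf.
apply: ae_eq_integral => //.
- by apply/measurable_EFinP; exact: measurable_funM.
- by apply/measurable_EFinP; apply: measurableT_comp => //; exact: measurable_funM.
- by apply: filterS phi0 => w pw _; rewrite /= normrM (ger0_norm pw).
Qed.

End RegularPart.

(** * First order conditions at a solution of the dual problem *)

Section DualSolution.
Context {d : measure_display} {Om : measurableType d} {R : realType}.
Variables (P : probability Om R) (T : \bar R) (F : R -> set (set Om)).
Context {n : nat}.
Variables (S : R -> Om -> 'rV[R]_n) (a : \bar R) (u : R -> \bar R) (W : Om -> R)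
  (x lam : R) (Q Qr Qs : (Om -> R) -> R) (phi : Om -> R) (k : Om -> R).
Hypotheses (hT : (0 < T)%E) (hu : utility a u) (hA1 : assumption_A1 a u)
  (hA2 : assumption_A2 P u) (hW : orlicz P (uhat u) W)
  (hsol : dual_solution P T F S u W x lam Q Qr Qs phi)
  (Kk : KW P T F S W k)
  (fxk : {ae P, forall w, (optimal_claim u lam phi w - x%:E)%E = (k w)%:E}).
Local Notation L := (orlicz P (uhat u)).
Local Notation I := (inv_du a u).
Local Notation fxm := (optimal_loss u lam phi).
Local Notation normQs := (dual_norm P (uhat u) Qs).

Let yG : young (uhat u) := young_uhat hu hA1.
Let Lcst := orlicz_uhat_cst P hu hA1.

Let lam0 : 0 < lam. Proof. by case: hsol. Qed.

Lemma solution_decomposes : decomposes P (uhat u) Q Qr Qs phi.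
Proof. by case: hsol => _ _ []. Qed.
Let dec := solution_decomposes.

Lemma solution_density_measurable : measurable_fun setT phi.
Proof. by case: hsol => _ _ [_ []]. Qed.
Let mphi := solution_density_measurable.

Lemma solution_polar : polarCW P T F S u W Q.
Proof. by case: hsol => _ [[]]. Qed.
Let pQ := solution_polar.
Let Q0 := polar_ge0 hT hu hA1 hW Kk pQ.

Let Q1 : Q (cst 1) = 1. Proof. by case: hsol => _ [[]]. Qed.

Let phi0 : ae_le P (cst 0) phi := density_ge0 yG (Lcst 1) Q0 dec mphi.

Lemma solution_singular_ge0 : dual_le P (uhat u) (fun=> 0) Qs.
Proof. exact: (singular_part_ge0 yG (Lcst 1) Q0 dec mphi). Qed.
Let Qs0 := solution_singular_ge0.

Let Qs_dual : is_dual P (uhat u) Qs. Proof. by case: dec => _ []. Qed.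

(** [f_x] is infinite where [phi] vanishes, yet it agrees almost surely with the finite [k + x]. *)
Lemma solution_claimE : {ae P, forall w, 0 < phi w /\ k w + x = I (lam * phi w)}.
Proof.
apply: filterS2 phi0 fxk => w /= pw; rewrite /optimal_claim.
have [->|pn0] := eqVneq (phi w) 0.
  by rewrite mulr0 /dPhi eqxx.
have {}pw : 0 < phi w by rewrite lt_neqAle eq_sym pn0.
rewrite (dPhi_pos hu hA1) ?mulr_gt0// -EFinN opprK -EFinB => -[<-].
by split => //; rewrite subrK.
Qed.

Lemma optimal_loss_ge0 w : 0 <= fxm w.
Proof. by rewrite /optimal_loss fine_ge0// le_max lexx orbT. Qed.

Lemma measurable_optimal_loss : measurable_fun setT fxm.
Proof.
rewrite (_ : fxm = (fun y => fine (maxe (dPhi u y) 0)) \o (fun w => lam * phi w)).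
  apply: measurableT_comp; first exact: (measurable_pos_dPhi hu hA1).
  exact: measurable_funM.
by apply/funext => w; rewrite /optimal_loss /optimal_claim oppeK.
Qed.

Lemma optimal_lossE : {ae P, forall w, fxm w = Num.max (- (k w + x)) 0}.
Proof.
apply: filterS solution_claimE => w [pw ->].
rewrite /optimal_loss /optimal_claim oppeK (dPhi_pos hu hA1) ?mulr_gt0//.
by rewrite -EFin_max.
Qed.

Lemma orlicz_optimal_loss : L fxm.
Proof.
have [c hc] := KW_lower_bound hT Kk.
have LW : L (fun w => c * W w + cst `|x| w) by exact: (orlicz_lin yG).
apply: (orlicz_le yG measurable_optimal_loss (orlicz_norm yG LW)).
apply: filterS2 optimal_lossE hc => w -> hw /=; rewrite normr_id.
rewrite ger0_norm ?le_max ?lexx ?orbT// ge_max normr_ge0 andbT.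
have := ler_norm (c * W w + `|x|); have := ler_norm (- x); rewrite normrN; lra.
Qed.
Let Lloss := orlicz_optimal_loss.

(** Membership in [NW] provides some decomposition with this property; by uniqueness its density
    agrees with [phi] almost surely. *)
Lemma solution_LPhi : LPhi P u phi.
Proof.
have [_ [_ [Qr' [Qs' [phi' [[dec' _] _ [mphi' phi'0 hphi']]]]]] _ _] := hsol.
split => //; rewrite (ae_eq_integral (fun w => Phi u (phi' w))) //.
- exact: (measurable_Phi_comp hu hA1).
- exact: (measurable_Phi_comp hu hA1).
have h1 := decomposes_density_le yG (Lcst 1) Q0 dec mphi dec' mphi'.
have h2 := decomposes_density_le yG (Lcst 1) Q0 dec' mphi' dec mphi.
apply: filterS2 h1 h2 => w h1 h2 _; congr (Phi u _).
by apply/eqP; rewrite eq_le h1 h2.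
Qed.

Lemma solution_density_integrable f : L f ->
  P.-integrable setT (fun w => (f w * phi w)%:E).
Proof. by move=> Lf; exact: (regular_integrable yG dec mphi phi0 Lf). Qed.

Lemma Phi_density_integrable s : 0 < s ->
  P.-integrable setT (fun w => Phi u (s * phi w)).
Proof.
move=> s0; have [_ _ hPhi] := solution_LPhi.
have iphi : P.-integrable setT (EFin \o phi).
  apply: eq_integrable (solution_density_integrable (Lcst 1)) => // w _.
  by rewrite /= mul1r.
apply: (Phi_scale_integrable hu hA1 hA2 mphi phi0 _ iphi hPhi s0).
rewrite lt_neqAle eq_sym; apply/andP; split; last first.
  have -> : (\int[P]_w (phi w)%:E = \int[P]_w (Num.max (phi w) 0)%:E)%E.
    apply: ae_eq_integral => //.
    - exact: measurable_int iphi.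
    - by apply/measurable_EFinP; apply: measurable_maxr.
    - by apply: filterS phi0 => w pw _; rewrite (max_idPl pw).
  by apply: integral_ge0 => w _; rewrite lee_fin le_max lexx orbT.
(* A zero total mass would make [phi] vanish almost surely, against [phi > 0]. *)
apply/negP => /eqP i0.
have : ae_eq P setT (EFin \o phi) (cst 0%E).
  apply/ae_eq_integral_abs => //; first exact: measurable_int iphi.
  rewrite -[RHS]i0; apply: ae_eq_integral => //.
  - by apply: measurableT_comp => //; exact: measurable_int iphi.
  - exact: measurable_int iphi.
  - by apply: filterS phi0 => w pw _; rewrite gee0_abs.
move=> z0; have : {ae P, forall w : Om, False}.
  by apply: filterS2 z0 solution_claimE => w /(_ Logic.I) [->] []; rewrite ltxx.
move=> [N [mN N0 hN]]; have NT : N = setT by apply/seteqP; split => // w _; exact: hN.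
have := probability_setT P; rewrite -NT => N1.
by have := @oner_eq0 R; rewrite -eqe -N1 N0 eqxx.
Qed.

Lemma singular_loss_ge0 : 0 <= Qs fxm.
Proof. by apply: Qs0 => //; apply: aeW => w; exact: optimal_loss_ge0. Qed.

Lemma loss_density_integrable : P.-integrable setT (fun w => (fxm w * phi w)%:E).
Proof. exact: solution_density_integrable. Qed.

Local Notation J := (fun w => ((k w + x) * phi w)%:E).
Local Notation p := (fun s w => fine (Phi u (s * phi w))).

Let mJ : measurable_fun setT J.
Proof.
have [mk _] := Kk; apply/measurable_EFinP; apply: measurable_funM => //.
exact: measurable_funD.
Qed.

Let integrable_p s : 0 < s -> P.-integrable setT (EFin \o p s).
Proof.
move=> s0; have ip := Phi_density_integrable s0.
apply: (le_integrable measurableT _ _ ip).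
  apply/measurable_EFinP; apply: measurableT_comp => //.
  exact: measurable_int ip.
by move=> w _ /=; case: (Phi u (s * phi w)) => [r| |] //=; exact: leey.
Qed.

Let integral_p s : 0 < s ->
  (\int[P]_w Phi u (s * phi w)%R = (fine (\int[P]_w (p s w)%:E))%:E)%E.
Proof.
move=> s0; have ip := Phi_density_integrable s0.
rewrite fineK; last by apply: integrable_fin_num => //; exact: integrable_p.
apply: ae_eq_integral => //.
- exact: measurable_int ip.
- exact: measurable_int (integrable_p s0).
- apply: filterS solution_claimE => w [pw _] _.
  by rewrite (Phi_pos hu hA1) ?mulr_gt0.
Qed.

(** Multipliers tending to [lam] from below; [m.+2] keeps them above [lam / 2], so that one
    dominating function serves all [m]. [D_ m] is the difference quotient of [Phi (s phi)] in [s],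
    with the sign changed. *)
Let mu_ (m : nat) : R := lam * (1 - m.+2%:R^-1).
Let h_ (m : nat) : R := lam * m.+2%:R^-1.
Let D_ m w : R := (p (mu_ m) w - p lam w) / h_ m.

Let h_gt0 m : 0 < h_ m. Proof. by rewrite mulr_gt0// invr_gt0. Qed.

Let mu_half m : lam / 2 <= mu_ m < lam.
Proof.
have m0 : 0 < m.+2%:R^-1 :> R by rewrite invr_gt0.
have m2 : m.+2%:R^-1 <= 2^-1 :> R by rewrite lef_pV2 ?posrE// ler_nat.
rewrite /mu_ ler_pM2l// -[X in _ < X]mulr1 ltr_pM2l//.
by move: (m.+2%:R^-1) m0 m2 => q *; apply/andP; split; lra.
Qed.

Let mu_h m : lam - mu_ m = h_ m. Proof. by rewrite /mu_ /h_; ring. Qed.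

Let mu_gt0 m : 0 < mu_ m.
Proof. by have /andP[+ _] := mu_half m; apply: lt_le_trans; rewrite divr_gt0. Qed.

Let integrable_D m : P.-integrable setT (EFin \o D_ m).
Proof.
have i1 := integrable_p (mu_gt0 m); have i2 := integrable_p lam0.
apply: eq_integrable (integrableZr measurableT (h_ m)^-1
  (integrableB measurableT i1 i2)) => // w _.
Qed.

(* Optimality of [lam] against the smaller multiplier [mu_ m], with the same [Q]. *)
Let optimality m : ((x + normQs)%:E <= \int[P]_w (D_ m w)%:E)%E.
Proof.
have [_ hN hparts hopt] := hsol.
have := hopt _ _ _ _ _ (mu_gt0 m) hN hparts.
have m0 := mu_gt0 m.
have i1 := integrable_p m0; have i2 := integrable_p lam0.
rewrite /dual_objective !integral_p// -!EFinD lee_fin => h.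
have -> : (\int[P]_w (D_ m w)%:E =
   ((fine (\int[P]_w (p (mu_ m) w)%:E)%E - fine (\int[P]_w (p lam w)%:E)%E) / h_ m)%:E)%E.
  rewrite (eq_integral (fun w => ((EFin \o p (mu_ m)) w - (EFin \o p lam) w) * (h_ m)^-1%:E)%E)//.
  rewrite integralZr//; last exact: (integrableB measurableT i1 i2).
  rewrite integralB_EFin// EFinM EFinB !fineK//; exact: integrable_fin_num.
rewrite lee_fin ler_pdivlMr// -mu_h; move: h.
by rewrite mulrBr [(x + _) * lam]mulrC [(x + _) * mu_ m]mulrC; lra.
Qed.

Let D_bounds m w : 0 < phi w -> k w + x = I (lam * phi w) ->
  (k w + x) * phi w <= D_ m w <= I (mu_ m * phi w) * phi w.
Proof.
move=> pw ->; have /andP[_ m1] := mu_half m.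
have y0 : 0 < mu_ m * phi w by rewrite mulr_gt0.
have yz : mu_ m * phi w < lam * phi w by rewrite ltr_pM2r.
have := Phi_slope hu hA1 y0 yz; rewrite -mulrBl mu_h /D_.
have ass r : r * phi w * h_ m = r * (h_ m * phi w) by ring.
by rewrite ler_pdivlMr// ler_pdivrMr// !ass.
Qed.

(** A difference quotient taken entirely to the left of all [mu_ m]: it dominates
    [I (mu_ m phi) phi] because [I] is nonincreasing, and it is integrable by (A2). *)
Let U w : R := (p (lam / 4) w - p (lam / 2) w) / (lam / 4).

Let D_le_U m w : 0 < phi w -> I (mu_ m * phi w) * phi w <= U w.
Proof.
move=> pw; have /andP[m1 _] := mu_half m.
have y0 : 0 < lam / 4 * phi w by rewrite mulr_gt0// divr_gt0.
have yz : lam / 4 * phi w < lam / 2 * phi w by rewrite ltr_pM2r//; have := lam0; lra.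
have yz' : lam / 2 * phi w <= mu_ m * phi w by rewrite ler_pM2r.
have /andP[+ _] := Phi_slope hu hA1 y0 yz.
have -> : lam / 2 * phi w - lam / 4 * phi w = (lam / 4) * phi w by field.
rewrite /U ler_pdivlMr ?divr_gt0// => h.
apply: le_trans h; rewrite [leLHS](_ : _ = I (mu_ m * phi w) * (lam / 4 * phi w)); last by ring.
rewrite ler_pM2r ?mulr_gt0 ?divr_gt0//.
exact: (inv_du_nonincreasing hu hA1 (lt_trans y0 yz) yz').
Qed.

Let integrable_U : P.-integrable setT (EFin \o U).
Proof.
have i1 := integrable_p (divr_gt0 lam0 (ltr0n R 4 : is_true (0 < 4%:R))).
have i2 := integrable_p (divr_gt0 lam0 (ltr0n R 2 : is_true (0 < 2%:R))).
apply: eq_integrable (integrableZr measurableT (lam / 4)^-1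
  (integrableB measurableT i1 i2)) => // w _.
Qed.

Let D_cvg w : 0 < phi w -> k w + x = I (lam * phi w) ->
  D_ m w @[m --> \oo] --> (k w + x) * phi w.
Proof.
move=> pw eI; apply/cvgrPdist_lt => e e0.
have [del del0 hdel] := inv_du_cont hu hA1 (mulr_gt0 lam0 pw) (divr_gt0 e0 pw).
have c0 : 0 < del / (lam * phi w) by rewrite divr_gt0// mulr_gt0.
have [N _ hN] := near_infty_natSinv_lt (PosNum c0).
exists N => // m /= Nm.
have /andP[b1 b2] := D_bounds m pw eI.
have /andP[_ m1] := mu_half m.
rewrite distrC ger0_norm ?subr_ge0//.
apply: (@le_lt_trans _ _ (I (mu_ m * phi w) * phi w - (k w + x) * phi w)); first lra.
rewrite eI -mulrBl -ltr_pdivlMr//.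
apply: le_lt_trans (ler_norm _) _; apply: hdel; first by rewrite mulr_gt0.
rewrite distrC -mulrBl mu_h gtr0_norm ?mulr_gt0//.
rewrite /h_ mulrAC mulrC -ltr_pdivlMr ?mulr_gt0//.
apply: le_lt_trans (hN m.+1 (leqW Nm)); rewrite /=.
by [].
Qed.

(** The quotients [D_ m] lie between [- f_x^- phi] and [U], both integrable, and dominated
    convergence carries the optimality inequality to the limit [f_x phi]. *)
Lemma first_order_condition : P.-integrable setT J /\
  ((x + normQs)%:E <= \int[P]_w J w)%E.
Proof.
have iloss := loss_density_integrable.
have ig : P.-integrable setT (fun w => ((fxm w * phi w)%:E + `|(U w)%:E|)%E).
  apply: (integrableD measurableT iloss).
  exact: (integrable_abse integrable_U).
have [iJ _ cv] : [/\ P.-integrable setT J,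
    [sequence \int[P]_w `|(D_ m w)%:E - J w|]_m @ \oo --> 0%E &
    [sequence \int[P]_w (D_ m w)%:E]_m @ \oo --> (\int[P]_w J w)%E]%E.
  apply: (@dominated_convergence _ _ _ P setT measurableT
    (fun m w => (D_ m w)%:E) _ (fun w => ((fxm w * phi w)%:E + `|(U w)%:E|)%E)) => //.
  - by move=> m; exact: measurable_int (integrable_D m).
  - apply: filterS solution_claimE => w [pw eI] _; apply: cvg_EFin; first exact: nearW.
    exact: D_cvg.
  - apply: filterS2 solution_claimE optimal_lossE => w [pw eI] el m _.
    have /andP[b1 b2] := D_bounds m pw eI; have b3 := D_le_U m pw.
    rewrite -EFinD lee_fin ler_norml.
    have b4 : - (fxm w) * phi w <= (k w + x) * phi w.
      by rewrite ler_pM2r// el lerNl le_max lexx.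
    have := ler_norm (U w); have := mulr_ge0 (optimal_loss_ge0 w) (ltW pw).
    by have := normr_ge0 (U w); rewrite mulNr in b4; lra.
split => //; apply: (cvge_to_ge cv); apply: nearW => m.
exact: optimality.
Qed.

(** [Q] is at most [x] on a capped claim plus [x], while this claim is at least [- f_x^-], so its
    [Qs]-value is at least [- Qs (f_x^-)]. The difference bounds the regular part, and dominated
    convergence lifts the cap. *)
Lemma budget_le : (\int[P]_w J w <= (x + Qs fxm)%:E)%E.
Proof.
have [iJ _] := first_order_condition.
have [ocr _ eQ eQr] := dec; have dQ := proj1 pQ; have dr := proj1 ocr.
(* The summand [|x|] keeps the cap plus [x] nonnegative: capping leaves the losses unchanged and
   does not increase [|k + x|]. *)
pose N_ (m : nat) : R := m%:R + `|x|.
pose f_ m w := 1 * capped k (N_ m) w + cst x w.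
have Lc m : L (capped k (N_ m)) by exact: (capped_orlicz hT hu hA1 hW Kk).
have Lf m : L (f_ m) by apply: (orlicz_lin yG).
have bound m : ((\int[P]_w (f_ m w * phi w)%:E) <= (x + Qs fxm)%:E)%E.
  rewrite -eQr// lee_fin.
  have e1 : Q (f_ m) = Q (capped k (N_ m)) + x.
    rewrite /f_ (dual_lin dQ)// mul1r; congr (_ + _).
    have := dual_scale yG dQ x (Lcst 1); rewrite Q1 mulr1 => e; rewrite -[RHS]e.
    by congr Q; apply/funext => w; rewrite /= mulr1.
  have h1 := polar_capped hT hu hA1 hW Kk pQ (N_ m).
  have h2 : - Qs fxm <= Qs (f_ m).
    rewrite -mulN1r -(dual_scale yG Qs_dual)//.
    apply: (dual_le_ae yG Qs_dual Qs0) => //; first exact: (orlicz_scale yG).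
    apply: filterS optimal_lossE => w el; rewrite mulN1r el /f_ mul1r /capped /=.
    have := normr_ge0 (k w + x).
    have := ler_norm (- x); rewrite normrN => xx.
    have m0 : 0 <= m%:R :> R by [].
    rewrite lerNl /N_; case: (leP (k w) _) => hk _; rewrite le_max.
      by rewrite lexx.
    by apply/orP; right; lra.
  by have := eQ _ (Lf m); lra.
have [_ _ cv] : [/\ P.-integrable setT J,
    [sequence \int[P]_w `|(f_ m w * phi w)%:E - J w|]_m @ \oo --> 0%E &
    [sequence \int[P]_w (f_ m w * phi w)%:E]_m @ \oo --> (\int[P]_w J w)%E]%E.
  apply: (@dominated_convergence _ _ _ P setT measurableT
    (fun m w => (f_ m w * phi w)%:E) _ (abse \o J)) => //.
  - by move=> m; exact: measurable_int (solution_density_integrable (Lf m)).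
  - apply: aeW => w _; apply: cvg_EFin; first exact: nearW.
    apply: cvgMr_tmp; apply: cvg_near_cst.
    near=> m; rewrite /f_ /capped /= mul1r; congr (_ + _); apply/min_idPl.
    rewrite /N_; apply: (@le_trans _ _ (m%:R : R)); last by rewrite lerDl.
    near: m; exact: nbhs_infty_ger.
  - exact: integrable_abse.
  - apply: filterS phi0 => w /= pw m _; rewrite lee_fin !normrM ler_wpM2r//.
    rewrite /f_ mul1r /capped /=; case: (leP (k w) _) => // hk.
    have m0 : 0 <= m%:R :> R by [].
    have := ler_norm (- x); rewrite normrN => xx.
    rewrite /N_ in hk *.
    have hm : 0 <= m%:R + `|x| + x by lra.
    have hm2 : 0 <= k w + x by lra.
    by rewrite (ger0_norm hm) (ger0_norm hm2); lra.
by apply: (cvge_to_le cv); apply: nearW => m; exact: bound.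
Unshelve. all: by end_near. Qed.

(** At [y = lam phi] the inequality [Phi y = u (I y) - y I y >= u 0] bounds [uhat (f_x^-)] by
    [lam phi f_x^-], which is integrable as the loss lies in the Orlicz space. *)
Lemma integral_uhat_loss : (\int[P]_w uhat u (fxm w) < +oo)%E.
Proof.
have iloss := loss_density_integrable.
apply: (@le_lt_trans _ _ (\int[P]_w (lam%:E * (fxm w * phi w)%:E))%E); last first.
  by apply: integrable_lty => //; exact: integrableZl.
have mG := measurable_young_comp yG measurable_optimal_loss.
have mr : measurable_fun setT (fun w => lam%:E * (fxm w * phi w)%:E)%E.
  by apply: measurable_funeM; exact: measurable_int iloss.
have -> : (\int[P]_w (lam%:E * (fxm w * phi w)%:E) =
    \int[P]_w (maxe (lam%:E * (fxm w * phi w)%:E) 0))%E.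
  apply: ae_eq_integral => //; first exact: measurable_maxe.
  apply: filterS phi0 => w /= pw _; rewrite -EFinM (max_idPl _)// lee_fin.
  by rewrite !mulr_ge0 ?optimal_loss_ge0// ltW.
apply: ae_ge0_le_integral => //.
- by move=> w _; exact: young_ge0.
- by move=> w _; rewrite le_max lexx orbT.
- exact: measurable_maxe.
apply: filterS2 solution_claimE optimal_lossE => w [pw eI] el _.
rewrite el eI le_max; apply/orP; left.
have y0 : 0 < lam * phi w by rewrite mulr_gt0.
have [h1 _] := inv_du_spec hu hA1 y0.
case: (leP (- I (lam * phi w)) 0) => hI.
  by have [-> _ _ _] := yG; rewrite mul0r mule0.
have eN : - `|- I (lam * phi w)| = I (lam * phi w) by rewrite gtr0_norm// opprK.
rewrite (uhat_fin hu) ?eN; last by rewrite (utility_fin hu h1).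
rewrite -EFinM lee_fin.
have := Phi_ge_u0 u (lam * phi w).
rewrite (Phi_pos hu hA1 y0) (utility_fin hu (utility0 hu)) lee_fin /=.
lra.
Qed.

Lemma singular_norm_loss : normQs = Qs fxm.
Proof.
apply/eqP; rewrite eq_le; apply/andP; split.
  have [_ h] := first_order_condition.
  by have := le_trans h budget_le; rewrite lee_fin lerD2l.
have [_ ss _ _] := dec.
apply: (singular_le_dual_norm yG (Lcst 1) ss Qs0 Lloss optimal_loss_ge0).
exact: integral_uhat_loss.
Qed.

Lemma singular_eq0 : (exists e : R, 0 < e /\ Dset P u (fun w => - (1 + e) * fxm w)) ->
  dual_zero P (uhat u) Qs.
Proof.
move=> [e [e0 /(DsetP P hu hA1)[_ he]]].
have e1 : 0 < 1 + e by lra.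
have [_ ss _ _] := dec.
have := singular_le_dual_norm yG (Lcst 1) ss Qs0 (orlicz_scale yG (1 + e) Lloss).
move=> /(_ (fun w => mulr_ge0 (ltW e1) (optimal_loss_ge0 w))) h.
have {}h : (1 + e) * Qs fxm <= normQs.
  rewrite -(dual_scale yG Qs_dual)//; apply: h.
  apply: le_lt_trans he; rewrite le_eqVlt; apply/orP; left; apply/eqP.
  apply: eq_integral => w _; congr (uhat u _).
  by rewrite mulNr opprK (max_idPl _)// mulr_ge0 ?optimal_loss_ge0 ?ltW.
apply: (dual_norm0 yG Qs_dual).
have q0 := singular_loss_ge0.
move: h; rewrite singular_norm_loss mulrDl mul1r gerDl pmulr_rle0//.
Qed.

End DualSolution.

(** * Linear combinations of functionals *)

Section Combination.
Context {d : measure_display} {Om : measurableType d} {R : realType}.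
Variables (P : probability Om R) (G : R -> \bar R).
Hypothesis yG : young G.

Lemma order_continuous_lin c z z' : order_continuous P G z ->
  order_continuous P G z' -> order_continuous P G (fun f => c * z f + z' f).
Proof.
move=> [dz hz] [dz' hz']; split; first exact: (is_dual_lin c dz dz').
move=> I le f g iI lrefl ltr ldir hf hfg hg hinf eps e0.
have c0 : 0 < 2 * (`|c| + 1) by rewrite mulr_gt0// ltr_wpDl.
have [i1 h1] := hz I le f g iI lrefl ltr ldir hf hfg hg hinf _ (divr_gt0 e0 c0).
have e2 : 0 < eps / 2 by rewrite divr_gt0.
have [i2 h2] := hz' I le f g iI lrefl ltr ldir hf hfg hg hinf _ e2.
have [i0 [l1 l2]] := ldir i1 i2; exists i0 => i l0.
have {}h1 := h1 i (ltr _ _ _ l1 l0); have {}h2 := h2 i (ltr _ _ _ l2 l0).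
apply: le_trans (ler_normD _ _) _; rewrite normrM.
have h3 : `|c| * `|z (f i)| <= eps / 2.
  apply: (@le_trans _ _ (`|c| * (eps / (2 * (`|c| + 1))))); first by rewrite ler_wpM2l.
  have c1 : 0 < `|c| + 1 by rewrite ltr_wpDl.
  have -> : `|c| * (eps / (2 * (`|c| + 1))) = (eps / 2) * (`|c| / (`|c| + 1)).
    by field; rewrite gt_eqF.
  by rewrite ler_piMr ?(ltW e2)// ler_pdivrMr// mul1r lerDl.
by move: h2; lra.
Qed.

(** Being positive, [c z] is its own modulus. It lies below [z], hence below the modulus of [z], and
    inherits the disjointness. *)
Lemma singular_scale c z : 0 <= c <= 1 -> singular P G z ->
  dual_le P G (fun=> 0) z -> singular P G (fun f => c * z f).
Proof.
move=> /andP[c0 c1] [dz sz] z0.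
have dcz : is_dual P G (fun f => c * z f).
  have := is_dual_lin c dz (is_dual0 P G); congr is_dual.
  by apply/funext => f; rewrite addr0.
split=> // z' oz'; have [m [m' [mz mz' disj]]] := sz _ oz'.
exists (fun f => c * z f), m'; split => //.
  by split => // f Lf f0 /=; have := mulr_ge0 c0 (z0 f Lf f0); lra.
move=> v dv h1 h2; apply: disj => // f Lf f0.
have [_ hm _ _] := mz; apply: le_trans (hm f Lf f0).
by apply: le_trans (h1 f Lf f0) _; rewrite ler_piMl// z0.
Qed.

End Combination.

(** * Uniqueness of the dual solution *)

Section Uniqueness.
Context {d : measure_display} {Om : measurableType d} {R : realType}.
Variables (P : probability Om R) (T : \bar R) (F : R -> set (set Om)).
Context {n : nat}.
Variables (S : R -> Om -> 'rV[R]_n) (a : \bar R) (u : R -> \bar R) (W : Om -> R)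
  (x lam : R) (Q Qr Qs : (Om -> R) -> R) (phi : Om -> R) (k : Om -> R)
  (lam' : R) (Q' Qr' Qs' : (Om -> R) -> R) (phi' : Om -> R).
Hypotheses (hT : (0 < T)%E) (hu : utility a u) (hA1 : assumption_A1 a u)
  (hA2 : assumption_A2 P u) (hW : orlicz P (uhat u) W)
  (hsol : dual_solution P T F S u W x lam Q Qr Qs phi)
  (hsol' : dual_solution P T F S u W x lam' Q' Qr' Qs' phi')
  (Kk : KW P T F S W k)
  (fxk : {ae P, forall w, (optimal_claim u lam phi w - x%:E)%E = (k w)%:E})
  (Qs_eq0 : dual_zero P (uhat u) Qs).
Local Notation L := (orlicz P (uhat u)).
Local Notation norm z := (dual_norm P (uhat u) z).

Let yG : young (uhat u) := young_uhat hu hA1.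
Let Lcst := orlicz_uhat_cst P hu hA1.
Let lam0 : 0 < lam. Proof. by case: hsol. Qed.
Let lam'0 : 0 < lam'. Proof. by case: hsol'. Qed.
(** The objective is convex in [lam] and [lam Q] taken together rather than in [lam] and [Q]; with
    this weight [lam2 * phi2] is the midpoint of [lam * phi] and [lam' * phi']. *)
Let b := lam / (lam + lam').
Let lam2 := (lam + lam') / 2.
Let lamD : 0 < lam + lam'. Proof. exact: addr_gt0. Qed.
Let b01 : 0 <= b <= 1.
Proof.
rewrite /b divr_ge0 ?(ltW lam0) ?(ltW lamD)//= ler_pdivrMr// mul1r.
by have := lam'0; lra.
Qed.
Let lam2b : lam2 * b = lam / 2.
Proof. by rewrite /lam2 /b; field; rewrite gt_eqF. Qed.
Let lam2b' : lam2 * (1 - b) = lam' / 2.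
Proof. by rewrite /lam2 /b; field; rewrite gt_eqF. Qed.

(* The normalized average of [lam * Q] and [lam' * Q'].  As [Qs = 0], its singular
   part is a multiple of [Qs'], so sums of singular functionals do not occur. *)
Let Q2 f := b * Q f + (1 - b) * Q' f.
Let Qr2 f := b * Qr f + (1 - b) * Qr' f.
Let Qs2 f := (1 - b) * Qs' f.
Let phi2 w := b * phi w + (1 - b) * phi' w.

Let dec := solution_decomposes hsol.
Let dec' := solution_decomposes hsol'.
Let mphi := solution_density_measurable hsol.
Let mphi' := solution_density_measurable hsol'.
Let Q'0 := polar_ge0 hT hu hA1 hW Kk (solution_polar hsol').
Let phi'0 : ae_le P (cst 0) phi' := density_ge0 yG (Lcst 1) Q'0 dec' mphi'.
Let b'01 : 0 <= 1 - b <= 1. Proof. by move: b01 => /andP[? ?]; apply/andP; split; lra. Qed.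

Let is_dual_scale c z : is_dual P (uhat u) z -> is_dual P (uhat u) (fun f => c * z f).
Proof.
move=> dz; have := is_dual_lin c dz (is_dual0 P (uhat u)); congr is_dual.
by apply/funext => f; rewrite addr0.
Qed.

Let parts2 : parts P u Q2 Qr2 Qs2 phi2.
Proof.
have [ocr _ eQ eQr] := dec; have [ocr' ss' eQ' eQr'] := dec'.
have i1 := solution_density_integrable hT hu hA1 hW hsol Kk.
have i2 := solution_density_integrable hT hu hA1 hW hsol' Kk.
split; first split.
- apply: (order_continuous_lin b ocr).
  have := order_continuous_lin (1 - b) ocr' (order_continuous0 P (uhat u)).
  by congr order_continuous; apply/funext => f; rewrite addr0.
- exact: (singular_scale b'01 ss' (solution_singular_ge0 hT hu hA1 hW hsol' Kk)).
- move=> f Lf; rewrite /Q2 /Qr2 /Qs2 (eQ _ Lf) (eQ' _ Lf) (Qs_eq0 Lf); ring.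
- move=> f Lf; rewrite /Qr2 EFinD !EFinM (eQr _ Lf) (eQr' _ Lf).
  rewrite -!integralZl//; [|exact: i2|exact: i1].
  rewrite -integralD//; [|apply: integrableZl => //; exact: i1|
    apply: integrableZl => //; exact: i2].
  apply: eq_integral => w _; rewrite -!EFinM -EFinD; congr EFin.
  by rewrite /phi2 -/b; ring.
have yC := young_conjugate yG.
have [_ _ [_ o1] _] := hsol; have [_ _ [_ o2] _] := hsol'.
exact: (orlicz_lin yC b o1 (orlicz_scale yC (1 - b) o2)).
Qed.

Let Qr1 : Qr (cst 1) = 1.
Proof.
have [_ _ eQ _] := dec; have [_ [[_ Q1] _] _ _] := hsol.
by move: (eQ _ (Lcst 1)); rewrite (Qs_eq0 (Lcst 1)) addr0 => <-.
Qed.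

Let NW2 : NW P T F S u W Q2.
Proof.
have [_ [[pQ Q1] _] _ _] := hsol; have [_ [[pQ' Q'1] _] _ _] := hsol'.
split; first split.
- split.
    apply: (is_dual_lin b (proj1 pQ)); exact: (is_dual_scale (1 - b) (proj1 pQ')).
  move=> f Cf; have h1 := proj2 pQ f Cf; have h2 := proj2 pQ' f Cf.
  rewrite /Q2; have /andP[b0 b1] := b01.
  have := mulr_ge0_le0 b0 h1; have b'0 : 0 <= 1 - b by lra.
  have := mulr_ge0_le0 b'0 h2; lra.
- by rewrite /Q2 Q1 Q'1; ring.
exists Qr2, Qs2, phi2; split; first exact: parts2.
  move=> /(_ _ (Lcst 1)); rewrite /Qr2 Qr1 mulr1.
  have := regular_part_ge0 yG (Lcst 1) Q'0 dec' mphi' (Lcst 1) (aeW _ (fun=> ler01)).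
  have /andP[_ b1] := b01.
  have b'0 : 0 <= 1 - b by lra.
  move=> /(mulr_ge0 b'0) h1 h2.
  have : 0 < b by rewrite divr_gt0.
  by move: h1 h2; lra.
have [_ phi0 hPhi] := solution_LPhi hT hu hA1 hW hsol Kk.
have [_ _ hPhi'] := solution_LPhi hT hu hA1 hW hsol' Kk.
split.
- by apply: measurable_funD; exact: measurable_funM.
- apply: filterS2 phi0 phi'0 => w /= p1 p2; rewrite /phi2.
  have /andP[b0 _] := b01; have /andP[b'0 _] := b'01.
  exact: addr_ge0 (mulr_ge0 b0 p1) (mulr_ge0 b'0 p2).
- apply: integrable_lty => //.
  by apply: (Phi_convex_integrable hu hA1) => //; exact: (Phi_integrable hu hA1).
Qed.

Let norm2 : norm Qs2 <= (1 - b) * norm Qs'.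
Proof.
have [_ [ds' _] _ _] := dec'.
apply: (dual_norm_le yG) => f Lf f1.
have /andP[b'0 _] := b'01.
rewrite normrM ger0_norm// ler_wpM2l//.
exact: (dual_norm_ub ds').
Qed.

Let normQs_ge0 : 0 <= norm Qs.
Proof.
have [_ [ds _] _ _] := dec.
apply: le_trans (normr_ge0 (Qs (cst 0))) _.
apply: (dual_norm_ub ds); first exact: (orlicz0 P yG).
by rewrite (luxemburg_ae0 yG)//; apply: aeW.
Qed.

Let iPhi : P.-integrable setT (fun w => Phi u (lam * phi w)).
Proof. exact: (Phi_density_integrable hT hu hA1 hA2 hW hsol Kk fxk lam0). Qed.

Let objE : dual_objective P u x lam Qs phi =
  (lam * (x + norm Qs) + fine (\int[P]_w Phi u (lam * phi w)%R)%E)%:E.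
Proof. by rewrite /dual_objective EFinD fineK//; exact: integrable_fin_num iPhi. Qed.

(** The claim of the second solution is not yet known to be attainable, so (A2) is not invoked here;
    optimality against the first solution already makes its objective finite. *)
Let iPhi' : P.-integrable setT (fun w => Phi u (lam' * phi' w)).
Proof.
have [_ hN hp _] := hsol; have [_ _ _ hopt'] := hsol'.
have := hopt' _ _ _ _ _ lam0 hN hp; rewrite objE /dual_objective => h.
apply: (Phi_integrable hu hA1); first exact: measurable_funM.
rewrite ltNge leye_eq; apply/negP => /eqP e; move: h.
by rewrite e addey.
Qed.

Let objE' : dual_objective P u x lam' Qs' phi' =
  (lam' * (x + norm Qs') + fine (\int[P]_w Phi u (lam' * phi' w)%R)%E)%:E.
Proof. by rewrite /dual_objective EFinD fineK//; exact: integrable_fin_num iPhi'. Qed.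

Let phi2E w : lam2 * phi2 w = 2^-1 * (lam * phi w) + 2^-1 * (lam' * phi' w).
Proof.
have -> : lam2 * phi2 w = (lam2 * b) * phi w + (lam2 * (1 - b)) * phi' w.
  by rewrite /phi2; ring.
by rewrite lam2b lam2b'; field.
Qed.

Let half : 1 - 2^-1 = 2^-1 :> R. Proof. by lra. Qed.

Let h2 : 0 <= (2^-1 : R) <= 1. Proof. by apply/andP; split; lra. Qed.

Let iPhi2 : P.-integrable setT (fun w => Phi u (lam2 * phi2 w)).
Proof.
have := Phi_convex_integrable hu hA1 h2 (measurable_funM (measurable_cst lam) mphi)
  (measurable_funM (measurable_cst lam') mphi') iPhi iPhi'.
by rewrite half; congr (integrable _ _ _); apply/funext => w; rewrite phi2E.
Qed.

Let objE2 : dual_objective P u x lam2 Qs2 phi2 =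
  (lam2 * (x + norm Qs2) + fine (\int[P]_w Phi u (lam2 * phi2 w)%R)%E)%:E.
Proof. by rewrite /dual_objective EFinD fineK//; exact: integrable_fin_num iPhi2. Qed.

(** The two solutions have equal values and the average cannot do better, so the nonnegative
    midpoint defect of [Phi] has a nonpositive integral. At this stage only [phi] is known to be
    positive; [phi'] might still vanish somewhere. *)
Lemma scaled_density_unique : {ae P, forall w, lam * phi w = lam' * phi' w}.
Proof.
have [_ hN hp hopt] := hsol; have [_ hN' hp' hopt'] := hsol'.
have lam20 : 0 < lam2 by rewrite divr_gt0.
have := hopt _ _ _ _ _ lam20 NW2 parts2.
have := hopt _ _ _ _ _ lam'0 hN' hp'.
have := hopt' _ _ _ _ _ lam0 hN hp.
rewrite objE objE' objE2 !lee_fin => e1 e2 e3.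
have e4 := ler_wpM2l (ltW lam20) norm2; rewrite mulrA lam2b' in e4.
have j1 := integrableZl measurableT (2^-1) iPhi.
have j2 := integrableZl measurableT (2^-1) iPhi'.
have jD := integrableD measurableT j1 j2.
suff hae : {ae P, forall w, (2^-1%:E * Phi u (lam * phi w) +
    2^-1%:E * Phi u (lam' * phi' w) = Phi u (lam2 * phi2 w))%E}.
  have hc := solution_claimE hT hu hA1 hW hsol Kk fxk.
  apply: filterS3 hae hc phi'0 => w eP [pw _] p'w.
  apply: (Phi_midpoint_inj hu hA1); first exact: mulr_gt0.
    by rewrite mulr_ge0// ltW.
  by rewrite eP phi2E.
apply: (integral_le_ae_eq jD iPhi2).
- move=> w; rewrite phi2E; have := Phi_convex hu (lam * phi w) (lam' * phi' w) h2.
  by rewrite half.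
- rewrite integralD// !integralZl//.
  rewrite -(fineK (integrable_fin_num measurableT iPhi)).
  rewrite -(fineK (integrable_fin_num measurableT iPhi')).
  rewrite -(fineK (integrable_fin_num measurableT iPhi2)).
  rewrite -!EFinM -EFinD lee_fin.
  (* Only [Qs'] contributes to [Qs2], so the term [lam * norm Qs] is dropped using its sign. *)
  move: e1 e2 e3 e4; have := mulr_ge0 (ltW lam0) normQs_ge0; rewrite /lam2.
  move: (fine _) (fine _) (fine _) (norm Qs) (norm Qs') (norm Qs2) => A1 A2 A3 B1 B2 B3.
  nra.
Qed.

Let fxm := optimal_loss u lam phi.

Lemma solution_unique : intDset P u (fun w => - fxm w) -> dual_eq P (uhat u) Q' Q.
Proof.
have hae := scaled_density_unique.
have Lloss := orlicz_optimal_loss hT hu hA1 hW hsol Kk fxk.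
move=> /(intDsetP hu hA1 Lloss (optimal_loss_ge0 u lam phi))[e [e0 hD]].
(* With [lam phi = lam' phi'] the second solution has the same optimal claim, so the results of the
   previous part apply to it with the same [k]. *)
have fxk' : {ae P, forall w, (optimal_claim u lam' phi' w - x%:E)%E = (k w)%:E}.
  by apply: filterS2 hae fxk => w ew <-; rewrite /optimal_claim ew.
have Lloss' := orlicz_optimal_loss hT hu hA1 hW hsol' Kk fxk'.
have fxmE : {ae P, forall w, fxm w = optimal_loss u lam' phi' w}.
  by apply: filterS hae => w ew; rewrite /fxm /optimal_loss /optimal_claim ew.
have Qs'_eq0 : dual_zero P (uhat u) Qs'.
  apply: (singular_eq0 hT hu hA1 hA2 hW hsol' Kk fxk'); exists e; split; first exact: e0.
  move/(DsetP P hu hA1) : hD => [L1 hD]; apply/(DsetP P hu hA1).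
  have L2 := orlicz_scale yG (- (1 + e)) Lloss'.
  split; first exact: L2.
  apply: le_lt_trans hD.
  have m1 := orlicz_measurable L1; have m2 := orlicz_measurable L2.
  rewrite le_eqVlt; apply/orP; left; apply/eqP; apply: ae_eq_integral => //.
  - apply: (measurable_young_comp yG); apply: measurable_maxr => //.
    exact: measurableT_comp.
  - apply: (measurable_young_comp yG); apply: measurable_maxr => //.
    exact: measurableT_comp.
  - by apply: filterS fxmE => w ew _; rewrite -ew.
have [_ _ eQ eQr] := dec; have [_ _ eQ' eQr'] := dec'.
have [_ [[_ Q'1] _] _ _] := hsol'.
have Qr'1 : Qr' (cst 1) = 1.
  by move: (eQ' _ (Lcst 1)); rewrite (Qs'_eq0 _ (Lcst 1)) addr0 => <-.
have i1 := solution_density_integrable hT hu hA1 hW hsol Kk.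
have i2 := solution_density_integrable hT hu hA1 hW hsol' Kk.
have scaled f : L f -> lam * Qr f = lam' * Qr' f.
  move=> Lf; apply: EFin_inj; rewrite !EFinM (eQr _ Lf) (eQr' _ Lf) -!integralZl//;
    [|exact: i2|exact: i1].
  apply: ae_eq_integral => //.
  - by apply: measurable_funeM; exact: measurable_int (i1 _ Lf).
  - by apply: measurable_funeM; exact: measurable_int (i2 _ Lf).
  - apply: filterS hae => w ew _; rewrite -!EFinM; congr EFin.
    by rewrite mulrCA ew; ring.
have elam : lam = lam'.
  by have := scaled _ (Lcst 1); rewrite Qr1 Qr'1 !mulr1.
move=> f Lf; rewrite (eQ _ Lf) (eQ' _ Lf) (Qs_eq0 Lf) (Qs'_eq0 _ Lf) !addr0.
have := scaled _ Lf; rewrite -elam => /(mulfI _) -> //.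
by rewrite gt_eqF.
Qed.

End Uniqueness.

Theorem proposition31 (R : realType) (d : measure_display)
  (Om : measurableType d) (P : probability Om R)
  (T : \bar R) (F : R -> set (set Om))
  (n : nat) (S : R -> Om -> 'rV[R]_n)
  (a : \bar R) (u : R -> \bar R) (W : Om -> R) (x : R)
  (lam : R) (Q Qr Qs : (Om -> R) -> R) (phi : Om -> R)
  (hT : (0 < T)%E) (hn : (0 < n)%N)
  (hF : usual_conditions P T F) (hF0 : trivial_initial P F)
  (hS : market P T F S)
  (hu : utility a u) (hA1 : assumption_A1 a u) (hA2 : assumption_A2 P u)
  (hW : orlicz P (uhat u) W) (hW0 : ae_le P (cst 0) W)
  (hsup : exists y : R, (a < y%:E)%E /\
     (ereal_sup [set expected_utility P u (fun w => y + k w)%R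
                | k in KW P T F S W] < u_infty u)%E)
  (hx : (a < x%:E)%E)
  (hsol : dual_solution P T F S u W x lam Q Qr Qs phi) :
  let fx := optimal_claim u lam phi in
  let fxm := optimal_loss u lam phi in
  in_KW P T F S W (fun w => fx w - x%:E)%E ->
  [/\ orlicz P (uhat u) fxm,
      dual_norm P (uhat u) Qs = Qs fxm,
      intDset P u (fun w => - fxm w) <->
        (exists eps : R, 0 < eps /\ Dset P u (fun w => - (1 + eps) * fxm w))
    & intDset P u (fun w => - fxm w) ->
      [/\ dual_zero P (uhat u) Qs,
          dual_eq P (uhat u) Q Qr
        & forall (lam' : R) (Q' Qr' Qs' : (Om -> R) -> R) (phi' : Om -> R),
            dual_solution P T F S u W x lam' Q' Qr' Qs' phi' ->
            dual_eq P (uhat u) Q' Q]].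
Proof.
move=> fx fxm [k [Kk fxk]].
have Lloss := orlicz_optimal_loss hT hu hA1 hW hsol Kk fxk.
have intP := intDsetP hu hA1 Lloss (optimal_loss_ge0 u lam phi).
split => //; first exact: (singular_norm_loss hT hu hA1 hA2 hW hsol Kk fxk).
move=> hint.
have Qs0 : dual_zero P (uhat u) Qs.
  exact: (singular_eq0 hT hu hA1 hA2 hW hsol Kk fxk (proj1 intP hint)).
split => //.
  have [_ _ eQ _] := solution_decomposes hsol.
  by move=> f Lf; rewrite (eQ _ Lf) (Qs0 _ Lf) addr0.
move=> lam' Q' Qr' Qs' phi' hsol'.
exact: (solution_unique hT hu hA1 hA2 hW hsol hsol' Kk fxk Qs0 hint).
Qed.
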